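(* Let $f$ be a piecewise smooth function with rational discontinuities (defined in the context) and let $q\in\mathbb{Q}$. Then for almost every $\alpha\in[0,1)$ there is a constant $C=C(\alpha,f,q)>0$ such that both sets $$\Big\{N\in\mathbb{N}: S_N(f,\alpha,q)\ge C\sum_{i=1}^{K(N)}a_i\Big\},\qquad \Big\{N\in\mathbb{N}: S_N(f,\alpha,q)\le -C\sum_{i=1}^{K(N)}a_i\Big\}$$ have positive upper density.
   Context: For irrational $\alpha=[a_0;a_1,a_2,\dots]$ (continued fraction expansion) with convergent denominators $q_0=1,q_1=a_1,q_{k+1}=a_{k+1}q_k+q_{k-1}$, and $N\in\mathbb{N}$, $K(N)$ denotes the integer $K$ with $q_{K-1}\le N<q_K$. For $1$-periodic integrable $f$, $S_N(f,\alpha,q):=\sum_{n=1}^N f(n\alpha+q)-N\int_0^1 f(x)\,dx$. A $1$-periodic $f:\mathbb{R}\to\mathbb{R}$ is a piecewise smooth function with rational discontinuities if there exist $\nu\ge1$ and rationals $0\le x_1<\dots<x_\nu<1$ such that $f$ is differentiable on $[0,1)\setminus\{x_1,\dots,x_\nu\}$, the restriction of $f'$ to $[0,1)$ extends to a function of bounded variation on $[0,1)$, and $\lim_{\delta\to0}[f(x_i-\delta)-f(x_i+\delta)]\ne0$ for some $i$. The upper density of $A\subseteq\mathbb{N}$ is $\limsup_{M\to\infty}|\{N\le M:N\in A\}|/M$. *)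

(* Defs.v *)
From HB Require Import structures.
From mathcomp Require Import all_boot all_order all_algebra.
From mathcomp Require Import all_classical all_reals all_analysis.
Set Implicit Arguments. Unset Strict Implicit. Unset Printing Implicit Defensive.
Import Order.TTheory GRing.Theory Num.Theory.
Import numFieldNormedType.Exports.
Local Open Scope classical_set_scope.
Local Open Scope ring_scope.

Section Defs.
Variable R : realType.

Definition fracpart (x : R) : R := x - (Num.floor x)%:~R.

Definition cf_x (alpha : R) (k : nat) : R :=
  iter k (fun x => fracpart x^-1) (fracpart alpha).

Definition cf_a (alpha : R) (k : nat) : nat :=
  if k is k'.+1 then `|Num.floor (cf_x alpha k')^-1|%N
  else `|Num.floor alpha|%N.

Fixpoint cfq_aux (a : nat -> nat) (k : nat) : nat :=
  match k with
  | 0 => 1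
  | 1 => a 1
  | (k'.+1 as k1).+1 => a k1.+1 * cfq_aux a k1 + cfq_aux a k'
  end%N.

Definition cf_q (alpha : R) (k : nat) : nat := cfq_aux (cf_a alpha) k.

Definition cf_K (alpha : R) (N : nat) : nat :=
  match pselect (exists K, [&& 0 < K, cf_q alpha K.-1 <= N & N < cf_q alpha K]%N) with
  | left h => ex_minn h
  | right _ => 0%N
  end.

Definition S_N (f : R -> R) (alpha q : R) (N : nat) : R :=
  \sum_(1 <= n < N.+1) f (n%:R * alpha + q)
  - N%:R * Rintegral (@lebesgue_measure R) `[0, 1] f.

Definition upper_density (A : set nat) : \bar R :=
  limn_esup (fun M : nat =>
    ((\sum_(1 <= N < M.+1) (\1_A N : R)) / M%:R)%:E).

Definition BV_01 (g : R -> R) : Prop :=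
  exists M : R, forall (t : nat -> R) (n : nat),
    (forall i, (i <= n)%N -> 0 <= t i < 1) ->
    (forall i, (i < n)%N -> t i <= t i.+1) ->
    \sum_(i < n) `|g (t i.+1) - g (t i)| <= M.

Definition off_disc (xs : seq rat) (x : R) : Prop :=
  forall r, r \in xs -> x != ratr r.

Definition in01 (x : R) : bool := (0 <= x) && (x < 1).

Definition pw_smooth_rat_disc (f : R -> R) : Prop :=
  (forall x, f (x + 1) = f x) /\
  exists xs : seq rat,
    [/\ [&& (0 < size xs)%N,
            sorted (fun x y : rat => x < y) xs &
            all (fun x : rat => (0 <= x) && (x < 1)) xs],
        (forall x : R, in01 x -> off_disc xs x -> derivable f x 1),
        (exists g : R -> R, BV_01 g /\
           (forall x : R, in01 x -> off_disc xs x -> g x = derive1 f x)) &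
        (exists2 r, r \in xs & exists L : R, L != 0 /\
           (fun d : R => f (ratr r - d) - f (ratr r + d)) @ 0^'+ --> L)].

End Defs.

(* Main.v *)
(* For almost every [alpha], infinitely many even [k] and infinitely many odd [k]
   satisfy [q_k = 1 mod D] and [a_(k+1) >= A (a_1 + ... + a_k)], for any [A] and [D]:
   conditionally on the first [k - 2] partial quotients this has probability
   [>= c / (a_1 + ... + a_(k-2))], and these sums are [O(k log k)] with probability
   close to 1, so the conditional probabilities have a divergent sum.

   Write [f = F + sum_j J_j psi (x - j / D)] with the sawtooth [psi], so that the
   [J_j] carry the discontinuities and the Riemann sums of [F] with [n] nodes have
   error [O(1/n)].  For [N = b q_k + N'] with [q_k = 1 mod D], the blocks of length
   [q_k] see [psi] only through the small rotation [th = q_k^2 (alpha - p_k/q_k)], of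
   sign [(-1)^k] and size about [1 / a_(k+1)].  Hence the Birkhoff sum is [I (b th) / th] up
   to [O(a_1 + ... + a_k)] and [o(a_(k+1))], where [I] is a fixed non-zero 1-periodic
   piecewise quadratic function.  Where [I (t0) <> 0] and [b |th|] is close to [t0]
   ([k] even) or to [1 - t0] ([k] odd), the sum has size at least [c a_(k+1)], with
   opposite signs for the two parities of [k]. *)
Require Import Defs.
From HB Require Import structures.
From mathcomp Require Import all_boot all_order all_algebra.
From mathcomp Require Import all_classical all_reals all_analysis.
From mathcomp Require Import measurable_realfun.
From mathcomp Require Import ring lra zify.
Import Order.TTheory GRing.Theory Num.Theory.
Import numFieldNormedType.Exports.
Local Open Scope classical_set_scope.
Local Open Scope ring_scope.

(** * Irrational numbers and convergents *)

Section Irrational.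
Context {R : realType}.
Implicit Types (x y : R) (r : rat).

(** The congruence on [q_k] freezes the limit profile: [D] clears the denominators of the
    breakpoints and of the base point [q], so multiplying [q - j / D] by [q_k] changes it by an
    integer, and one function [I], with one point [t0], serves all these [k]. The error [O(1/n)] for
    [F], which comes from the bounded variation of [f'], is the delicate input: up to [a_(k+1)]
    blocks are added, so a merely bounded error per block, as in the Denjoy-Koksma inequality, would
    be as large as the main term. The remaining [N' < q_k] terms are only controlled by the digit
    sum. This is why [a_(k+1)] has to dominate [a_1 + ... + a_k]; it is then also comparable with
    the whole sum in the statement. Digits have infinite mean, so digit sums are bounded off an
    exceptional set whose measure is small but fixed. It is tolerated, not summed: the points that
    avoid all large digits have measure below every [eps]. Positive upper density arises because
    [b |th|] is nearly [N / q_(k+1)]: the good [N] fill an interval of length proportional to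
    [q_(k+1)]. *)

Definition irr x := forall r, x != ratr r.

Lemma irrDr x r : irr x -> irr (x + ratr r).
Proof.
move=> xI s; apply: contraNneq (xI (s - r)) => xr.
by rewrite rmorphB /= -xr addrK.
Qed.

Lemma irrMr x r : r != 0 -> irr x -> irr (x * ratr r).
Proof.
move=> r0 xI s; apply: contraNneq (xI (s / r)) => xr.
by rewrite fmorph_div /= -xr mulfK // fmorph_eq0.
Qed.

Lemma irrV x : irr x -> irr x^-1.
Proof.
move=> xI s; apply: contraNneq (xI s^-1) => xr.
by rewrite fmorphV /= -xr invrK.
Qed.

Lemma irrDi x (m : int) : irr x -> irr (x + m%:~R).
Proof. by move=> xI; rewrite -(ratr_int R) ; exact: irrDr. Qed.

Lemma irrDn x (m : nat) : irr x -> irr (x + m%:R).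
Proof. exact: (irrDi _ m). Qed.

Lemma irr_neq_int x (m : int) : irr x -> x != m%:~R.
Proof. by move=> /(_ m%:~R); rewrite ratr_int. Qed.

Lemma irr_neq0 x : irr x -> x != 0.
Proof. exact: (irr_neq_int _ 0). Qed.

Lemma fracpart_itv x : 0 <= fracpart x < 1.
Proof. have := floor_itv x; rewrite /fracpart intrD; lra. Qed.

Lemma fracpart_id x : 0 <= x < 1 -> fracpart x = x.
Proof.
move=> x01; rewrite /fracpart (@floor_def _ x 0) ?subr0 //.
Qed.

Lemma fracpartDi x (m : int) : fracpart (x + m%:~R) = fracpart x.
Proof.
rewrite /fracpart floorDrz ?intr_int // intrKfloor intrD; lra.
Qed.

Lemma irr_fracpart x : irr x -> irr (fracpart x).
Proof. by move=> xI; rewrite /fracpart -rmorphN /=; exact: irrDi. Qed.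

End Irrational.

(* The convergents [p_k / q_k] of a digit sequence, with [cfq1], [cfp1] the
   denominator and numerator of index [k - 1], starting from [q_(-1) = 0] and
   [p_(-1) = 1]. *)
Definition cfq1 (a : nat -> nat) (k : nat) : nat :=
  if k is k'.+1 then cfq_aux a k' else 0%N.

Fixpoint cfp (a : nat -> nat) (k : nat) : nat :=
  match k with
  | 0 => 0
  | 1 => 1
  | (k'.+1 as k1).+1 => a k1.+1 * cfp a k1 + cfp a k'
  end%N.

Definition cfp1 (a : nat -> nat) (k : nat) : nat :=
  if k is k'.+1 then cfp a k' else 1%N.

Section Convergents.
Implicit Types (a : nat -> nat) (k : nat).
Local Open Scope nat_scope.

Lemma cfqS a k : cfq_aux a k.+1 = a k.+1 * cfq_aux a k + cfq1 a k.
Proof. by case: k => [|k] //=; rewrite muln1 addn0. Qed.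

Lemma cfpS a k : cfp a k.+1 = a k.+1 * cfp a k + cfp1 a k.
Proof. by case: k => [|k] //=; rewrite muln0. Qed.

Lemma eq_cfq a b k : (forall i, 0 < i <= k -> a i = b i) ->
  cfq_aux a k = cfq_aux b k.
Proof.
elim/ltn_ind: k => k IH ab; case: k IH ab => [|k] IH ab //.
rewrite !cfqS ab ?leqnn // (IH k) //; last first.
  by move=> i /andP[i0 ik]; apply: ab; rewrite i0 leqW.
case: k IH ab => [|k] //= IH ab; rewrite (IH k) //.
by move=> i /andP[i0 ik]; apply: ab; rewrite i0 !leqW.
Qed.

Lemma eq_cfp a b k : (forall i, 0 < i <= k -> a i = b i) ->
  cfp a k = cfp b k.
Proof.
elim/ltn_ind: k => k IH ab; case: k IH ab => [|k] IH ab //.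
rewrite !cfpS ab ?leqnn // (IH k) //; last first.
  by move=> i /andP[i0 ik]; apply: ab; rewrite i0 leqW.
case: k IH ab => [|k] //= IH ab; rewrite (IH k) //.
by move=> i /andP[i0 ik]; apply: ab; rewrite i0 !leqW.
Qed.

Section Positive.
Variable a : nat -> nat.
Hypothesis a_gt0 : forall i, 0 < i -> 0 < a i.

Lemma cfq_gt0 k : 0 < cfq_aux a k.
Proof. by elim: k => [|k IH] //; rewrite cfqS addn_gt0 muln_gt0 a_gt0 ?IH. Qed.

Lemma cfq_leS k : cfq_aux a k <= cfq_aux a k.+1.
Proof.
by rewrite cfqS (leq_trans _ (leq_addr _ _)) // leq_pmull // a_gt0.
Qed.

Lemma cfq_le : {homo cfq_aux a : i j / i <= j}.
Proof. exact: homo_leq leqnn leq_trans cfq_leS. Qed.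

Lemma cfq1_le k : cfq1 a k <= cfq_aux a k.
Proof. by case: k => [|k] //=; exact: cfq_leS. Qed.

Lemma cfq_ge k : k <= cfq_aux a k.+1.
Proof.
elim: k => // k IH; rewrite cfqS.
have q0 : 0 < cfq1 a k.+1 by exact: cfq_gt0.
have a0 := a_gt0 k.+2 isT.
rewrite -[X in X <= _]addn1 leq_add //; apply: leq_trans IH _.
by rewrite leq_pmull.
Qed.

(** The identity [p_(k-1) q_k - p_k q_(k-1) = (-1)^k], kept inside the naturals by adding the
    indicator of one parity on each side. *)
Lemma cf_det k : cfp1 a k * cfq_aux a k + odd k = cfp a k * cfq1 a k + ~~ odd k.
Proof.
elim: k => // k IH; rewrite cfqS cfpS /=.
by move: IH; case: odd => /=; nia.
Qed.

Lemma coprime_cfp k : coprime (cfp a k) (cfq_aux a k).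
Proof.
have qp := cfq_gt0 k; have := cf_det k.
case: (posnP (cfp a k)) => [->|pp]; last case: odd => /= E.
- rewrite /coprime gcd0n mul0n; case: odd => /= E; first by rewrite addn1 in E.
  by move/eqP: E; rewrite addn0 muln_eq1 => /andP[].
- by apply/coprimeP => //; exists (cfq1 a k, cfp1 a k) => /=; nia.
- rewrite coprime_sym.
  by apply/coprimeP => //; exists (cfp1 a k, cfq1 a k) => /=; nia.
Qed.

End Positive.
End Convergents.

(** * Digits, tails and inverse branches of the Gauss map *)

Section GaussMap.
Context {R : realType}.
Implicit Types (x y t alpha : R) (a : nat -> nat) (k : nat).

Definition irr01 : set R := [set x | irr x /\ 0 <= x < 1].

Lemma irr01_gt0 x : irr01 x -> 0 < x < 1.
Proof.
by move=> [xI /andP[x0 ->]]; rewrite andbT lt_neqAle x0 eq_sym irr_neq0.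
Qed.

Lemma cf_x_irr01 alpha k : irr01 alpha -> irr01 (cf_x alpha k).
Proof.
move=> aI; have irr01_fracpart x : irr x -> irr01 (fracpart x).
  by move=> xI; split; [exact: irr_fracpart|exact: fracpart_itv].
elim: k => [|k IH]; first by apply: irr01_fracpart; case: aI.
by apply: irr01_fracpart; apply: irrV; case: IH.
Qed.

Lemma cf_x0 alpha : irr01 alpha -> cf_x alpha 0 = alpha.
Proof. by move=> [_ a01]; rewrite /cf_x /= fracpart_id. Qed.

Lemma cf_a_gt0 alpha i : irr01 alpha -> (0 < i)%N -> (0 < cf_a alpha i)%N.
Proof.
case: i => // i aI _; rewrite /= absz_gt0 gt_eqF // floor_gt0.
have /irr01_gt0/andP[x0 x1] := cf_x_irr01 alpha i aI.
by rewrite invf_ge1 // ltW.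
Qed.

Lemma cf_xV alpha k : irr01 alpha ->
  (cf_x alpha k)^-1 = (cf_a alpha k.+1)%:R + cf_x alpha k.+1.
Proof.
move=> aI; have /irr01_gt0/andP[x0 x1] := cf_x_irr01 alpha k aI.
rewrite {2}/cf_x iterS -/(cf_x alpha k) /fracpart /=.
rewrite -[X in X + _]/((`|Num.floor (cf_x alpha k)^-1|%N : int)%:~R).
rewrite gez0_abs ?floor_ge0 ?invr_ge0 ?ltW //; lra.
Qed.

(** The inverse branch of the [k]-th iterate of the Gauss map: the value of the continued fraction
    [[0; a 1, ..., a k + t]]. The integer part is 0 since only points of [[0, 1)] are described. *)
Definition mob a k t : R :=
  ((cfp a k)%:R + (cfp1 a k)%:R * t) / ((cfq_aux a k)%:R + (cfq1 a k)%:R * t).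

Lemma eq_mob a b k t : (forall i, (0 < i <= k)%N -> a i = b i) ->
  mob a k t = mob b k t.
Proof.
move=> ab; have ab' : forall i, (0 < i <= k.-1)%N -> a i = b i.
  by move=> i /andP[i0 ik]; apply: ab; rewrite i0 (leq_trans ik) // leq_pred.
rewrite /mob (eq_cfq a b k) // (eq_cfp a b k) //.
have -> : cfp1 a k = cfp1 b k by case: k ab ab' => [|k] //= _; exact: eq_cfp.
by have -> : cfq1 a k = cfq1 b k by case: k ab ab' => [|k] //= _; exact: eq_cfq.
Qed.

Section Digits.
Variable a : nat -> nat.
Hypothesis a_gt0 : forall i, (0 < i)%N -> (0 < a i)%N.

Lemma mob_den_gt0 k t : 0 <= t -> 0 < (cfq_aux a k)%:R + (cfq1 a k)%:R * t.
Proof.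
move=> t0; rewrite ltr_pwDl ?mulr_ge0 // ltr0n.
exact: cfq_gt0.
Qed.

Lemma mobS k t : 0 <= t -> mob a k.+1 t = mob a k ((a k.+1)%:R + t)^-1.
Proof.
move=> t0; rewrite /mob cfpS cfqS /= !natrD !natrM.
have a0 : 0 < (a k.+1)%:R :> R by rewrite ltr0n a_gt0.
have := mob_den_gt0 k.+1 t t0; rewrite cfqS /= natrD natrM.
set A := (a k.+1)%:R in a0 *; set Q := (cfq_aux a k)%:R.
set Q' := (cfq1 a k)%:R; set P := (cfp a k)%:R; set P' := (cfp1 a k)%:R.
move=> H; field; rewrite -/A -/Q -/Q'.
by apply/andP; split; lra.
Qed.

(** The determinant identity makes the difference of two values an exact product. It yields the
    orientation and length of cylinders, and later the error [alpha - p_k / q_k]. *)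
Lemma mobB k s t : 0 <= s -> 0 <= t ->
  mob a k t - mob a k s = (-1) ^+ k * (t - s) /
    (((cfq_aux a k)%:R + (cfq1 a k)%:R * t) *
     ((cfq_aux a k)%:R + (cfq1 a k)%:R * s)).
Proof.
move=> s0 t0; rewrite /mob.
have := mob_den_gt0 k t t0; have := mob_den_gt0 k s s0.
have : (cfp1 a k)%:R * (cfq_aux a k)%:R - (cfp a k)%:R * (cfq1 a k)%:R
       = (-1) ^+ k :> R.
  have /(congr1 (fun n => n%:R : R)) := cf_det a k.
  rewrite !natrD !natrM -signr_odd; case: odd => /=; rewrite ?expr1 ?expr0; lra.
set Q := (cfq_aux a k)%:R.
set Q' := (cfq1 a k)%:R; set P := (cfp a k)%:R; set P' := (cfp1 a k)%:R.
move=> <- H1 H2; field; rewrite -/Q -/Q'.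
by apply/andP; split; lra.
Qed.

Lemma irr_mob k t : irr (mob a k t) -> irr t.
Proof.
move=> mI r; apply/eqP => tr.
have /eqP[] := mI (((cfp a k)%:R + (cfp1 a k)%:R * r) /
                  ((cfq_aux a k)%:R + (cfq1 a k)%:R * r)).
by rewrite /mob tr fmorph_div /= !rmorphD /= !rmorphM /= !ratr_nat.
Qed.

(** Through [mobS], a tail [t] of rank [k.+1] becomes the tail [1 / (a k.+1 + t)] of rank [k], whose
    reciprocal has floor [a k.+1]. Together with [mob_cf], the tails in [irr01] are coordinates on
    the cylinder. *)
Lemma cf_mob k t : irr01 t ->
  [/\ irr01 (mob a k t), cf_x (mob a k t) k = t &
      forall i, (0 < i <= k)%N -> cf_a (mob a k t) i = a i].
Proof.
elim: k t => [|k IH] t tI.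
  have -> : mob a 0 t = t.
    by rewrite /mob /= mul0r addr0 add0r mul1r divr1.
  by split; [|rewrite cf_x0|case].
have /andP[t0 t1] := irr01_gt0 t tI.
rewrite mobS ?ltW //.
have a1 : 1 <= (a k.+1)%:R :> R by rewrite ler1n a_gt0.
have t'I : irr01 ((a k.+1)%:R + t)^-1.
  split; first by apply: irrV; rewrite addrC; apply: irrDn; case: tI.
  have At0 : 0 < (a k.+1)%:R + t by lra.
  by rewrite invr_ge0 ltW //= invf_lt1 //; lra.
have [mI xE aE] := IH _ t'I.
set m := mob a k _ in mI xE aE *.
have fl : Num.floor ((a k.+1)%:R + t) = a k.+1.
  by apply: floor_def; rewrite intrD /= -pmulrn; apply/andP; split; lra.
split=> //.
  by rewrite /cf_x iterS -/(cf_x m k) xE invrK /fracpart fl -pmulrn; lra.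
move=> i /andP[i0]; rewrite leq_eqVlt => /orP[/eqP ->|ik].
  by rewrite /= xE invrK fl.
by apply: aE; rewrite i0 -ltnS.
Qed.

End Digits.

Lemma mob_cf alpha k : irr01 alpha -> mob (cf_a alpha) k (cf_x alpha k) = alpha.
Proof.
move=> aI; elim: k => [|k IH].
  by rewrite cf_x0 // /mob /= mul0r addr0 add0r mul1r divr1.
rewrite mobS; last first.
- by case: (cf_x_irr01 alpha k.+1 aI) => _ /andP[].
- by move=> i; exact: cf_a_gt0.
by rewrite -cf_xV // invrK.
Qed.

End GaussMap.

(** * Measure of cylinders *)

Section Cylinders.
Context {R : realType}.
Implicit Types (a : nat -> nat) (k : nat) (s t : R).
Notation lam := (@lebesgue_measure R).

Lemma irrE : [set x : R | irr x] = ~` range (@ratr R).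
Proof.
apply/seteqP; split=> x /= xI.
  by move=> [r _ rx]; have := xI r; rewrite rx eqxx.
by move=> r; apply/eqP => xr; apply: xI; exists r.
Qed.

Lemma countable_ratr : countable (range (@ratr R)).
Proof. exact: card_le_trans (card_image_le _ _) (countableP _). Qed.

Lemma measurable_irr : measurable [set x : R | irr x].
Proof.
rewrite irrE; apply: measurableC; apply: countable_measurable => //.
exact: countable_ratr.
Qed.

Lemma lebesgue_irr (A : set R) : measurable A ->
  lam (A `&` [set x | irr x]) = lam A.
Proof.
move=> mA; have mQ : measurable (range (@ratr R)).
  by rewrite -[X in measurable X]setCK -irrE; apply: measurableC; exact: measurable_irr.
rewrite irrE -setDE (measureDI lam mA mQ).
rewrite [X in (_ + X)%E]countable_lebesgue_measure0 ?adde0 //.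
exact: sub_countable (subset_card_le (@subIsetr _ _ _)) countable_ratr.
Qed.

(** A cylinder of rank [k] cut by a window for the tail. Conditions on digit [k.+1] are windows
    smaller than [(0, 1)], so conditional probabilities are quotients of measures of such sets. *)
Definition cyl a k s t : set R :=
  [set b | [/\ irr01 b, forall i, (0 < i <= k)%N -> cf_a b i = a i &
               s < cf_x b k < t]].

Lemma eq_cyl a b k s t : (forall i, (0 < i <= k)%N -> a i = b i) ->
  cyl a k s t = cyl b k s t.
Proof.
move=> ab; apply/seteqP; split=> x [xI xa xst]; split=> // i ik.
  by rewrite xa // ab.
by rewrite xa // ab.
Qed.

Section Digits.
Variable a : nat -> nat.
Hypothesis a_gt0 : forall i, (0 < i)%N -> (0 < a i)%N.

(** [mob a k] is monotone in the tail and decreasing for odd [k], hence the swapped endpoints. That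
    every irrational of the interval is reached follows by solving for its tail explicitly. *)
Lemma cylE k s t : 0 <= s -> s < t -> t <= 1 ->
  cyl a k s t = (if odd k then `]mob a k t, mob a k s[%classic
                 else `]mob a k s, mob a k t[%classic) `&` [set x | irr x].
Proof.
move=> s0 st t1.
have t0 : 0 <= t by lra.
have -> : (if odd k then `]mob a k t, mob a k s[%classic
           else `]mob a k s, mob a k t[%classic) =
  [set b | 0 < (-1) ^+ k * (b - mob a k s) /\ (-1) ^+ k * (b - mob a k t) < 0].
  apply/seteqP; rewrite -signr_odd; case: odd; rewrite /= ?expr1 ?expr0;
    by split=> b /=; rewrite in_itv /=; [move=> /andP[]|case]; lra.
have sqr1 : (-1) ^+ k * (-1) ^+ k = 1 :> R.
  by rewrite -exprMn mulrNN mulr1 expr1n.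
apply/seteqP; split=> b /=.
  move=> [bI ba /andP[sx xt]]; split; last by case: bI.
  have -> : b = mob a k (cf_x b k).
    by rewrite -[LHS](mob_cf b k) //; apply: eq_mob.
  have x0 : 0 <= cf_x b k by lra.
  rewrite !mobB // !mulrA !sqr1 !mul1r; split.
    by rewrite divr_gt0 ?mulr_gt0 ?subr_gt0 ?mob_den_gt0.
  by rewrite pmulr_llt0 ?subr_lt0 // invr_gt0 mulr_gt0 ?mob_den_gt0.
move=> [[bs bt] bI].
set u := (-1) ^+ k * (b - mob a k s) in bs.
have bE : b = mob a k s + (-1) ^+ k * u by rewrite /u mulrA sqr1 mul1r; lra.
have := mobB a a_gt0 k _ _ s0 t0.
have eP := mob_den_gt0 a a_gt0 k s s0; have dP := mob_den_gt0 a a_gt0 k t t0.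
have q1le : (cfq1 a k)%:R <= (cfq_aux a k)%:R :> R.
  by rewrite ler_nat cfq1_le.
have q1ge : 0 <= (cfq1 a k)%:R :> R by [].
have qge : 0 < (cfq_aux a k)%:R :> R by rewrite ltr0n cfq_gt0.
set e := _ + _ * s in eP *; set d := _ + _ * t in dP * => mE.
set q := (cfq_aux a k)%:R in e d eP dP mE q1le q1ge qge.
set q1 := (cfq1 a k)%:R in e d eP dP mE q1le q1ge.
have uL : u < (t - s) / (d * e).
  have : mob a k t = mob a k s + (-1) ^+ k * ((t - s) / (d * e)).
    by rewrite mulrA -mE; lra.
  move=> E; move: bt; rewrite bE E opprD addrACA subrr add0r -mulrBr mulrA sqr1.
  by rewrite mul1r subr_lt0.
have de : d - e = q1 * (t - s) by rewrite /d /e; lra.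
have uL' : u * d * e < t - s by rewrite -mulrA -ltr_pdivlMr ?mulr_gt0.
have v1 : 0 < 1 - u * e * q1.
  rewrite subr_gt0 -(ltr_pM2r dP) mul1r.
  have -> : u * e * q1 * d = (u * d * e) * q1 by ring.
  have [->|q1p] := eqVneq q1 0; first by rewrite mulr0.
  have q1p' : 0 < q1 by rewrite lt_neqAle eq_sym q1p.
  rewrite (@lt_le_trans _ _ ((t - s) * q1)) ?ltr_pM2r //.
  by rewrite mulrC -de; lra.
(* The solution of [u = v / ((e + q1 v) e)], which is [mobB] between the tails [s] and [s + v]. The
   upper bound on [u] made the denominator positive and gives [v < t - s]. *)
pose v := u * e ^+ 2 / (1 - u * e * q1).
have v0 : 0 < v by rewrite divr_gt0 // mulr_gt0 // exprn_gt0.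
have vt : v < t - s.
  rewrite ltr_pdivrMr // mulrBr mulr1.
  have -> : (t - s) * (u * e * q1) = u * e * (d - e) by rewrite de; ring.
  have -> : u * e * (d - e) = u * d * e - u * e ^+ 2 by ring.
  lra.
pose x := s + v.
have x0 : 0 < x by rewrite /x; lra.
have bx : b = mob a k x.
  rewrite bE; have := mobB a a_gt0 k _ _ s0 (ltW x0).
  rewrite -/q -/q1 -/e => xE.
  rewrite -[RHS](subrK (mob a k s)) xE addrC; congr (_ + _).
  have -> : q + q1 * x = e + q1 * v by rewrite /x /e; ring.
  have -> : x - s = v by rewrite /x; ring.
  rewrite -mulrA; congr (_ * _).
  have ev : e + q1 * v = e / (1 - u * e * q1).
    by rewrite /v; field; lra.
  rewrite ev /v; field.
  by apply/andP; split; lra.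
have xI : irr01 x.
  split; first by apply: (irr_mob a k); rewrite -bx.
  by rewrite /x; apply/andP; split; lra.
have [mI mx ma] := cf_mob a a_gt0 k x xI.
rewrite bx; split=> //; rewrite mx /x; apply/andP; split; lra.
Qed.

Lemma measurable_cyl k s t : 0 <= s -> s < t -> t <= 1 -> measurable (cyl a k s t).
Proof.
move=> s0 st t1; rewrite cylE //.
by apply: measurableI; [case: ifP|exact: measurable_irr].
Qed.

Lemma lebesgue_cyl k s t : 0 <= s -> s < t -> t <= 1 ->
  lam (cyl a k s t) = ((t - s) /
    (((cfq_aux a k)%:R + (cfq1 a k)%:R * t) *
     ((cfq_aux a k)%:R + (cfq1 a k)%:R * s)))%:E.
Proof.
move=> s0 st t1; have t0 : 0 <= t by lra.
have dP := mob_den_gt0 a a_gt0 k s s0; have eP := mob_den_gt0 a a_gt0 k t t0.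
rewrite cylE // lebesgue_irr; last by case: ifP.
have := mobB a a_gt0 k _ _ s0 t0; rewrite -[in (-1) ^+ k]signr_odd.
set L := (X in _ = X%:E); rewrite -mulrA -/L => mE.
have L0 : 0 < L by rewrite divr_gt0 ?mulr_gt0 ?subr_gt0.
case: odd mE; rewrite /= ?expr1 ?expr0 => mE.
  rewrite lebesgue_measure_itv /= lte_fin ifT; last by lra.
  by rewrite -EFinB; congr (_%:E); lra.
rewrite lebesgue_measure_itv /= lte_fin ifT; last by lra.
by rewrite -EFinB; congr (_%:E); lra.
Qed.

(** Bounded distortion: the quotient of the two measures is [t - s] times
    [q (q + q1) / ((q + q1 t) (q + q1 s))], and [q1 <= q] keeps this factor between 1/2 and 2. The
    uniformity in the digits replaces independence. *)
Lemma lebesgue_cyl_bounds k s t : 0 <= s -> s < t -> t <= 1 ->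
  (((t - s) / 2)%:E * lam (cyl a k 0 1) <= lam (cyl a k s t)
   <= (2 * (t - s))%:E * lam (cyl a k 0 1))%E.
Proof.
move=> s0 st t1; rewrite !lebesgue_cyl // -!EFinM !lee_fin.
have q1le : (cfq1 a k)%:R <= (cfq_aux a k)%:R :> R by rewrite ler_nat cfq1_le.
have q1ge : 0 <= (cfq1 a k)%:R :> R by [].
have qgt : 0 < (cfq_aux a k)%:R :> R by rewrite ltr0n cfq_gt0.
rewrite mulr0 addr0 subr0 mulr1.
set q := (cfq_aux a k)%:R in q1le qgt *; set q1 := (cfq1 a k)%:R in q1le q1ge *.
have E1 : 0 <= q1 * t <= q1 by rewrite mulr_ge0 ?ler_piMr //; lra.
have E2 : 0 <= q1 * s <= q1 by rewrite mulr_ge0 ?ler_piMr //; lra.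
have P0 : 0 < (q + q1) * q by rewrite mulr_gt0 //; lra.
have xy0 : 0 < (q + q1 * t) * (q + q1 * s) by rewrite mulr_gt0 //; lra.
have xyP : (q + q1 * t) * (q + q1 * s) <= 2 * ((q + q1) * q).
  have -> : 2 * ((q + q1) * q) = (q + q1) * (2 * q) by ring.
  by rewrite ler_pM //; lra.
have Pxy : (q + q1) * q <= 2 * ((q + q1 * t) * (q + q1 * s)).
  have -> : 2 * ((q + q1 * t) * (q + q1 * s)) = (2 * (q + q1 * t)) * (q + q1 * s) by ring.
  by rewrite ler_pM //; lra.
set P := (q + q1) * q in P0 xyP Pxy *; set X := (q + q1 * t) * _ in xy0 xyP Pxy *.
apply/andP; split.
  have -> : (t - s) / 2 * (1 / P) = (t - s) * (2 * P)^-1 by field; lra.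
  by rewrite ler_pM2l ?lef_pV2 ?posrE ?mulr_gt0 //; lra.
have -> : 2 * (t - s) * (1 / P) = (t - s) * (P / 2)^-1 by field; lra.
by rewrite ler_pM2l ?lef_pV2 ?posrE ?divr_gt0 //; lra.
Qed.

Lemma cylS k : cyl a k.+1 0 1 = cyl a k ((a k.+1).+1%:R)^-1 ((a k.+1)%:R)^-1.
Proof.
have a0 : 0 < (a k.+1)%:R :> R by rewrite ltr0n a_gt0.
apply/seteqP; split=> b [bI ba xb]; split => //.
- by move=> i /andP[i0 ik]; apply: ba; rewrite i0 leqW.
- have := cf_xV b k bI; rewrite ba ?leqnn // => xE.
  have /irr01_gt0/andP[x0 x1] := cf_x_irr01 b k bI.
  rewrite -(invrK (cf_x b k)) xE !ltf_pV2 ?posrE ?ltr0n //; try lra.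
  exact: a_gt0.
- have /irr01_gt0/andP[x0 x1] := cf_x_irr01 b k bI.
  move=> i /andP[i0]; rewrite leq_eqVlt => /orP[/eqP ->|ik]; last first.
    by apply: ba; rewrite i0 -ltnS.
  rewrite /=; suff -> : Num.floor (cf_x b k)^-1 = a k.+1 by [].
  case/andP: xb => l r; apply: floor_def; rewrite intrD -pmulrn.
  rewrite -[X in X <= _]invrK lef_pV2 ?posrE ?invr_gt0 // ltW //=.
  by rewrite -[ltRHS]invrK ltf_pV2 ?posrE ?invr_gt0 ?natr1 // ltr0n.
- exact/irr01_gt0/cf_x_irr01.
Qed.

Lemma cyl_digit_ge k n : (0 < n)%N ->
  cyl a k 0 1 `&` [set b | (n <= cf_a b k.+1)%N] = cyl a k 0 (n%:R)^-1.
Proof.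
move=> n0; have n0' : 0 < n%:R :> R by rewrite ltr0n.
have n1 : n%:R^-1 <= 1 :> R by rewrite invf_le1 // ler1n.
apply/seteqP; split=> b.
  move=> [[bI ba /andP[x0 x1]] /= nb]; split=> //; rewrite x0 /=.
  have := cf_xV b k bI => xE.
  have /irr01_gt0/andP[y0 y1] := cf_x_irr01 b k.+1 bI.
  rewrite -(invrK (cf_x b k)) xE ltf_pV2 ?posrE //.
    have : n%:R <= (cf_a b k.+1)%:R :> R by rewrite ler_nat.
    lra.
  by rewrite -xE invr_gt0.
move=> [bI ba /andP[x0 x1]]; split.
  by split=> //; rewrite x0 /=; lra.
rewrite /= -lez_nat gez0_abs; last by rewrite floor_ge0 invr_ge0 ltW.
rewrite floor_ge_int -pmulrn.
by rewrite -[leLHS]invrK lef_pV2 ?posrE ?invr_gt0 // ltW.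
Qed.

End Digits.

(** Membership in the sigma-algebra of the first [k] digits, in a pointwise form that can be checked
    without measure theory. *)
Definition digit_det k (B : set R) := B `<=` irr01 /\
  forall b c, B b -> irr01 c ->
    (forall i, (0 < i <= k)%N -> cf_a c i = cf_a b i) -> B c.

Lemma digit_det_cover k B : digit_det k B ->
  exists (D : set nat) (A : nat -> nat -> nat),
  [/\ forall n, D n -> forall i, (0 < i)%N -> (0 < A n i)%N,
      forall n, D n -> cyl (A n) k 0 1 `<=` B,
      trivIset D (fun n => cyl (A n) k 0 1) &
      B = \bigcup_(n in D) cyl (A n) k 0 1].
Proof.
move=> [Birr Bdet].
pose word (b : R) := [seq cf_a b i | i <- iota 1 k].
(* Words are coded by [pickle] so that the cylinders form a sequence. The default digit 1 beyond
   position [k] keeps all digits positive, as the cylinder lemmas require. *)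
pose A n i := nth 1%N (odflt [::] (unpickle n)) i.-1.
have Aw b i : (0 < i)%N -> A (pickle (word b)) i = if (i <= k)%N then cf_a b i else 1%N.
  move=> i0; rewrite /A pickleK /= /word; case: ifP => ik.
    rewrite (nth_map 0%N) ?size_iota ?prednK // nth_iota ?prednK //.
    by rewrite add1n prednK.
  by rewrite nth_default // size_map size_iota -ltnS prednK // ltnNge ik.
exists [set n | exists2 b, B b & n = pickle (word b)], A; split.
- move=> n [b Bb ->] i i0; rewrite Aw //; case: ifP => // _.
  exact: cf_a_gt0 (Birr _ Bb) i0.
- move=> n [b Bb ->] c [cI cb _]; apply: (Bdet b) => // i ik.
  by rewrite cb // Aw; case/andP: ik => // _ ->.
- move=> n m [b Bb ->] [c Bc ->] [x [[xI xb _] [_ xc _]]].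
  congr pickle; apply/eq_in_map => i; rewrite mem_iota add1n ltnS => ik.
  have := xb i ik; rewrite xc // !Aw; case/andP: ik => // _ -> //.
- apply/seteqP; split=> [b Bb|c [n [b Bb ->]] [cI cb _]]; last first.
    apply: (Bdet b) => // i ik.
    by rewrite cb // Aw; case/andP: ik => // _ ->.
  exists (pickle (word b)); first by exists b.
  split; [exact: Birr| |exact/irr01_gt0/cf_x_irr01/Birr].
  by move=> i ik; rewrite Aw; case/andP: ik => // _ ->.
Qed.

Lemma digit_det_measurable k B : digit_det k B -> measurable B.
Proof.
move=> /digit_det_cover[D [A [A0 _ _ ->]]].
apply: bigcup_measurable => n Dn.
exact: measurable_cyl (A0 n Dn) _ _ _ _ ltr01 _.
Qed.

(** Countable additivity over the disjoint cylinders of [digit_det_cover]: a conditional bound on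
    each cylinder passes to [B]. *)
Lemma digit_det_ge k B E (c : R) : digit_det k B -> measurable E -> 0 <= c ->
  (forall a, (forall i, (0 < i)%N -> (0 < a i)%N) -> cyl a k 0 1 `<=` B ->
     (c%:E * lam (cyl a k 0 1) <= lam (cyl a k 0 1 `&` E))%E) ->
  (c%:E * lam B <= lam (B `&` E))%E.
Proof.
move=> /digit_det_cover[D [A [A0 AB tA BE]]] mE c0 H.
have mA n : D n -> measurable (cyl (A n) k 0 1).
  by move=> Dn; exact: measurable_cyl (A0 n Dn) _ _ _ _ ltr01 _.
rewrite BE setI_bigcupl !measure_bigcup //; last 2 first.
- by move=> n Dn; apply: measurableI => //; exact: mA.
- exact: trivIset_setIr.
rewrite -nneseriesZl //; apply: lee_nneseries => n; rewrite in_setE.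
- by move=> Dn; rewrite mule_ge0 ?lee_fin.
- by move=> Dn; apply: H; [exact: A0|exact: AB].
Qed.

Lemma digit_det_le k B E (c : R) : digit_det k B -> measurable E -> 0 <= c ->
  (forall a, (forall i, (0 < i)%N -> (0 < a i)%N) -> cyl a k 0 1 `<=` B ->
     (lam (cyl a k 0 1 `&` E) <= c%:E * lam (cyl a k 0 1))%E) ->
  (lam (B `&` E) <= c%:E * lam B)%E.
Proof.
move=> /digit_det_cover[D [A [A0 AB tA BE]]] mE c0 H.
have mA n : D n -> measurable (cyl (A n) k 0 1).
  by move=> Dn; exact: measurable_cyl (A0 n Dn) _ _ _ _ ltr01 _.
rewrite BE setI_bigcupl !measure_bigcup //; last 2 first.
- by move=> n Dn; apply: measurableI => //; exact: mA.
- exact: trivIset_setIr.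
rewrite -nneseriesZl //; apply: lee_nneseries => n; rewrite in_setE.
- by [].
- by move=> Dn; apply: H; [exact: A0|exact: AB].
Qed.

End Cylinders.

(** * Large partial quotients in a prescribed residue class *)

(* [a] removes the primes of [D] common to [q' := q_(k-1)], then [b] solves a
   linear congruence with invertible leading coefficient. *)
Lemma digits_to_one (D q' q : nat) : (0 < D)%N -> (0 < q')%N -> coprime q' q ->
  exists a b, [/\ (0 < a <= D)%N, (0 < b <= D)%N &
    b * (a * q + q') + q = 1 %[mod D]]%N.
Proof.
move=> D0 q'0 cq.
pose a := (D`_(\pi(q')^'))%N.
have aD : (a %| D)%N by exact: dvdn_part.
have a0 : (0 < a)%N by rewrite part_gt0.
set u := (a * q + q')%N.
have u0 : (0 < u)%N by rewrite /u addn_gt0 q'0 orbT.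
(* A prime of [D] divides exactly one of [a q] and [q']: if it divides [q'], it divides neither [a],
   by the choice of the part, nor [q], by coprimality; otherwise it divides [a]. *)
have cu : coprime u D.
  rewrite coprime_has_primes //; apply/hasPn => p.
  rewrite !mem_primes => /and3P[pP _ pD]; rewrite pP u0 /=.
  apply/negP => pu.
  have pa : (p %| a)%N = ~~ (p %| q')%N.
    have := pi_of_part (\pi(q')^')%N D0 p.
    rewrite !inE /= !mem_primes pP D0 pD q'0 /= part_gt0 /=; by [].
  have [pq'|pq'] := boolP (p %| q')%N.
    rewrite pq' /= in pa.
    move: pu; rewrite /u dvdn_addl // Euclid_dvdM // pa /= => pq.
    have := dvdn_gcd p q' q; rewrite pq' pq (eqP cq) dvdn1 => /eqP p1.
    by rewrite p1 in pP.
  rewrite pq' /= in pa.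
  by move: pu; rewrite /u dvdn_addr ?dvdn_mulr // (negbTE pq').
have /coprimeP - /(_ u0) [[x y] /= xy] := cu.
(* [x] inverts [u] modulo [D], and [D - 1] stands for -1, so [b0 u = 1 - q]. The witness below takes
   the representative in [1..D], since a digit cannot be 0. *)
pose b0 := (x * (1 + (D - 1) * q))%N.
exists a, ((b0 + (D - 1)) %% D + 1)%N; split.
- by rewrite a0 dvdn_leq.
- by rewrite addn1 ltn_mod D0.
have bE : ((b0 + (D - 1)) %% D + 1 = b0 %[mod D])%N.
  by rewrite modnDml -addnA subnK // modnDr.
rewrite -/u -modnDml -modnMml bE modnMml modnDml.
have -> : (b0 * u + q = (y * (1 + (D - 1) * q) + q) * D + 1)%N.
  have xu : (x * u = y * D + 1)%N by lia.
  rewrite /b0 mulnAC xu.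
  have : (D = (D - 1) + 1)%N by lia.
  by move: (D - 1)%N => e ->; ring.
by rewrite modnMDl.
Qed.

Lemma coprime_cfq a k : coprime (cfq1 a k) (cfq_aux a k).
Proof.
elim: k => // k IH; rewrite cfqS /= /coprime gcdnMDl gcdnC.
exact: IH.
Qed.

Section Metric.
Context {R : realType}.
Notation lam := (@lebesgue_measure R).

Definition dsum (b : R) (k : nat) : nat := (\sum_(1 <= i < k.+1) cf_a b i)%N.

(** Indexed by the number of digits conditioned on: digits [k.+1] and [k.+2] are left to adjust the
    residue, and digit [k.+3] is the large one. *)
Definition big_digit (D A k : nat) : set R :=
  [set b | [/\ irr01 b, cf_q b k.+2 = 1 %[mod D] &
               (A * dsum b k.+2 <= cf_a b k.+3)%N]].

Lemma eq_dsum (b c : R) k : (forall i, (0 < i <= k)%N -> cf_a c i = cf_a b i) ->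
  dsum c k = dsum b k.
Proof. by move=> H; apply: eq_big_nat => i /H. Qed.

Lemma dsumS (b : R) k : dsum b k.+1 = (dsum b k + cf_a b k.+1)%N.
Proof. by rewrite /dsum big_nat_recr. Qed.

Lemma digit_det_irr01 k : digit_det k (@irr01 R).
Proof. by split. Qed.

Lemma digit_detS j k (B : set R) : (j <= k)%N -> digit_det j B -> digit_det k B.
Proof.
move=> jk [BI BD]; split=> // b c Bb cI H; apply: (BD b) => // i /andP[i0 ij].
by apply: H; rewrite i0 (leq_trans ij).
Qed.

Lemma digit_det_big D A k : digit_det k.+3 (big_digit D A k).
Proof.
split=> [b []//|b c [bI bq ba] cI H]; split=> //.
  rewrite -bq; congr (_ %% _)%N; apply: eq_cfq => i /andP[i0 ik].
  by apply: H; rewrite i0 leqW.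
rewrite (eq_dsum b) ?H ?leqnn // => i /andP[i0 ik].
by apply: H; rewrite i0 leqW.
Qed.

Lemma cylS_ge (a : nat -> nat) k D : (forall i, (0 < i)%N -> (0 < a i)%N) ->
  (a k.+1 <= D)%N ->
  (((2 * D * D.+1)%:R^-1 : R)%:E * lam (cyl a k 0 1) <= lam (cyl a k.+1 0 1))%E.
Proof.
move=> a0 aD; rewrite cylS //.
have A0 : 1 <= (a k.+1)%:R :> R by rewrite ler1n a0.
have AD : (a k.+1)%:R <= D%:R :> R by rewrite ler_nat.
have s0 : 0 <= (a k.+1).+1%:R^-1 :> R by rewrite invr_ge0.
have st : (a k.+1).+1%:R^-1 < (a k.+1)%:R^-1 :> R.
  by rewrite ltf_pV2 ?posrE ?ltr0n ?a0 // ltr_nat.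
have t1 : (a k.+1)%:R^-1 <= 1 :> R by rewrite invf_le1; lra.
have /andP[+ _] := lebesgue_cyl_bounds a a0 k _ _ s0 st t1.
apply: le_trans; rewrite lee_wpmul2r // lee_fin.
set x := (a k.+1)%:R in A0 AD *.
rewrite -natr1 -/x.
have -> : (x^-1 - (x + 1)^-1) / 2 = (2 * x * (x + 1))^-1 by field; lra.
rewrite lef_pV2 ?posrE ?ltr0n; last 2 first.
- rewrite muln_gt0 //= muln_gt0 /= andbT -(ltr_nat R); lra.
- by rewrite !mulr_gt0; lra.
rewrite !natrM -natr1 ler_pM //; first [by rewrite mulr_ge0; lra | lra].
Qed.

(** Prescribing two digits [m1, m2 <= D] costs a constant factor each and adds at most [2 D] to the
    digit sum. Hence [n = A (sum + 2 D)] is a sufficient threshold for the next digit, reached with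
    conditional probability at least [1 / (2 n)]. *)
Lemma big_digit_cyl (D A k : nat) (a : nat -> nat) :
  (0 < D)%N -> (0 < A)%N -> (0 < k)%N ->
  (forall i, (0 < i)%N -> (0 < a i)%N) ->
  (((2 * (A * (\sum_(1 <= i < k.+1) a i + 2 * D)))%:R^-1 *
    ((2 * D * D.+1)%:R^-1 * (2 * D * D.+1)%:R^-1) : R)%:E * lam (cyl a k 0 1)
   <= lam (cyl a k 0 1 `&` big_digit D A k))%E.
Proof.
move=> D0 A0 k0 a0.
have q'0 : (0 < cfq1 a k)%N by case: k k0 => // k _ /=; apply: cfq_gt0.
have [m1 [m2 [/andP[m1_0 m1D] /andP[m2_0 m2D] mE]]] :=
  digits_to_one D (cfq1 a k) (cfq_aux a k) D0 q'0 (coprime_cfq a k).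
pose a' i := if i == k.+1 then m1 else if i == k.+2 then m2 else a i.
have a'a i : (0 < i <= k)%N -> a' i = a i.
  by move=> /andP[_ ik]; rewrite /a' !ltn_eqF // ltnW.
have a'0 i : (0 < i)%N -> (0 < a' i)%N.
  by move=> i0; rewrite /a'; case: ifP => // _; case: ifP => // _; exact: a0.
have a'1 : a' k.+1 = m1 by rewrite /a' eqxx.
have a'2 : a' k.+2 = m2 by rewrite /a' eqxx gtn_eqF.
set n := (A * _)%N.
have n0 : (0 < n)%N.
  by rewrite /n muln_gt0 A0 addn_gt0 muln_gt0 D0 orbT.
have n0' : 0 < n%:R :> R by rewrite ltr0n.
have sub : cyl a' k.+2 0 n%:R^-1 `<=` cyl a k 0 1 `&` big_digit D A k.
  rewrite -cyl_digit_ge // => b [[bI ba _] /= nb].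
  split.
    split=> //; last exact/irr01_gt0/cf_x_irr01.
    by move=> i ik; rewrite ba ?a'a //; case/andP: ik => -> /leqW/leqW.
  split=> //.
    rewrite /cf_q (eq_cfq _ a') // !cfqS a'1 a'2 /= -mE.
    have -> : cfq_aux a' k = cfq_aux a k by exact: eq_cfq.
    have -> : cfq1 a' k = cfq1 a k.
      rewrite -(prednK k0) /=; apply: eq_cfq => i /andP[i0 ik].
      by apply: a'a; rewrite i0 (leq_trans ik) // leq_pred.
    by [].
  apply: leq_trans nb; rewrite /n leq_mul2l; apply/orP; right.
  rewrite !dsumS (ba k.+1) ?leqnSn // (ba k.+2) ?leqnn // a'1 a'2 -addnA leq_add //.
    rewrite leq_eqVlt; apply/orP; left; apply/eqP.
    apply: eq_big_nat => i ik; rewrite ba ?a'a //; case/andP: ik => -> //= ik.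
    by rewrite ltnW // ltnW.
  by rewrite mul2n -addnn leq_add.
have n1 : n%:R^-1 <= 1 :> R by rewrite invf_le1 // ler1n.
have nV0 : 0 < n%:R^-1 :> R by rewrite invr_gt0.
have le1 : (lam (cyl a' k.+2 0 n%:R^-1) <= lam (cyl a k 0 1 `&` big_digit D A k))%E.
  rewrite le_measure // ?inE; first exact: measurable_cyl.
  apply: measurableI; first exact: measurable_cyl.
  exact: digit_det_measurable (digit_det_big _ _ _).
apply: le_trans le1.
have /andP[+ _] := lebesgue_cyl_bounds a' a'0 k.+2 _ _ (lexx 0) nV0 n1.
apply: le_trans; rewrite subr0 natrM invfM [2^-1 * _]mulrC.
rewrite EFinM -muleA lee_wpmul2l ?lee_fin ?divr_ge0 //.
have c0 : (0 <= ((2 * D * D.+1)%:R^-1 : R)%:E)%E by rewrite lee_fin invr_ge0.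
apply: le_trans (cylS_ge a' k.+1 D a'0 _); last by rewrite a'2.
rewrite EFinM -muleA lee_wpmul2l //.
apply: le_trans (cylS_ge a' k D a'0 _); last by rewrite a'1.
by rewrite lee_wpmul2l // (eq_cyl a a') // => i ik; rewrite a'a.
Qed.

End Metric.

(** * Tail bounds for digit sums *)

Section Tail.
Context {R : realType}.
Notation lam := (@lebesgue_measure R).

Lemma irr01_itv : @irr01 R = `[0, 1[ `&` [set x | irr x].
Proof.
apply/seteqP; split=> x; rewrite /irr01 /= in_itv /=; tauto.
Qed.

Lemma measurable_irr01 : measurable (@irr01 R).
Proof. exact: digit_det_measurable (digit_det_irr01 0). Qed.

Lemma lebesgue_irr01 : lam (@irr01 R) = 1%E.
Proof.
rewrite irr01_itv lebesgue_irr // lebesgue_measure_itv /= lte_fin ltr01.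
by rewrite oppr0 adde0.
Qed.

Lemma lebesgue_sub_irr01 (B : set R) : B `<=` @irr01 R -> measurable B ->
  (lam B <= 1)%E.
Proof.
move=> BI mB; rewrite -lebesgue_irr01 le_measure // ?inE //.
exact: measurable_irr01.
Qed.

Definition digit_ge i n : set R := [set b | irr01 b /\ (n <= cf_a b i)%N].

Lemma digit_det_ge_set i n : digit_det i (digit_ge i n).
Proof.
split=> [b []//|b c [bI nb] cI H]; split=> //.
case: i H nb => [|i] H nb; last by rewrite H ?leqnn.
have aE (x : R) : irr01 x -> cf_a x 0 = 0%N.
  move=> [_ x01]; rewrite /= (@floor_def _ _ 0) //.
by rewrite aE // -(aE b).
Qed.

Lemma lebesgue_digit_ge i n : (0 < n)%N ->
  (lam (digit_ge i.+1 n) <= (2 / n%:R)%:E)%E.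
Proof.
move=> n0.
have mE : measurable (digit_ge i.+1 n).
  exact: digit_det_measurable (digit_det_ge_set _ _).
have -> : digit_ge i.+1 n = @irr01 R `&` digit_ge i.+1 n.
  by rewrite setIidr // => b [].
apply: (@le_trans _ _ ((2 / n%:R)%:E * lam (@irr01 R))%E); last first.
  by rewrite lebesgue_irr01 mule1.
apply: (digit_det_le i _ _ _ (digit_det_irr01 i) mE); first by rewrite divr_ge0.
move=> a a0 _.
have n1 : n%:R^-1 <= 1 :> R by rewrite invf_le1 ?ler1n // ltr0n.
have nV0 : 0 < n%:R^-1 :> R by rewrite invr_gt0 ltr0n.
have /andP[_] := lebesgue_cyl_bounds a a0 i _ _ (lexx 0) nV0 n1.
rewrite subr0; apply: le_trans.
rewrite -cyl_digit_ge // le_measure // ?inE.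
- by apply: measurableI => //; exact: measurable_cyl.
- by rewrite cyl_digit_ge //; exact: measurable_cyl.
- by move=> b [cb [_ nb]]; split.
Qed.

(** Integrate the hypothesis over [X]. It will be applied to dyadic level sets of the digits, since
    the digits themselves have infinite mean. *)
Lemma weighted_markov (T : eqType) (I : seq T) (w : T -> R) (F : T -> set R)
    (X : set R) (C : R) :
  measurable X -> (forall t, measurable (F t)) -> (forall t, 0 <= w t) -> 0 <= C ->
  (forall x, X x -> C <= \sum_(t <- I) w t * \1_(F t) x) ->
  (C%:E * lam X <= \sum_(t <- I) (w t)%:E * lam (F t))%E.
Proof.
move=> mX mF w0 C0 H.
apply: (@le_trans _ _ (\int[lam]_(x in X) (\sum_(t <- I) (w t * \1_(F t) x)%:E)))%E.
  rewrite -integral_cst //; apply: ge0_le_integral => //.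
  all: try by (move=> x _; rewrite ?lee_fin // sume_ge0 // => t _; rewrite lee_fin mulr_ge0).
  - by apply: emeasurable_sum => t; apply/measurable_EFinP;
      apply: measurable_funM => //; exact: measurable_indic (mF t).
  - by move=> x Xx; rewrite sumEFin lee_fin H.
rewrite ge0_integral_sum //; last 2 first.
- by move=> t; apply/measurable_EFinP;
    apply: measurable_funM => //; exact: measurable_indic (mF t).
- by move=> t x _; rewrite lee_fin mulr_ge0.
apply: lee_sum => t _; under eq_integral do rewrite EFinM.
rewrite ge0_integralZl ?lee_fin //; last first.
  by apply/measurable_EFinP; exact: measurable_indic (mF t).
rewrite lee_wpmul2l ?lee_fin // integral_indic //.
rewrite le_measure // ?inE; [exact: measurableI (mF t) mX|exact: mF].
exact: mF.
Qed.

(** The levels [2^l <= n] form an initial segment whose geometric sum is [2^m - 1] with [2^m > n];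
    [full] evaluates it as long as every level is active. *)
Lemma digit_le_dyadic (n L : nat) : (n < 2 ^ L)%N ->
  (n <= \sum_(l < L) 2 ^ l * (2 ^ l <= n))%N.
Proof.
have full m : (2 ^ m <= 2 * n)%N -> (2 ^ m <= (\sum_(l < m) 2 ^ l * (2 ^ l <= n)).+1)%N.
  elim: m => [|m IH]; first by rewrite big_ord0.
  rewrite big_ord_recr /= expnS leq_pmul2l // => mn.
  rewrite mn muln1 mul2n -addnn -addSn leq_add // IH //.
  by rewrite (leq_trans mn) // leq_pmull.
elim: L => [|L IH]; first by rewrite expn0 ltnS leqn0 => /eqP ->.
have [le nL|lt _] := leqP (2 ^ L) n; last first.
  by rewrite big_ord_recr /= [(2 ^ L <= n)%N]leqNgt lt muln0 addn0 IH.
by rewrite -ltnS (leq_trans nL) // full // expnS leq_pmul2l.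
Qed.

(* Discard the points with a digit [>= 2^L], [L = m + s]; on the rest, apply Markov to
   [a_i <= sum_(l < L) 2^l 1_(a_i >= 2^l)], each term of which has mean at most [2]. *)
Lemma lebesgue_dsum_tail m s k : (k <= 2 ^ m)%N ->
  (lam ([set b | irr01 b /\ (2 ^ (m + s) * (m + s) < dsum b k)%N])
    <= (4 / 2 ^+ s)%:E)%E.
Proof.
move=> km.
set L := (m + s)%N.
pose X := [set b : R | irr01 b /\ (2 ^ L * L < dsum b k)%N].
have detX : digit_det k X.
  split=> [b []//|b c [bI nb] cI H]; split=> //.
  by rewrite (eq_dsum b).
pose big := \big[setU/set0]_(i < k) digit_ge i.+1 (2 ^ L).
have mge i n : measurable (digit_ge i n).
  exact: digit_det_measurable (digit_det_ge_set _ _).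
have mbig : measurable big by apply: bigsetU_measurable.
have mX : measurable X by exact: digit_det_measurable detX.
have bigle : (lam big <= (2 / 2 ^+ s)%:E)%E.
  apply: (@le_trans _ _ (\sum_(i < k) lam (digit_ge i.+1 (2 ^ L)))%E).
    apply: (@Boole_inequality _ _ _ lam (fun i => digit_ge i.+1 (2 ^ L)) k) => i _; exact: mge.
  apply: (@le_trans _ _ (\sum_(i < k) (2 / (2 ^ L)%:R)%:E)%E).
    by apply: lee_sum => i _; apply: lebesgue_digit_ge; rewrite expn_gt0.
  rewrite sumEFin lee_fin sumr_const card_ord -[X in X <= _]mulr_natr.
  have s0 : 0 < 2 ^+ s :> R by rewrite exprn_gt0.
  have kR : k%:R <= 2 ^+ m :> R by rewrite -natrX ler_nat.
  have m0 : 0 < 2 ^+ m :> R by rewrite exprn_gt0.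
  rewrite natrX /L exprD.
  set P := 2 ^+ s in s0 *; set M := 2 ^+ m in m0 kR *.
  have -> : 2 / (M * P) * k%:R = 2 / P * (k%:R / M) by field; lra.
  have PV : 0 <= 2 / P by rewrite divr_ge0 // ltW.
  by rewrite ler_piMr // ler_pdivrMr // mul1r.
have restle : (lam (X `\` big) <= (2 / 2 ^+ s)%:E)%E.
  (* For [L = 0] the Markov threshold is 0 and gives nothing, but then [s = 0] and the claimed bound
     2 exceeds the total mass. *)
  have [L0|L0] := posnP L.
    have s0 : s = 0%N by move: L0; rewrite /L; lia.
    rewrite s0 expr0 divr1 (@le_trans _ _ 1%E) ?lee_fin ?ler1n //.
    apply: lebesgue_sub_irr01; last exact: measurableD.
    by move=> b [[]].
  have C0 : 0 < (2 ^ L * L)%:R :> R by rewrite ltr0n muln_gt0 expn_gt0.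
  have := @weighted_markov _ (index_enum ('I_k * 'I_L)%type) (fun t => (2 ^ t.2)%:R)
    (fun t => digit_ge t.1.+1 (2 ^ t.2)) (X `\` big) (2 ^ L * L)%:R.
  move=> /(_ (measurableD mX mbig) (fun=> mge _ _) (fun=> ler0n _ _) (ltW C0)) H.
  rewrite -(@lee_pmul2l _ (2 ^ L * L)%:R%:E) // ?lte_fin //.
  apply: le_trans (H _) _.
    move=> b [[bI Xb] nbig].
    have ab (i : 'I_k) : (cf_a b i.+1 < 2 ^ L)%N.
      rewrite ltnNge; apply/negP => ge; apply: nbig.
      rewrite /big -(bigcup_mkord k (fun i => digit_ge i.+1 (2 ^ L))).
      by exists i => //=; split.
    rewrite (eq_bigr (fun t : 'I_k * 'I_L => (2 ^ t.2 * (2 ^ t.2 <= cf_a b t.1.+1))%N%:R)).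
      rewrite -natr_sum ler_nat ltnW // (leq_trans Xb) //.
      rewrite -(pair_bigA _ (fun (i : 'I_k) (l : 'I_L) => (2 ^ l * (2 ^ l <= cf_a b i.+1))%N)) /=.
      rewrite /dsum big_add1 /= big_mkord; apply: leq_sum => i _.
      by apply: digit_le_dyadic; exact: ab.
    move=> t _; rewrite natrM; congr (_ * _).
    rewrite indicE; congr (_%:R); apply/eqP.
    rewrite /digit_ge; case: leqP => ge.
      by rewrite mem_set.
    by rewrite memNset // => -[_]; rewrite leqNgt ge.
  apply: (@le_trans _ _ (\sum_(t : 'I_k * 'I_L) (2%:R)%:E)%E).
    apply: lee_sum => t _.
    have p0 : (0 < 2 ^ t.2)%N by rewrite expn_gt0.
    apply: (@le_trans _ _ (((2 ^ t.2)%:R : R)%:E * (2 / (2 ^ t.2)%:R)%:E)%E).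
      by rewrite lee_wpmul2l ?lee_fin // lebesgue_digit_ge.
    by rewrite -EFinM lee_fin mulrCA divff ?mulr1 // pnatr_eq0 -lt0n.
  rewrite sumEFin -EFinM lee_fin sumr_const card_prod !card_ord.
  rewrite -[X in X <= _]mulr_natr !natrM /L expnD.
  rewrite natrM (natrX _ 2 s).
  have s0 : 0 < 2 ^+ s :> R by rewrite exprn_gt0.
  have kR : k%:R <= (2 ^ m)%:R :> R by rewrite ler_nat.
  set P := 2 ^+ s in s0 *; set M := (2 ^ m)%:R in kR *; set l := (m + s)%:R.
  have -> : M * P * l * (2 / P) = 2 * (M * l) by field; rewrite gt_eqF.
  by rewrite ler_pM2l // ler_wpM2r.
have -> : 4 / 2 ^+ s = 2 / 2 ^+ s + 2 / 2 ^+ s :> R by rewrite -mulrDl -natrD.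
rewrite EFinD; apply: le_trans (leeD bigle restle).
apply: (@le_trans _ _ (lam (big `|` (X `\` big)))).
  rewrite le_measure // ?inE //; last by move=> b Xb; have [|] := pselect (big b); [left|right].
  by apply: measurableU => //; exact: measurableD.
apply: measureU2 => //; exact: measurableD.
Qed.

End Tail.

Lemma harmonic_decrease_absurd (R : realType) (h : nat -> R) (c : R) (n : nat) :
  0 < c -> (forall i, 0 <= h i) ->
  (forall i, (n <= i)%N -> h i.+1 <= h i - c / i.+1%:R) -> False.
Proof.
move=> c0 h0 hS.
have key i : c * series (@harmonic R) (n + i)%N <= c * series (@harmonic R) n + h n - h (n + i)%N.
  elim: i => [|i IH]; first by rewrite addn0 addrK.
  rewrite addnS; have := hS (n + i)%N (leq_addr _ _).
  have -> : series (@harmonic R) (n + i)%N.+1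
          = series (@harmonic R) (n + i)%N + (n + i)%N.+1%:R^-1.
    by rewrite /series /= big_nat_recr.
  rewrite [c * (_ + _)]mulrDr; move: IH; set x1 := c * _; set x2 := c * _.
  set x3 := h _; set x4 := h _; set x5 := h _; set x6 := c * _.
  by move: x1 x2 x3 x4 x5 x6 => x1 x2 x3 x4 x5 x6; lra.
apply: (@dvg_harmonic R); apply: nondecreasing_is_cvgn.
  move=> i j ij; rewrite /series /= (big_cat_nat (leq0n i) ij) /= lerDl.
  by apply: sumr_ge0 => k _; rewrite invr_ge0.
exists (series (@harmonic R) n + h n / c) => _ [i _ <-].
apply: (@le_trans _ _ (series (@harmonic R) (n + i)%N)).
  rewrite /series /= (big_cat_nat (leq0n i) (leq_addl n i)) /= lerDl.
  by apply: sumr_ge0 => k _; rewrite invr_ge0.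
rewrite -(ler_pM2l c0) mulrDr [c * (h n / c)]mulrCA divff ?gt_eqF // mulr1.
by rewrite (le_trans (key i)) // gerBl.
Qed.

(** * Recurrence of the large digits, by dyadic blocks of indices *)

Section Recurrence.
Context {R : realType}.
Notation lam := (@lebesgue_measure R).
Variables (D A : nat) (e : bool).
Hypotheses (D0 : (0 < D)%N) (A0 : (0 < A)%N).

(** Event [j] reads digits up to [kk j + 3]. The spacing 4 puts them among the first [kk (j + 1)]
    digits, so that the next event can be conditioned on them. The parity is that of [e], and the
    offset 4 keeps the index positive. *)
Let kk j := (4 * j + 4 + e)%N.

Definition avoids n M : set R :=
  [set b | irr01 b /\ forall j, (n <= j < M)%N -> ~ big_digit D A (4 * j + 4 + e) b].

Lemma digit_det_avoids n M : digit_det (kk M) (avoids n M).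
Proof.
split=> [b []//|b c [bI nb] cI H]; split=> // j jM cj.
apply: (nb j jM).
have [_ bd] := digit_detS _ (kk M) _ (ltac:(rewrite /kk; lia) : (kk j).+3 <= kk M)%N
  (@digit_det_big R D A (kk j)).
by apply: (bd c) => // i /H.
Qed.

Lemma avoids_le1 n M : (lam (avoids n M) <= 1)%E.
Proof.
apply: lebesgue_sub_irr01; first by move=> b [].
exact: digit_det_measurable (digit_det_avoids n M).
Qed.

Lemma avoids_fin n M : lam (avoids n M) \is a fin_num.
Proof. by rewrite ge0_fin_numE // (le_lt_trans (avoids_le1 n M)) // ltry. Qed.

(** The conditional probability in [big_digit_cyl] when the digit sum equals [2 ^ L * L], the
    threshold of [lebesgue_dsum_tail]. *)
Definition rate (L : nat) : R := (2 * (A * (2 ^ L * L + 2 * D)))%:R^-1 *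
  ((2 * D * D.+1)%:R^-1 * (2 * D * D.+1)%:R^-1).

(** Off the set [G] of large digit sums, event [M] has conditional probability at least [rate].
    Removing [G] keeps the set determined by its digits and costs the [eps] in the last factor. *)
Lemma avoids_step n M i s (eps : R) : (n <= M)%N -> (M < 2 ^ i.+1)%N ->
  4 / 2 ^+ s <= eps ->
  fine (lam (avoids n M.+1)) <= fine (lam (avoids n M)) -
     rate (i + 4 + s) * (fine (lam (avoids n M)) - eps).
Proof.
move=> nM Mi seps; set c := rate _.
have c0 : 0 <= c by rewrite !mulr_ge0 ?invr_ge0.
(* [M < 2 ^ i.+1] gives [kk M <= 2 ^ (i + 4)], so [lebesgue_dsum_tail] applies with [m = i + 4]. *)
pose G : set R := [set b | irr01 b /\ (2 ^ (i + 4 + s) * (i + 4 + s) < dsum b (kk M))%N].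
have detG : digit_det (kk M) G.
  split=> [b []//|b c' [bI nb] cI H]; split=> //.
  by rewrite (eq_dsum b).
have mG : measurable G by exact: digit_det_measurable detG.
have GE : (lam G <= eps%:E)%E.
  apply: (@le_trans _ _ (4 / 2 ^+ s)%:E); last by rewrite lee_fin.
  apply: lebesgue_dsum_tail; rewrite /kk expnD; move: Mi; rewrite expnS.
  by move: (2 ^ i)%N => x; case: e; lia.
have detB := digit_det_avoids n M; set B := avoids n M in detB *.
have mB := digit_det_measurable _ _ detB.
have detBG : digit_det (kk M) (B `\` G).
  case: (detB) (detG) => [BI BD] [GI GD]; split=> [b [/BI]//|b c' [Bb nGb] cI H].
  split; first exact: BD H.
  by move=> Gc; apply: nGb; apply: (GD c') => //; [exact: BI|move=> i' /H].
have mBG := digit_det_measurable _ _ detBG.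
have mE : measurable (@big_digit R D A (kk M)).
  exact: digit_det_measurable (digit_det_big _ _ _).
have step : (c%:E * lam (B `\` G) <= lam ((B `\` G) `&` big_digit D A (kk M)))%E.
  apply: (digit_det_ge (kk M)) => // a a0 sub.
  have [->|/set0P[b Cb]] := eqVneq (cyl a (kk M) 0 1 : set R) set0.
    by rewrite set0I measure0 mule0.
  have kk0 : (0 < kk M)%N by rewrite /kk addn4.
  apply: le_trans (big_digit_cyl D A (kk M) a D0 A0 kk0 a0).
  rewrite lee_wpmul2r // lee_fin ler_wpM2r ?mulr_ge0 ?invr_ge0 //.
  have [bB nG] := sub _ Cb; case: Cb => bI ba _.
  rewrite lef_pV2 ?posrE ?ltr0n ?muln_gt0 ?addn_gt0 ?muln_gt0 ?A0 ?D0 ?orbT //.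
  rewrite ler_nat leq_mul2l /= leq_mul2l; apply/orP; right; rewrite leq_add2r.
  have -> : (\sum_(1 <= j < (kk M).+1) a j = dsum b (kk M))%N.
    by apply: eq_big_nat => j jM; rewrite ba.
  by rewrite leqNgt; apply/negP => lt; apply: nG; split.
have avS : avoids n M.+1 = B `\` big_digit D A (kk M).
  apply/seteqP; split=> b.
    move=> [bI nb]; split; last by apply: nb; rewrite nM leqnn.
    by split=> // j /andP[nj jM]; apply: nb; rewrite nj ltnW.
  move=> [[bI nb] nM']; split=> // j /andP[nj]; rewrite ltnS leq_eqVlt.
  by move=> /orP[/eqP ->//|jM]; apply: nb; rewrite nj.
have disj : (lam (avoids n M.+1) + lam ((B `\` G) `&` big_digit D A (kk M)) <= lam B)%E.
  rewrite avS -measureU //; last 3 first.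
  - exact: measurableD.
  - exact: measurableI.
  - by apply/seteqP; split=> // b [[_ nE] [_ Eb]].
  rewrite le_measure // ?inE //.
    by apply: measurableU; [exact: measurableD|exact: measurableI].
  by move=> b [[]|[[]]].
have BG : (lam B <= lam (B `\` G) + lam G)%E.
  apply: (@le_trans _ _ (lam ((B `\` G) `|` G))).
    rewrite le_measure // ?inE //; first exact: measurableU.
    by move=> b Bb; have [|] := pselect (G b); [right|left].
  exact: measureU2.
have fB : lam B \is a fin_num := avoids_fin n M.
have fB' := avoids_fin n M.+1.
have fBG : lam (B `\` G) \is a fin_num.
  rewrite ge0_fin_numE // (@le_lt_trans _ _ 1%E) ?ltry //.
  by apply: lebesgue_sub_irr01 => // b [[]].
have fG : lam G \is a fin_num.
  by rewrite ge0_fin_numE // (le_lt_trans GE) // ltry.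
have fE : lam ((B `\` G) `&` big_digit D A (kk M)) \is a fin_num.
  rewrite ge0_fin_numE // (@le_lt_trans _ _ 1%E) ?ltry //.
  apply: lebesgue_sub_irr01; first by move=> b [[[]]].
  exact: measurableI.
move: step disj BG GE.
rewrite -(fineK fB) -(fineK fB') -(fineK fBG) -(fineK fG) -(fineK fE).
rewrite -EFinM -!EFinD !lee_fin /=.
set x := fine (lam B); set y := fine _; set z := fine (lam (B `\` G)).
set w := fine _; set g := fine (lam G) => h1 h2 h3 h4.
have h5 : c * (x - eps) <= c * z.
  by rewrite ler_wpM2l // lerBlDr (le_trans h3) // lerD2l.
by rewrite lerBrDr (le_trans _ h2) // lerD2l (le_trans h5).
Qed.

(* If the measures stayed [>= eps], each block of indices [2^i <= M < 2^(i+1)] would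
   remove at least [g / (i + 1)] from them, and the harmonic series diverges. *)
Lemma avoids_small n (eps : R) : 0 < eps -> exists M, (lam (avoids n M) < eps%:E)%E.
Proof.
move=> eps0; apply: contrapT => /forallNP big.
have [s seps] : exists s, 4 / 2 ^+ s <= eps / 2 :> R.
  pose s := (Num.truncn (8 / eps)).+1; exists s.
  have lt8 : 8 / eps < 2 ^+ s.
    apply: lt_trans (truncnS_gt _) _; rewrite -/s.
    have -> : 2 ^+ s = (2 ^ s)%N%:R :> R by rewrite natrX.
    by rewrite ltr_nat; exact: ltn_expl.
  rewrite ler_pdivrMr ?exprn_gt0 //.
  move: lt8; rewrite ltr_pdivrMr // => /ltW.
  by set x := 2 ^+ s; lra.
pose h i := fine (lam (avoids n (2 ^ i))).
have hbig M : eps <= fine (lam (avoids n M)).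
  have /negP := big M; rewrite -(fineK (avoids_fin n M)) lte_fin -leNgt.
  by [].
pose K : R := (2 * (A * (1 + 2 * D)) * 2 ^ (4 + s))%N%:R.
have K0 : 0 < K.
  have P : (0 < 2 ^ (4 + s))%N by rewrite expn_gt0.
  by rewrite ltr0n muln_gt0 P andbT muln_gt0 /= muln_gt0 A0.
pose k2 : R := ((2 * D * D.+1)%:R^-1 * (2 * D * D.+1)%:R^-1).
have k20 : 0 < k2 by rewrite mulr_gt0 // invr_gt0 ltr0n !muln_gt0 D0.
(* At level [i] the rate is at least [k2 / K] over [(4 + s) (i + 1) 2^i], and the measure exceeds
   the tolerated [eps / 2] by at least [eps / 2]; so [2^i] steps remove [g / (i + 1)]. *)
pose g := k2 / K * (eps / 2) / (4 + s)%:R.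
have s40 : 0 < (4 + s)%:R :> R by rewrite ltr0n.
have g0 : 0 < g by rewrite divr_gt0 // mulr_gt0 // divr_gt0.
apply: (@harmonic_decrease_absurd _ h g n g0).
  by move=> i; exact: fine_ge0.
move=> i ni.
have i2 : 0 < (2 ^ i)%:R :> R by rewrite ltr0n expn_gt0.
have n2 : (n <= 2 ^ i)%N by rewrite (leq_trans ni) // ltnW // ltn_expl.
have step t : (t <= 2 ^ i)%N -> fine (lam (avoids n (2 ^ i + t))) <=
   h i - t%:R * (g / i.+1%:R / (2 ^ i)%:R).
  elim: t => [|t IH] t2; first by rewrite addn0 mul0r subr0.
  have := IH (ltnW t2); rewrite addnS.
  have lt : (2 ^ i + t < 2 ^ i.+1)%N by rewrite expnS mul2n -addnn ltn_add2l.
  have := avoids_step _ _ _ _ _ (leq_trans n2 (leq_addr t _)) lt seps.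
  set c := rate _.
  have cg : g / i.+1%:R / (2 ^ i)%:R <= c * (eps / 2).
    have -> : g / i.+1%:R / (2 ^ i)%:R =
        (K * (4 + s)%N%:R * i.+1%:R * (2 ^ i)%:R)^-1 * k2 * (eps / 2).
      have fl (u v w x y z : R) : 0 < v -> 0 < x -> 0 < y -> 0 < z ->
          u / v * w / x / y / z = (v * x * y * z)^-1 * u * w.
        by move=> v0 x0 y0 z0; field; rewrite !gt_eqF.
      by rewrite /g fl // ltr0n.
    have e20 : 0 <= eps / 2 by rewrite divr_ge0 // ltW.
    rewrite ler_wpM2r // /c /rate -/k2 ler_wpM2r ?(ltW k20) //.
    rewrite lef_pV2 ?posrE; last 2 first.
    - by rewrite !mulr_gt0 // ltr0n.
    - by rewrite ltr0n !muln_gt0 A0 addn_gt0 !muln_gt0 D0 orbT.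
    rewrite /K -!natrM ler_nat.
    have -> : (2 * (A * (1 + 2 * D)) * 2 ^ (4 + s) * (4 + s) * i.+1 * 2 ^ i =
       2 * (A * (2 ^ (i + 4 + s) * ((4 + s) * i.+1) * (1 + 2 * D))))%N.
      by rewrite -addnA [(2 ^ (i + (4 + s)))%N]expnD; ring.
    rewrite leq_mul2l /= leq_mul2l; apply/orP; right; set P := (2 ^ _)%N.
    have P0 : (0 < P)%N by rewrite expn_gt0.
    apply: (@leq_trans (P * ((4 + s) * i.+1) + 2 * D)).
      by rewrite leq_add2r leq_mul2l; apply/orP; right; lia.
    by rewrite mulnDr muln1 leq_add2l leq_pmull // muln_gt0 P0 muln_gt0.
  have : c * (eps / 2) <= c * (fine (lam (avoids n (2 ^ i + t))) - eps / 2).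
    rewrite ler_wpM2l ?mulr_ge0 ?invr_ge0 //.
    have := hbig (2 ^ i + t)%N; lra.
  rewrite -[t.+1]addn1 natrD mulrDl mul1r.
  move: cg; set u := g / _ / _; set v := fine (lam (avoids n (2 ^ i + t))).
  lra.
have := step _ (leqnn _); rewrite addnn -mul2n -expnS /h.
by rewrite [_ * (_ / _)]mulrC divfK // gt_eqF.
Qed.

Lemma ae_big_digit :
  {ae lam, forall alpha, irr01 alpha -> forall n, exists2 j, (n <= j)%N &
     big_digit D A (4 * j + 4 + e) alpha}.
Proof.
suff H n : lam.-negligible (\bigcap_M avoids n M).
  apply: negligibleS (negligible_bigcup H) => b /= nH.
  apply: contrapT => nb; apply: nH => bI n.
  apply: contrapT => nE; apply: nb; exists n => // M _; split=> // j /andP[nj jM] E.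
  by apply: nE; exists j.
have mav M : measurable (avoids n M).
  exact: digit_det_measurable (digit_det_avoids n M).
have mcap : measurable (\bigcap_M avoids n M) by exact: bigcap_measurable.
apply/negligibleP => //; apply/eqP; rewrite eq_le measure_ge0 andbT.
apply/lee_addgt0Pr => eps eps0; rewrite add0e.
have [M /ltW] := avoids_small n _ eps0; apply: le_trans.
apply: le_measure; rewrite ?inE; [exact: mcap|exact: mav|].
by move=> b /(_ M I).
Qed.

End Recurrence.

(** * The sawtooth function along rational rotations *)

Section Sawtooth.
Context {R : realType}.
Implicit Types (x y z h s t u v w : R) (n : nat).
Local Notation fl x := ((Num.floor x)%:~R : R).

Definition saw x : R := fracpart x - 2^-1.
(** The continuous 1-periodic primitive of [saw] that vanishes at the integers. *)
Definition saw2 x : R := (fracpart x ^+ 2 - fracpart x) / 2.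

Lemma sawDi x (m : int) : saw (x + m%:~R) = saw x.
Proof. by rewrite /saw fracpartDi. Qed.

Lemma saw2Di x (m : int) : saw2 (x + m%:~R) = saw2 x.
Proof. by rewrite /saw2 fracpartDi. Qed.

Lemma saw_bound x : `|saw x| <= 2^-1.
Proof. by rewrite ler_norml /saw; have := fracpart_itv x; lra. Qed.

Lemma le_fl s t : s <= t -> fl s <= fl t.
Proof. by move=> st; rewrite ler_int le_floor. Qed.

Lemma flDi x (m : int) : fl (x + m%:~R) = fl x + m%:~R.
Proof. by rewrite floorDrz ?intr_int // intrKfloor intrD. Qed.

(** The floor difference counts the integers in the window, each of which costs a unit jump. Keeping
    this count, and not a constant, allows the errors of a block to be added up exactly. *)
Lemma saw_close z h s t : z <= s <= z + h -> z <= t <= z + h ->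
  `|saw s - saw t| <= h + (fl (z + h) - fl z).
Proof.
move=> /andP[s1 s2] /andP[t1 t2]; rewrite /saw /fracpart ler_norml.
have := le_fl _ _ s1; have := le_fl _ _ s2; have := le_fl _ _ t1.
have := le_fl _ _ t2; lra.
Qed.

(** Hermite's identity: the difference [G] of the two sides has period [1 / n] and vanishes on
    [[0, 1 / n)]. *)
Lemma hermite n z : (0 < n)%N ->
  \sum_(r < n) fl (z + r%:R / n%:R) = fl (n%:R * z).
Proof.
move=> n0; have n0' : 0 < n%:R :> R by rewrite ltr0n.
pose G x := \sum_(r < n) fl (x + r%:R / n%:R) - fl (n%:R * x).
have Gnat x (m : nat) : G (x + m%:R / n%:R) = G x.
  elim: m => [|m IH]; first by rewrite mul0r addr0.
  rewrite -IH -[m.+1%:R]natr1 mulrDl addrA; move: (x + _) => {IH}y.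
  case: n n0 n0' @G => // n _ n0' G; rewrite /G.
  rewrite big_ord_recr [in RHS]big_ord_recl /= mul0r addr0.
  have -> : fl (n.+1%:R * (y + 1 / n.+1%:R)) = fl (n.+1%:R * y) + 1.
    rewrite mulrDr div1r divff ?gt_eqF //.
    by rewrite -[X in _ + X]/(1%:~R) floorDrz ?intr_int // intrKfloor intrD.
  have -> : fl (y + 1 / n.+1%:R + n%:R / n.+1%:R) = fl y + 1.
    rewrite -addrA -mulrDl addrC [1 + _]addrC natr1 divff ?gt_eqF // addrC.
    by rewrite -[X in _ + X]/(1%:~R) floorDrz ?intr_int // intrKfloor intrD.
  under eq_bigr => i _.
    rewrite -addrA -mulrDl [1 + _]addrC natr1.
  over.
  under [in RHS]eq_bigr => i _ do rewrite /bump /= add1n.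
  lra.
have Gint x (m : int) : G (x + m%:~R / n%:R) = G x.
  case: m => m; first exact: Gnat.
  rewrite NegzE mulrNz -pmulrn mulNr.
  by rewrite -[LHS](Gnat _ m.+1) subrK.
pose m := Num.floor (n%:R * z); pose e := z - m%:~R / n%:R.
have /andP[m1 m2] := floor_itv (n%:R * z).
have ne : n%:R * e = n%:R * z - m%:~R by rewrite /e mulrBr mulrCA divff ?gt_eqF // mulr1.
have e0 : 0 <= e by rewrite -(pmulr_rge0 _ n0') ne subr_ge0.
have e1 : n%:R * e < 1 by rewrite ne ltrBlDl -[X in _ + X]/(1%:~R) -intrD.
suff : G z = 0 by move=> /eqP; rewrite subr_eq0 => /eqP.
have -> : z = e + m%:~R / n%:R by rewrite /e subrK.
rewrite Gint /G (@floor_def _ _ 0); last first.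
  by rewrite e1 andbT mulr_ge0 // ltW.
rewrite subr0 big1 // => r _; rewrite (@floor_def _ _ 0) //.
rewrite addr_ge0 ?divr_ge0 //= -(ltr_pM2l n0') mulrDr mulrCA divff ?gt_eqF //.
rewrite !mulr1; have : (r.+1)%:R <= n%:R :> R by rewrite ler_nat.
by rewrite -natr1; lra.
Qed.

Lemma sum_nat_div n : (0 < n)%N -> \sum_(r < n) r%:R / n%:R = (n%:R - 1) / 2 :> R.
Proof.
move=> n0; have n0' : n%:R != 0 :> R by rewrite pnatr_eq0 -lt0n.
rewrite -mulr_suml; apply: (mulIf n0'); rewrite divfK //.
elim: n {n0 n0'} => [|n IH]; first by rewrite big_ord0 mulr0.
by rewrite big_ord_recr /= IH -natr1; field.
Qed.

Lemma saw_hermite n z : (0 < n)%N ->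
  \sum_(r < n) saw (z + r%:R / n%:R) = saw (n%:R * z).
Proof.
move=> n0; rewrite /saw /fracpart !sumrB hermite // big_split /= sum_nat_div //.
rewrite !sumr_const !card_ord -[z *+ n]mulr_natl -[2^-1 *+ n]mulr_natl.
set a := fl (n%:R * z); set b := n%:R * z; lra.
Qed.

(** Multiplication by [p] permutes the residues modulo [n], and the periodicity of [G] absorbs the
    quotients. *)
Lemma sum_coprime (V : nmodType) (G : R -> V) n p y : (0 < n)%N -> coprime p n ->
  (forall x (m : int), G (x + m%:~R) = G x) ->
  \sum_(i < n) G (y + (i * p)%:R / n%:R) = \sum_(r < n) G (y + r%:R / n%:R).
Proof.
move=> n0 cpn Gp; have n0' : n%:R != 0 :> R by rewrite pnatr_eq0 -lt0n.
case: n n0 cpn n0' => // n _ cpn n0'.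
pose s (i : 'I_n.+1) : 'I_n.+1 := inord ((i * p) %% n.+1)%N.
have sE i : s i = ((i * p) %% n.+1)%N :> nat by rewrite inordK // ltn_mod.
have sI : injective s.
  move=> i j ij; have := congr1 (@nat_of_ord n.+1) ij; rewrite !sE => /eqP.
  wlog ji : i j {ij} / (j <= i)%N.
    move=> H; case: (leqP j i) => [/H//|/ltnW ji]; rewrite eq_sym => E.
    by apply/esym/H.
  rewrite eqn_mod_dvd ?leq_mul2r ?ji ?orbT // -mulnBl Gauss_dvdl; last first.
    by rewrite coprime_sym.
  move=> d; apply/val_inj => /=; apply/eqP; rewrite eqn_leq ji andbT -subn_eq0.
  apply: contraTT d => ne; rewrite gtnNdvd // ?lt0n //.
  by rewrite (leq_ltn_trans (leq_subr _ _)).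
rewrite [RHS](reindex_inj sI) /=; apply: eq_bigr => i _.
rewrite sE {1}(divn_eq (i * p) n.+1) natrD natrM mulrDl mulfK // addrCA addrC.
exact: (Gp _ ((i * p) %/ n.+1)%N).
Qed.

(** Every point moves within a window of length [h]. The crossings counted by [saw_close] add up,
    again by [hermite], to those of the one window dilated by [n]. *)
Lemma saw_block n p z h u (e : nat -> R) : (0 < n)%N -> coprime p n ->
  z <= u <= z + h -> (forall i, (i < n)%N -> z <= e i <= z + h) ->
  `|\sum_(i < n) saw ((i * p)%:R / n%:R + e i) - saw (n%:R * u)| <=
    n%:R * h + (fl (n%:R * (z + h)) - fl (n%:R * z)).
Proof.
move=> n0 cpn zu ze.
rewrite -saw_hermite // -(sum_coprime _ saw n p u) //; last exact: sawDi.
rewrite -sumrB (le_trans (ler_norm_sum _ _ _)) //.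
have -> : fl (n%:R * (z + h)) - fl (n%:R * z) =
    \sum_(i < n) (fl (z + (i * p)%:R / n%:R + h) - fl (z + (i * p)%:R / n%:R)).
  rewrite (sum_coprime _ (fun x => fl (x + h) - fl x)) //.
    by rewrite -!hermite // -sumrB; apply: eq_bigr => r _; rewrite addrAC.
  by move=> x m; rewrite addrAC !flDi opprD addrACA subrr addr0.
have -> : n%:R * h = \sum_(i < n) h by rewrite sumr_const card_ord mulr_natl.
rewrite -big_split /=; apply: ler_sum => i _.
have := ze i (ltn_ord i); set q := _ / _ => eb.
by apply: saw_close; lra.
Qed.

(** The remainder is [h^2 / 2] when no integer is crossed. For [h <= 1] at most one is crossed,
    which adds a term of size at most [h]. *)
Lemma saw2_step z h : 0 <= h <= 1 ->
  `|saw2 (z + h) - saw2 z - h * saw z| <= h * (h + (fl (z + h) - fl z)).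
Proof.
move=> /andP[h0 h1]; have /andP[x0 x1] := fracpart_itv z.
pose x := fracpart z.
have zE : z = x + fl z by rewrite /x /fracpart subrK.
have hh : 0 <= h * h by rewrite mulr_ge0.
have [lt1|ge1] := ltP (x + h) 1.
  have f1 : Num.floor (z + h) = Num.floor z.
    apply: floor_def; rewrite intrD; move: zE lt1 x0; rewrite -/x; lra.
  rewrite f1 subrr addr0.
  have -> : saw2 (z + h) - saw2 z - h * saw z = h * h / 2.
    by rewrite /saw2 /saw {1}/fracpart {1}/fracpart f1 {1 3}zE -/x; field.
  rewrite ger0_norm; lra.
have f1 : Num.floor (z + h) = Num.floor z + 1.
  apply: floor_def; rewrite !intrD; move: zE x1; rewrite -/x; lra.
have -> : saw2 (z + h) - saw2 z - h * saw z = h * h / 2 + (1 - x - h).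
  by rewrite /saw2 /saw {1}/fracpart {1}/fracpart f1 intrD {1 3}zE -/x; field.
rewrite f1 intrD [_ + 1%:~R]addrC addrK mulrDr mulr1 ler_norml.
by move: x1; rewrite -/x; lra.
Qed.

Lemma saw2_step_signed z h u : `|h| <= 1 ->
  Num.min z (z + h) <= u <= Num.max z (z + h) ->
  `|saw2 (z + h) - saw2 z - h * saw u| <= 2 * `|h| * (`|h| + `|fl (z + h) - fl z|).
Proof.
wlog h0 : z h / 0 <= h.
  move=> H; have [h0|h0] := leP 0 h; first exact: H.
  have h0' : 0 <= - h by rewrite oppr_ge0; exact: ltW h0.
  move=> h1 zu; have := H (z + h) (- h) h0'.
  rewrite addrK normrN minC maxC => /(_ h1 zu).
  rewrite [`|fl z - _|]distrC.
  have -> : saw2 z - saw2 (z + h) - - h * saw u =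
    - (saw2 (z + h) - saw2 z - h * saw u) by ring.
  by rewrite normrN.
rewrite ger0_norm // => h1; rewrite min_l ?max_r ?lerDl // => zu.
have flh : fl z <= fl (z + h) by rewrite le_fl // lerDl.
rewrite [`|fl _ - _|]ger0_norm ?subr_ge0 //.
have st := saw2_step z h; rewrite h0 h1 in st; have {}st := st isT.
have zz : z <= z <= z + h by lra.
have cl := saw_close z h z u zz zu.
have -> : saw2 (z + h) - saw2 z - h * saw u =
   (saw2 (z + h) - saw2 z - h * saw z) + h * (saw z - saw u) by ring.
rewrite (le_trans (ler_normD _ _)) // normrM ger0_norm //.
rewrite [2 * h]mulrC -mulrA mulr2n mulrDl mul1r mulrDr lerD //.
by rewrite ler_wpM2l.
Qed.

Lemma sum_blocks (V : nmodType) (f : nat -> V) b n :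
  \sum_(0 <= m < b * n) f m = \sum_(0 <= j < b) \sum_(i < n) f (j * n + i)%N.
Proof.
elim: b => [|b IH]; first by rewrite mul0n !big_nil.
rewrite big_nat_recr //= -IH mulSn addnC (@big_cat_nat _ _ _ (b * n)) ?leq_addr //=.
congr (_ + _); rewrite -{1}[(b * n)%N]add0n big_addn addKn big_mkord.
by apply: eq_bigr => i _; rewrite addnC.
Qed.

(** The floors move monotonically in the direction of [h], so their absolute increments
    telescope. *)
Lemma fl_variation w h b :
  \sum_(0 <= j < b) `|fl (w + j.+1%:R * h) - fl (w + j%:R * h)| <= b%:R * `|h| + 1.
Proof.
have mono (j : nat) : w + j.+1%:R * h = w + j%:R * h + h.
  by rewrite -natr1 mulrDl mul1r addrA.
have tel : \sum_(0 <= j < b) (fl (w + j.+1%:R * h) - fl (w + j%:R * h))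
    = fl (w + b%:R * h) - fl w.
  by rewrite (telescope_sumr (fun j => fl (w + j%:R * h))) // mul0r addr0.
have := floor_itv (w + b%:R * h); have := floor_itv w; rewrite !intrD.
have [h0|h0] := leP 0 h.
  rewrite (eq_bigr (fun j : nat => fl (w + j.+1%:R * h) - fl (w + j%:R * h))).
    rewrite tel (ger0_norm h0); lra.
  by move=> j _; rewrite ger0_norm // subr_ge0 mono le_fl // lerDl.
rewrite (eq_bigr (fun j : nat => - (fl (w + j.+1%:R * h) - fl (w + j%:R * h)))).
  rewrite sumrN tel (ltr0_norm h0); lra.
by move=> j _; rewrite ler0_norm // subr_le0 mono le_fl // gerDl ltW.
Qed.

Lemma norm_fl_range z h : fl (Num.min z (z + h) + `|h|) - fl (Num.min z (z + h)) =
  `|fl (z + h) - fl z|.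
Proof.
have [h0|h0] := leP 0 h.
  by rewrite min_l ?lerDl // ger0_norm // ger0_norm // subr_ge0 le_fl // lerDl.
rewrite min_r ?gerDl ?(ltW h0) // ltr0_norm // addrK ler0_norm ?opprB //.
by rewrite subr_le0 le_fl // gerDl ltW.
Qed.

Lemma norm_range z h t : 0 <= t <= 1 ->
  Num.min z (z + h) <= z + t * h <= Num.min z (z + h) + `|h|.
Proof.
move=> /andP[t0 t1].
have [h0|h0] := leP 0 h.
  have := mulr_ge0 t0 h0; have : t * h <= h by rewrite ler_piMl.
  by rewrite min_l ?lerDl // ger0_norm //; lra.
have : 0 <= t * - h by rewrite mulr_ge0 //; lra.
have : t * - h <= - h by rewrite ler_piMl //; lra.
by rewrite min_r ?gerDl ?(ltW h0) // ltr0_norm //; lra.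
Qed.

(** Modulo 1 the points of block [j] are [i p / n + e i], where [e i] drifts from [z0] by at most
    [n |d|]. Dilation by [n] turns the drift into [th], and [n z0] is [n v + j th] plus the integer
    [p]. *)
Lemma saw_orbit_block n p (d v th : R) (j : nat) : (0 < n)%N -> coprime p n ->
  th = n%:R ^+ 2 * d ->
  `|\sum_(i < n) saw ((j * n + i).+1%:R * (p%:R / n%:R + d) + v) -
    saw (n%:R * v + j%:R * th)| <=
  `|th| + `|fl (n%:R * v + j.+1%:R * th) - fl (n%:R * v + j%:R * th)|.
Proof.
move=> n0 cpn thE; have n0' : 0 < n%:R :> R by rewrite ltr0n.
pose z0 := p%:R / n%:R + v + j%:R * (n%:R * d).
pose h := n%:R * d.
pose e i := p%:R / n%:R + v + (j * n + i).+1%:R * d.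
have z0E : n%:R * z0 = n%:R * v + j%:R * th + p%:R.
  by rewrite /z0 thE; field; rewrite gt_eqF.
have nhE : n%:R * h = th by rewrite /h thE mulrA expr2.
have eE i : (i < n)%N -> Num.min z0 (z0 + h) <= e i <= Num.min z0 (z0 + h) + `|h|.
  move=> ilt.
  have -> : e i = z0 + i.+1%:R / n%:R * h.
    rewrite /e /z0 /h -!natr1 natrD natrM; field; rewrite gt_eqF //.
  apply: norm_range; rewrite divr_ge0 //= ler_pdivrMr // mul1r ler_nat //.
have z0z : Num.min z0 (z0 + h) <= z0 <= Num.min z0 (z0 + h) + `|h|.
  have := norm_range z0 h 0; rewrite lexx ler01 mul0r addr0 => /(_ isT) H.
  exact: H.
have := saw_block n p _ _ z0 e n0 cpn z0z eE.
have -> : saw (n%:R * z0) = saw (n%:R * v + j%:R * th).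
  by rewrite z0E; exact: (sawDi _ p).
have -> : \sum_(i < n) saw ((i * p)%:R / n%:R + e i) =
    \sum_(i < n) saw ((j * n + i).+1%:R * (p%:R / n%:R + d) + v).
  apply: eq_bigr => i _; rewrite -[RHS](sawDi _ (- (j * p)%N%:Z)) mulrNz -pmulrn.
  congr saw; rewrite /e -!natr1 !natrD !natrM; field; rewrite gt_eqF //.
move=> H; apply: (le_trans H).
have nh : n%:R * `|h| = `|th| by rewrite -nhE [RHS]normrM normr_nat.
rewrite mulrDr nh lerD2l -nh.
have -> : n%:R * Num.min z0 (z0 + h) = Num.min (n%:R * z0) (n%:R * z0 + th).
  by rewrite -nhE -mulrDr minr_pMr // ltW.
rewrite nh norm_fl_range z0E.
have -> : n%:R * v + j.+1%:R * th = n%:R * v + j%:R * th + th.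
  by rewrite -natr1; ring.
rewrite addrAC !(flDi _ p) opprD addrACA subrr addr0 //.
Qed.

(** Times [th], the blocks form a Riemann sum of [saw] with step [th], which is compared with the
    telescoping increments of its primitive [saw2]. *)
Lemma saw_birkhoff n p (d v th : R) b : (0 < n)%N -> coprime p n ->
  th = n%:R ^+ 2 * d ->
  b%:R * `|th| <= 1 -> `|th| <= 1 ->
  `|th * (\sum_(0 <= m < b * n) saw (m.+1%:R * (p%:R / n%:R + d) + v)) -
    (saw2 (n%:R * v + b%:R * th) - saw2 (n%:R * v))| <= 9 * `|th|.
Proof.
move=> n0 cpn thE bth th1; rewrite sum_blocks.
have -> : saw2 (n%:R * v + b%:R * th) - saw2 (n%:R * v) =
    \sum_(0 <= j < b) (saw2 (n%:R * v + j.+1%:R * th) - saw2 (n%:R * v + j%:R * th)).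
  by rewrite (telescope_sumr (fun j => saw2 (n%:R * v + j%:R * th))) // mul0r addr0.
rewrite mulr_sumr -sumrB (le_trans (ler_norm_sum _ _ _)) //.
(* The factor 3 is 2 from [saw2_step_signed] plus 1 from [saw_orbit_block]. The brackets sum to at
   most [2 b |th| + 1 <= 3], whence 9. *)
apply: (@le_trans _ _ (\sum_(0 <= j < b) 3 * `|th| *
  (`|th| + `|fl (n%:R * v + j.+1%:R * th) - fl (n%:R * v + j%:R * th)|))); last first.
  rewrite -mulr_sumr big_split /= sumr_const_nat subn0 -[_ *+ b]mulr_natl.
  have := fl_variation (n%:R * v) th b.
  set x := \sum_(_ <= _ < _) _ => xb.
  have -> : 9 * `|th| = 3 * `|th| * 3 by ring.
  by rewrite ler_wpM2l ?mulr_ge0 //; lra.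
apply: ler_sum => j _.
have := saw_orbit_block n p d v th j n0 cpn thE.
have zE : n%:R * v + j.+1%:R * th = n%:R * v + j%:R * th + th.
  by rewrite -natr1; ring.
rewrite zE; set z := n%:R * v + j%:R * th.
have := saw2_step_signed z th z th1.
rewrite ge_min lexx le_max lexx => /(_ isT).
set c := `|fl _ - _|; set S := \sum_(_ < _) _ => h1 h2.
have -> : th * S - (saw2 (z + th) - saw2 z) =
  - (saw2 (z + th) - saw2 z - th * saw z) + th * (S - saw z) by ring.
rewrite (le_trans (ler_normD _ _)) // normrN normrM.
have -> : 3 * `|th| * (`|th| + c) = 2 * `|th| * (`|th| + c) + `|th| * (`|th| + c) by ring.
by rewrite lerD // ler_wpM2l.
Qed.

End Sawtooth.

(** * Bounds for the primitive of the sawtooth and for its combinations *)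

Section SawtoothPrimitive.
Context {R : realType}.
Local Notation fl x := ((Num.floor x)%:~R : R).

Lemma saw_denjoy n p (d v : R) : (0 < n)%N -> coprime p n ->
  n%:R ^+ 2 * `|d| <= 1 ->
  `|\sum_(i < n) saw (i.+1%:R * (p%:R / n%:R + d) + v)| <= 4.
Proof.
move=> n0 cpn nd.
have := saw_orbit_block n p d v _ 0 n0 cpn erefl.
set th := _ * d; rewrite !mul0r !addr0 mul1r.
under eq_bigr => i _ do rewrite mul0n add0n.
have th1 : `|th| <= 1 by rewrite /th normrM ger0_norm ?exprn_ge0.
have := saw_bound (n%:R * v).
have fl1 : `|fl (n%:R * v + th) - fl (n%:R * v)| <= 2.
  have := floor_itv (n%:R * v + th); have := floor_itv (n%:R * v).
  rewrite !intrD ler_norml; move: th1; rewrite ler_norml.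
  set x := n%:R * v; set y := fl x; set z := fl (x + th); lra.
move: fl1; set x := `|fl _ - _|; set y := saw _; set S := \sum_(_ < _) _.
have := ler_normD (S - y) y; rewrite subrK; lra.
Qed.

Lemma saw2_bound (x : R) : `|saw2 x| <= 2^-1.
Proof.
rewrite /saw2; have := fracpart_itv x; set y := fracpart x => /andP[y0 y1].
have : 0 <= y * (1 - y) by rewrite mulr_ge0; lra.
have : y * y <= 1 by rewrite mulr_ile1; lra.
rewrite ler_norml; have := mulr_ge0 y0 y0; lra.
Qed.

Lemma saw2_lip (s t : R) : `|saw2 s - saw2 t| <= 4 * `|s - t|.
Proof.
wlog ts : s t / t <= s.
  by move=> H; case: (leP t s) => [/H//|/ltW/H]; rewrite distrC [`|t - s|]distrC.
have [st1|st1] := leP (s - t) 1; last first.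
  have := saw2_bound s; have := saw2_bound t; have := ler_normB (saw2 s) (saw2 t).
  rewrite [`|s - t|]ger0_norm; lra.
have := saw2_step t (s - t).
rewrite subr_ge0 ts st1 => /(_ isT); have -> : t + (s - t) = s by ring.
have := floor_itv s; have := floor_itv t; rewrite !intrD => f1 f2.
have f3 : fl s - fl t <= 2 by move: f1 f2; lra.
have := saw_bound t; rewrite [`|s - t|]ger0_norm ?subr_ge0 //.
set h := s - t in st1 *; set x := saw2 _ - _; set c := fl s - fl t in f3 *.
move=> sb H.
have h0 : 0 <= h by rewrite subr_ge0.
have : h * (h + c) <= h * 3 by rewrite ler_wpM2l //; lra.
have : `|h * saw t| <= h * 2^-1 by rewrite normrM ger0_norm // ler_wpM2l.
have := ler_normD (x - h * saw t) (h * saw t); rewrite subrK.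
set a := `|h * saw t|; set b := h * (h + c) in H *; set u := `|_ - _| in H *; lra.
Qed.

Lemma saw2_second_diff_int (z : int) (h : R) : 0 < h < 1 ->
  saw2 (z%:~R + h) + saw2 (z%:~R - h) - 2 * saw2 z%:~R = h ^+ 2 - h.
Proof.
move=> /andP[h0 h1].
have -> : saw2 (z%:~R - h) = saw2 (1 - h).
  by rewrite -[RHS](saw2Di _ (z - 1)) intrD; congr saw2; ring.
rewrite addrC -[X in saw2 X](add0r z%:~R) saw2Di.
rewrite [z%:~R + h]addrC saw2Di /saw2 !fracpart_id; first by field.
all: lra.
Qed.

Lemma saw2_second_diff (x h : R) : 0 <= h -> h <= fracpart x -> fracpart x + h < 1 ->
  saw2 (x + h) + saw2 (x - h) - 2 * saw2 x = h ^+ 2.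
Proof.
move=> h0 hx xh.
have xE : x = fracpart x + fl x by rewrite /fracpart subrK.
have -> : saw2 (x + h) = saw2 (fracpart x + h).
  by rewrite -[RHS](saw2Di _ (Num.floor x)) {1}xE addrAC.
have -> : saw2 (x - h) = saw2 (fracpart x - h).
  by rewrite -[RHS](saw2Di _ (Num.floor x)) {1}xE addrAC.
have -> : saw2 x = saw2 (fracpart x).
  by rewrite -[RHS](saw2Di _ (Num.floor x)) {1}xE.
rewrite /saw2 !(fracpart_id (fracpart x + h)) ?(fracpart_id (fracpart x - h))
  ?(fracpart_id (fracpart x)); first by field.
all: lra.
Qed.

(** A periodic primitive of the jump part [saw_comb]; the profile [I] is its increment from the base
    point. *)
Definition saw2_comb (D : nat) (J : nat -> R) (t : R) : R :=
  \sum_(k < D) J k * saw2 (t - k%:R / D%:R).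

Lemma saw2_combDi D J t (m : int) : saw2_comb D J (t + m%:~R) = saw2_comb D J t.
Proof. by apply: eq_bigr => k _; rewrite addrAC saw2Di. Qed.

Lemma saw2_comb_lip D J s t :
  `|saw2_comb D J s - saw2_comb D J t| <= 4 * (\sum_(k < D) `|J k|) * `|s - t|.
Proof.
rewrite /saw2_comb -sumrB (le_trans (ler_norm_sum _ _ _)) // mulr_sumr mulr_suml.
apply: ler_sum => k _; rewrite -mulrBr normrM.
have -> : 4 * `|J k| * `|s - t| = `|J k| * (4 * `|s - t|) by ring.
rewrite ler_wpM2l //.
by rewrite (le_trans (saw2_lip _ _)) // opprD addrACA subrr addr0.
Qed.

(** Keeps the kinks of the other terms at distance at least [1 / D], so a second difference at a
    grid point with a smaller step sees a single kink. *)
Lemma fracpart_rat_away (D j k : nat) : (j < D)%N -> (k < D)%N -> j != k ->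
  D%:R^-1 <= fracpart (k%:R / D%:R - j%:R / D%:R : R) <= 1 - D%:R^-1.
Proof.
move=> jD kD jk; have D0 : 0 < D%:R :> R by rewrite ltr0n; case: D jD kD.
have Dx (a b : nat) : (a <= b)%N -> a%:R / D%:R <= b%:R / D%:R :> R.
  by move=> ab; rewrite ler_pM2r ?invr_gt0 // ler_nat.
have DD : D%:R / D%:R = 1 :> R by rewrite divff ?gt_eqF.
have V0 : 0 < D%:R^-1 :> R by rewrite invr_gt0.
have := Dx _ _ (leq0n j); have := Dx _ _ (leq0n k).
have := Dx _ _ jD; have := Dx _ _ kD.
rewrite -[k.+1]addn1 -[j.+1]addn1 !natrD !mulrDl mul0r div1r DD.
move=> k1 j1 k0 j0; move: jk; rewrite neq_ltn => /orP[jk|kj].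
  have := Dx _ _ jk; rewrite -[j.+1]addn1 natrD mulrDl div1r => h.
  by rewrite fracpart_id; lra.
have := Dx _ _ kj; rewrite -[k.+1]addn1 natrD mulrDl div1r => h.
rewrite -[X in fracpart X](addrK 1) -[X in fracpart (_ - X)]/(1%:~R).
rewrite -mulrNz fracpartDi fracpart_id; lra.
Qed.

(* The second difference with step [h] at [k / D] is [h^2 (sum_j J j) - h (J k)]; it
   cannot vanish for two small values of [h]. *)
Lemma saw2_comb_nonconst D J k q : (k < D)%N -> J k != 0 ->
  exists t, [/\ 0 < t, t < 1 & saw2_comb D J (q + t) != saw2_comb D J q].
Proof.
move=> kD Jk; have D0' : (0 < D)%N by case: D kD.
have D0 : 0 < D%:R :> R by rewrite ltr0n.
suff [t tq] : exists t, saw2_comb D J (q + t) != saw2_comb D J q.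
  exists (fracpart t); have /andP[f0 f1] := fracpart_itv t.
  have tE : saw2_comb D J (q + fracpart t) = saw2_comb D J (q + t).
    by rewrite -[LHS](saw2_combDi _ _ _ (Num.floor t)) /fracpart -addrA subrK.
  split; rewrite ?tE // lt_neqAle f0 andbT eq_sym.
  by apply: contraNneq tq => ft; rewrite -tE ft addr0.
apply: contrapT => /forallNP cst.
have C t : saw2_comb D J t = saw2_comb D J q.
  by have /negP := cst (t - q); rewrite negbK addrC subrK => /eqP.
have key h : 0 < h -> h < D%:R^-1 -> h * \sum_(j < D) J j = J k.
  move=> h0 hD.
  have hD1 : h < 1.
    by rewrite (lt_le_trans hD) // invf_le1 // ler1n.
  pose u : R := k%:R / D%:R.
  have : saw2_comb D J (u + h) + saw2_comb D J (u - h) - 2 * saw2_comb D J u = 0.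
    by rewrite !C; ring.
  rewrite /saw2_comb -big_split /= mulr_sumr -sumrB.
  rewrite (eq_bigr (fun j : 'I_D => h ^+ 2 * J j - (if j == Ordinal kD then h * J k else 0))).
    rewrite sumrB -mulr_sumr -big_mkcond big_pred1_eq expr2 -mulrA -mulrBr.
    by move=> /eqP; rewrite mulf_eq0 gt_eqF //= subr_eq0 => /eqP.
  move=> j _.
  have -> : J j * saw2 (u + h - j%:R / D%:R) + J j * saw2 (u - h - j%:R / D%:R) -
     2 * (J j * saw2 (u - j%:R / D%:R)) =
     J j * (saw2 (u - j%:R / D%:R + h) + saw2 (u - j%:R / D%:R - h)
            - 2 * saw2 (u - j%:R / D%:R)).
    by rewrite [u + h - _]addrAC [u - h - _]addrAC; ring.
  case: eqP => [->|/eqP jk].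
    rewrite /u /= subrr (saw2_second_diff_int 0); last by rewrite h0 hD1.
    by ring.
  have /andP[w1 w2] := fracpart_rat_away _ _ _ (ltn_ord j) kD jk.
  by rewrite saw2_second_diff ?subr0; [rewrite mulrC|exact: ltW|rewrite /u; lra|
    rewrite /u; lra].
have D1 : 0 < D%:R^-1 :> R by rewrite invr_gt0.
have h1 := key (D%:R^-1 / 2); have h2 := key (D%:R^-1 / 4).
have {}h1 := h1 (ltac:(lra)) (ltac:(lra)); have {}h2 := h2 (ltac:(lra)) (ltac:(lra)).
have : J k = 0 by move: h1 h2; set S := \sum_(_ < _) _; set x := D%:R^-1; lra.
by move/eqP; rewrite (negbTE Jk).
Qed.

End SawtoothPrimitive.

(** * Decomposition of piecewise smooth functions *)

Section CellwiseSmooth.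
Context {R : realType}.
Implicit Types (f g : R -> R) (x y z : R) (D : nat).
Local Notation fl x := ((Num.floor x)%:~R : R).

Definition off_grid D x : Prop := forall m : int, D%:R * x != m%:~R.

(** The breakpoints are enlarged to the grid of multiples of [1 / D], and the fractional part
    extends the derivative [g], controlled on [[0, 1)], periodically. *)
Definition cellwise_smooth D f g (B : R) : Prop :=
  [/\ forall x, f (x + 1) = f x,
      forall x, off_grid D x -> is_derive x 1 f (g (fracpart x)),
      forall x, 0 <= x < 1 -> `|g x| <= B & BV_01 g].

Lemma BV_01_bounded g : BV_01 g -> exists B, 0 <= B /\
  forall x, 0 <= x < 1 -> `|g x| <= B.
Proof.
move=> [M HM]; exists (`|g 0| + `|M|); split; first by rewrite addr_ge0.
move=> x x01.
have := HM (fun i => if i is 0%N then 0 else x) 1%N.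
rewrite big_ord1 /= => H.
have {H} : `|g x - g 0| <= M.
  apply: H => [[|i]|[|i]] //= _; first by rewrite lexx ltr01.
  by case/andP: x01.
have := ler_normD (g x - g 0) (g 0); rewrite subrK; have := ler_norm M.
set a := `|g x - g 0|; lra.
Qed.

Lemma periodic_int f : (forall x, f (x + 1) = f x) ->
  forall x (m : int), f (x + m%:~R) = f x.
Proof.
move=> fp x m; have fn y (n : nat) : f (y + n%:R) = f y.
  elim: n y => [|n IH] y; first by rewrite addr0.
  by rewrite -natr1 addrA fp IH.
case: m => n; first exact: fn.
by rewrite NegzE mulrNz -pmulrn -[LHS](fn _ n.+1) subrK.
Qed.

Lemma grid_fracpart D x : off_grid D x -> off_grid D (fracpart x).
Proof.
move=> xg m; have := xg (m + D%:Z * Num.floor x); apply: contraNneq.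
by rewrite /fracpart mulrBr intrD intrM => <-; rewrite -pmulrn; apply/eqP; ring.
Qed.

Lemma irr_off_grid D x : (0 < D)%N -> irr x -> off_grid D x.
Proof.
move=> D0 xI m; apply: contraNneq (xI (m%:~R / D%:R)) => xE.
rewrite fmorph_div /= ratr_int ratr_nat -xE mulrC mulKf //.
by rewrite pnatr_eq0 -lt0n.
Qed.

Lemma is_derive_periodic f x (m : int) (df : R) : (forall x, f (x + 1) = f x) ->
  is_derive x 1 f df -> is_derive (x + m%:~R) 1 f df.
Proof.
move=> fp fx.
have fE : f = f \o (fun y => y - m%:~R).
  by apply/funext => y /=; rewrite -mulrNz periodic_int.
rewrite fE -[df]mulr1; apply: is_derive1_comp; first by rewrite addrK.
by rewrite -[X in is_derive _ _ _ X]subr0; apply: is_deriveB.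
Qed.

Lemma common_denominator (s : seq rat) : exists D : nat, (0 < D)%N /\
  forall r, r \in s -> exists z : int, D%:R * ratr r = z%:~R :> R.
Proof.
elim: s => [|r s [D [D0 HD]]]; first by exists 1%N.
have rE : (`|denq r|)%N%:R * ratr r = (numq r)%:~R :> R.
  rewrite pmulrn absz_denq -[in ratr r](divq_num_den r) fmorph_div /= !ratr_int.
  by rewrite mulrC divfK // intr_eq0 denq_neq0.
exists (`|denq r| * D)%N; split; first by rewrite muln_gt0 D0 absz_gt0 denq_neq0.
move=> r'; rewrite inE => /orP[/eqP ->|/HD[z zE]].
  by exists (D%:Z * numq r); rewrite natrM mulrAC rE intrM mulrC.
by exists (`|denq r|%N%:Z * z); rewrite natrM -mulrA zE intrM.
Qed.

(** [D] is a common denominator of the breakpoints and also of [q], because the base point must be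
    fixed modulo 1 by every multiplier congruent to 1 modulo [D]. *)
Lemma pw_smooth_cellwise f (q : rat) : pw_smooth_rat_disc f ->
  exists (D : nat) g B, [/\ (0 < D)%N, 0 <= B, cellwise_smooth D f g B,
    exists z : int, D%:R * ratr q = z%:~R :> R &
    exists k L, [/\ (k < D)%N, L != 0 &
     (fun d : R => f (k%:R / D%:R - d) - f (k%:R / D%:R + d)) @ 0^'+ --> L]].
Proof.
move=> [fp [xs [/and3P[_ _ xs01] fd [g [gBV gE]] [r rxs [L [L0 fL]]]]]].
have [B [B0 gB]] := BV_01_bounded g gBV.
have [D [D0 HD]] := common_denominator (q :: xs).
have D0' : D%:R != 0 :> R by rewrite pnatr_eq0 -lt0n.
exists D, g, B; split=> //.
- split=> // x xg; have yg := grid_fracpart _ _ xg; set y := fracpart x in yg *.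
  have y01 : in01 y by exact: fracpart_itv.
  have yoff : off_disc xs y.
    move=> s sxs; apply/eqP => ys.
    have [|z zE] := HD s; first by rewrite inE sxs orbT.
    by have := yg z; rewrite ys zE eqxx.
  have -> : x = y + (Num.floor x)%:~R by rewrite /y /fracpart subrK.
  apply: is_derive_periodic => //; rewrite gE // derive1E.
  by apply: derivableP; exact: fd.
- by apply: HD; rewrite inE eqxx.
have [|z zE] := HD r; first by rewrite inE rxs orbT.
have /andP[r0 r1] := allP xs01 r rxs.
have rR0 : 0 <= ratr r :> R by rewrite ler0q.
have rR1 : ratr r < 1 :> R by rewrite -(rmorph1 (@ratr R)) ltr_rat.
have z0 : 0 <= z by rewrite -(ler_int R) -zE mulr_ge0.
have zD : (`|z| < D)%N.
  rewrite -ltz_nat gez0_abs // -(ltr_int R) -zE -pmulrn.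
  by rewrite gtr_pMr // ltr0n.
exists `|z|%N, L; split=> //.
suff -> : `|z|%N%:R / D%:R = ratr r :> R by [].
by rewrite pmulrn gez0_abs // -zE mulrC mulKf.
Qed.

End CellwiseSmooth.

Section OneSidedLimits.
Context {R : realType}.

(* [f x + B (x - a)] is nondecreasing, so its infimum is the right limit at [a]. *)
Lemma lipschitz_right_limit (f : R -> R) (a b B : R) : a < b -> 0 <= B ->
  (forall y z, a < y -> y <= z -> z < b -> `|f z - f y| <= B * (z - y)) ->
  exists l, forall x, a < x < b -> `|f x - l| <= B * (x - a).
Proof.
move=> ab B0 Hf.
pose S := [set f x + B * (x - a) | x in [set x | a < x < b]].
have lb x : a < x < b -> lbound S (f x - B * (x - a)).
  move=> /andP[ax xb] _ [y /= /andP[ay yb] <-].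
  have [xy|yx] := leP x y.
    have := Hf x y ax xy yb; rewrite ler_norml.
    have : B * (x - a) <= B * (y - a) by rewrite ler_wpM2l //; lra.
    have -> : B * (y - x) = B * (y - a) - B * (x - a) by ring.
    have : 0 <= B * (x - a) by rewrite mulr_ge0 //; lra.
    set u := B * (x - a); set v := B * (y - a); lra.
  have := Hf y x ay (ltW yx) xb; rewrite ler_norml.
  have -> : B * (x - y) = B * (x - a) - B * (y - a) by ring.
  have : 0 <= B * (y - a) by rewrite mulr_ge0 //; lra.
  set u := B * (x - a); set v := B * (y - a); lra.
have mid : a < (a + b) / 2 < b by lra.
have S0 : S !=set0 by exists (f ((a + b) / 2) + B * ((a + b) / 2 - a)); exists ((a + b) / 2).
exists (inf S) => x xab.
have h1 : inf S <= f x + B * (x - a).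
  by apply: ge_inf; [exists (f x - B * (x - a)); exact: lb|exists x].
have h2 : f x - B * (x - a) <= inf S by apply: lb_le_inf => //; exact: lb.
rewrite ler_norml; move: h1 h2; set u := B * (x - a); lra.
Qed.

Lemma lipschitz_left_limit (f : R -> R) (a b B : R) : a < b -> 0 <= B ->
  (forall y z, a < y -> y <= z -> z < b -> `|f z - f y| <= B * (z - y)) ->
  exists l, forall x, a < x < b -> `|f x - l| <= B * (b - x).
Proof.
move=> ab B0 Hf.
have [||l Hl] := lipschitz_right_limit (fun x => f (- x)) (- b) (- a) B _ B0.
- by rewrite ltrN2.
- move=> y z y0 yz z0.
  by rewrite distrC (le_trans (Hf (- z) (- y) _ _ _)) //; lra.
exists l => x xab; have := Hl (- x); rewrite opprK opprK [- x + b]addrC; apply.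
lra.
Qed.

End OneSidedLimits.

Lemma cell_itv {R : realType} (D : nat) (k : int) (x : R) : (0 < D)%N ->
  k%:~R / D%:R < x < (k + 1)%:~R / D%:R ->
  Num.floor (D%:R * x) = k /\ off_grid D x.
Proof.
move=> D0; have D0' : 0 < D%:R :> R by rewrite ltr0n.
rewrite ltr_pdivrMr // ltr_pdivlMr // ![x * _]mulrC => /andP[h1 h2].
split; first by apply: floor_def; rewrite h2 ltW.
move=> m; apply/eqP => xm; move: h1 h2; rewrite xm !ltr_int; lia.
Qed.

Section CellwiseStructure.
Context {R : realType}.
Local Notation fl x := ((Num.floor x)%:~R : R).
Variables (D : nat) (f g : R -> R) (B : R).
Hypotheses (D0 : (0 < D)%N) (B0 : 0 <= B) (Hf : cellwise_smooth D f g B).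

Let D0' : 0 < D%:R :> R. Proof. by rewrite ltr0n. Qed.

Lemma cell_off_grid (y z x : R) : off_grid D y ->
  Num.floor (D%:R * y) = Num.floor (D%:R * z) -> y <= x -> x <= z -> off_grid D x.
Proof.
move=> yg E yx xz m; apply/eqP => xm.
have /andP[f1 _] := floor_itv (D%:R * y); have /andP[_ f2] := floor_itv (D%:R * z).
have f1' : fl (D%:R * y) < D%:R * y by rewrite lt_neqAle f1 andbT eq_sym yg.
have h1 : D%:R * y <= m%:~R by rewrite -xm ler_pM2l.
have h2 : m%:~R <= D%:R * z by rewrite -xm ler_pM2l.
have := lt_le_trans f1' h1; have := le_lt_trans h2 f2.
by rewrite !ltr_int -E ltzD1 leNgt => /negbTE ->.
Qed.

Lemma cell_mvt y z : off_grid D y -> Num.floor (D%:R * y) = Num.floor (D%:R * z) ->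
  y <= z -> exists c, [/\ y <= c, c <= z & f z - f y = g (fracpart c) * (z - y)].
Proof.
move=> yg E yz; case: Hf => _ fd _ _.
have dx x : x \in `[y, z]%R -> is_derive x 1 f (g (fracpart x)).
  by rewrite in_itv => /andP[yx xz]; apply: fd; exact: cell_off_grid E yx xz.
have dxo x : x \in `]y, z[%R -> is_derive x 1 f (g (fracpart x)).
  by move=> xyz; apply: dx; apply: subset_itv_oo_cc xyz.
have cf : {within `[y, z], continuous f}.
  by apply: derivable_within_continuous => x xyz; have [] := dx x xyz.
have [c] := @MVT_segment R f (fun x => g (fracpart x)) y z yz dxo cf.
by rewrite in_itv => /andP[yc cz] H; exists c.
Qed.

Lemma cell_lip y z : off_grid D y -> Num.floor (D%:R * y) = Num.floor (D%:R * z) ->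
  y <= z -> `|f z - f y| <= B * (z - y).
Proof.
move=> yg E yz; have [c [_ _ ->]] := cell_mvt _ _ yg E yz.
rewrite normrM [`|z - y|]ger0_norm ?subr_ge0 // ler_wpM2r ?subr_ge0 //.
by case: Hf => _ _ + _; apply; exact: fracpart_itv.
Qed.

Lemma jumps_exist : exists Lm Rm : nat -> R, forall k : nat,
  (forall x, k%:R / D%:R < x < k.+1%:R / D%:R ->
     `|f x - Rm k| <= B * (x - k%:R / D%:R)) /\
  (forall x, (k%:R - 1) / D%:R < x < k%:R / D%:R ->
     `|f x - Lm k| <= B * (k%:R / D%:R - x)).
Proof.
have kk (k : int) : k%:~R / D%:R < (k + 1)%:~R / D%:R :> R.
  by rewrite ltr_pM2r ?invr_gt0 // ltr_int ltzD1.
have lip (k : int) y z : k%:~R / D%:R < y -> y <= z -> z < (k + 1)%:~R / D%:R ->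
    `|f z - f y| <= B * (z - y).
  move=> ky yz zk.
  have [y1 y2] := cell_itv D k y D0 (introT andP (conj ky (le_lt_trans yz zk))).
  have [z1 _] := cell_itv D k z D0 (introT andP (conj (lt_le_trans ky yz) zk)).
  by apply: cell_lip => //; rewrite y1 z1.
have HR (k : nat) := lipschitz_right_limit f _ _ B (kk k) B0 (lip k).
have HL (k : nat) := lipschitz_left_limit f _ _ B (kk (k%:Z - 1)) B0 (lip _).
exists (fun k => sval (cid (HL k))), (fun k => sval (cid (HR k))) => k; split.
- case: cid => l /= Hl x; rewrite -natr1 => xk; apply: Hl.
  by rewrite intrD -pmulrn.
- case: cid => l /= Hl x xk; have := Hl x; rewrite intrB !intrD subrK -!pmulrn.
  by apply.
Qed.

End CellwiseStructure.

Section GridFloors.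
Context {R : realType}.
Local Notation fl x := ((Num.floor x)%:~R : R).
Variables (D : nat).
Hypothesis D0 : (0 < D)%N.
Let D0' : 0 < D%:R :> R. Proof. by rewrite ltr0n. Qed.

(** [n <= x - k / D] means [D n + k <= D x], so this floor depends on [x] only through its cell. *)
Lemma floor_grid_le (y z : R) (k : nat) : Num.floor (D%:R * y) <= Num.floor (D%:R * z) ->
  Num.floor (y - k%:R / D%:R) <= Num.floor (z - k%:R / D%:R).
Proof.
move=> yz; rewrite floor_ge_int; set n := Num.floor (y - _).
have key (x : R) : (n%:~R <= x - k%:R / D%:R) = ((D%:Z * n + k%:Z)%:~R <= D%:R * x).
  rewrite -(ler_pM2l D0') mulrBr mulrCA divff ?gt_eqF // mulr1 lerBrDr.
  by rewrite intrD intrM -!pmulrn.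
have : n%:~R <= y - k%:R / D%:R by exact: floor_le.
by rewrite !key -!floor_ge_int => /le_trans; apply.
Qed.

Lemma floor_grid_eq (y z : R) (k : nat) : Num.floor (D%:R * y) = Num.floor (D%:R * z) ->
  Num.floor (y - k%:R / D%:R) = Num.floor (z - k%:R / D%:R).
Proof. by move=> E; apply/le_anti; rewrite !floor_grid_le ?E. Qed.

(** The range of [kap] is one period of cells together with the cell left of 0, which occurs when
    the crossed grid point is 0. *)
Lemma floor_grid (x : R) (kap : int) (k : nat) : Num.floor (D%:R * x) = kap ->
  -1 <= kap -> kap < D%:Z -> (k < D)%N ->
  Num.floor (x - k%:R / D%:R) = - ((kap < k%:Z)%R : nat)%:Z.
Proof.
move=> E k1 kD kk; have := floor_itv (D%:R * x); rewrite E => /andP[h1 h2].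
have xk : D%:R * (x - k%:R / D%:R) = D%:R * x - k%:R.
  by rewrite mulrBr mulrCA divff ?gt_eqF // mulr1.
case: ltP => lt; apply: floor_def; apply/andP; split.
- rewrite -(ler_pM2l D0') xk mulrN mulr1 lerBrDr (le_trans _ h1) //.
  rewrite !pmulrn -intrN -intrD ler_int; lia.
- rewrite addNr -(ltr_pM2l D0') xk mulr0 subr_lt0 (lt_le_trans h2) //.
  rewrite pmulrn ler_int; lia.
- rewrite oppr0 -(ler_pM2l D0') xk mulr0 subr_ge0 (le_trans _ h1) //.
  by rewrite pmulrn ler_int.
- rewrite oppr0 add0r -(ltr_pM2l D0') xk mulr1 ltrBlDr (lt_le_trans h2) //.
  rewrite !pmulrn -intrD ler_int; lia.
Qed.

End GridFloors.

(** * Splitting off the jumps *)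

Section Decomposition.
Context {R : realType}.
Local Notation fl x := ((Num.floor x)%:~R : R).
Variables (D : nat) (f g : R -> R) (B : R).
Hypotheses (D0 : (0 < D)%N) (B0 : 0 <= B) (Hf : cellwise_smooth D f g B).
Let D0' : 0 < D%:R :> R. Proof. by rewrite ltr0n. Qed.

Definition saw_comb (J : nat -> R) (x : R) : R :=
  \sum_(k < D) J k * saw (x - k%:R / D%:R).

Lemma saw_combDi J x (m : int) : saw_comb J (x + m%:~R) = saw_comb J x.
Proof. by apply: eq_bigr => k _; rewrite addrAC sawDi. Qed.

Lemma saw_comb_cell J y z : Num.floor (D%:R * y) = Num.floor (D%:R * z) ->
  saw_comb J z - saw_comb J y = (\sum_(k < D) J k) * (z - y).
Proof.
move=> E; rewrite -sumrB mulr_suml; apply: eq_bigr => k _.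
rewrite -mulrBr /saw /fracpart (floor_grid_eq D D0 _ _ k E); congr (_ * _); ring.
Qed.

Lemma saw_comb_cross J y z (j : nat) : (j < D)%N ->
  Num.floor (D%:R * z) = j -> Num.floor (D%:R * y) = j%:Z - 1 ->
  saw_comb J z - saw_comb J y = (\sum_(k < D) J k) * (z - y) - J j.
Proof.
move=> jD zj yj; rewrite -sumrB mulr_suml.
rewrite (eq_bigr (fun k : 'I_D => J k * (z - y) -
  (if k == Ordinal jD then J j else 0))); last first.
  move=> k _; rewrite -mulrBr /saw /fracpart.
  rewrite (floor_grid D D0 _ _ k zj) // ?(floor_grid D D0 _ _ k yj) //; try lia.
  have -> : (k == Ordinal jD) = (k == j :> nat) by [].
  have [->|kj] := eqVneq (k : nat) j.
    by rewrite ltxx (_ : j%:Z - 1 < j) ?intrN /=; [ring|lia].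
  have -> : (j%:Z - 1 < k) = (j%:Z < k) by lia.
  by ring.
by rewrite sumrB -big_mkcond big_pred1_eq.
Qed.

(** [saw] drops by 1 at integers, so taking left limit minus right limit as coefficient cancels the
    jumps. [F] is then Lipschitz inside a cell by the mean value theorem, across one grid point by
    the one-sided limits, and beyond by chaining. The shift [c0] is minus the sum of the [J k]. *)
Lemma cellwise_decomposition : exists (J : nat -> R) (B' : R),
  let F x := f x - saw_comb J x in
  [/\ 0 <= B', forall x (m : int), F (x + m%:~R) = F x,
      forall y z, irr y -> irr z -> `|F y - F z| <= B' * `|y - z|,
      exists c0, forall y z, off_grid D y ->
        Num.floor (D%:R * y) = Num.floor (D%:R * z) -> y <= z ->
        exists c, [/\ y <= c, c <= z & F z - F y = (g (fracpart c) + c0) * (z - y)] &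
      forall k, (k < D)%N -> forall d, 0 < d -> d < D%:R^-1 ->
        `|f (k%:R / D%:R - d) - f (k%:R / D%:R + d) - J k| <= 2 * B * d].
Proof.
have [Lm [Rm LR]] := jumps_exist D f g B D0 B0 Hf.
pose J k := Lm k - Rm k; exists J.
pose SJ := \sum_(k < D) `|J k|; exists (B + SJ).
have SJ0 : 0 <= SJ by apply: sumr_ge0.
have SJle : `|\sum_(k < D) J k| <= SJ by exact: ler_norm_sum.
move=> F.
have fint : forall x (m : int), f (x + m%:~R) = f x.
  by apply: periodic_int; case: Hf.
have Fint x (m : int) : F (x + m%:~R) = F x by rewrite /F fint saw_combDi.
have DV : D%:R^-1 > 0 :> R by rewrite invr_gt0.
have cell y z : irr y -> Num.floor (D%:R * y) = Num.floor (D%:R * z) -> y <= z ->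
    `|F z - F y| <= (B + SJ) * (z - y).
  move=> yI E yz.
  have -> : F z - F y = (f z - f y) - (saw_comb J z - saw_comb J y) by rewrite /F; ring.
  rewrite saw_comb_cell // (le_trans (ler_normB _ _)) // mulrDl lerD //.
    apply: (cell_lip D f g B D0 Hf) => //; exact: irr_off_grid.
  by rewrite normrM [`|z - y|]ger0_norm ?subr_ge0 // ler_wpM2r ?subr_ge0.
have adj0 y z (j : nat) : irr y -> irr z -> (j < D)%N ->
    Num.floor (D%:R * z) = j -> Num.floor (D%:R * y) = j%:Z - 1 ->
    `|F z - F y| <= (B + SJ) * (z - y).
  move=> yI zI jD zj yj.
  have := floor_itv (D%:R * z); rewrite zj => /andP[z1 z2].
  have := floor_itv (D%:R * y); rewrite yj => /andP[y1 y2].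
  have [HR HL] := LR j.
  have zlt : j%:R / D%:R < z.
    rewrite ltr_pdivrMr // mulrC lt_neqAle z1 andbT eq_sym.
    by have := irr_off_grid D z D0 zI j%:Z.
  have ylt : y < j%:R / D%:R.
    by rewrite ltr_pdivlMr // mulrC (lt_le_trans y2) // subrK.
  have {}HR : `|f z - Rm j| <= B * (z - j%:R / D%:R).
    apply: HR; rewrite zlt ltr_pdivlMr // mulrC (lt_le_trans z2) //.
    by rewrite intrD -natr1.
  have {}HL : `|f y - Lm j| <= B * (j%:R / D%:R - y).
    apply: HL; rewrite ylt andbT ltr_pdivrMr // mulrC lt_neqAle.
    move: y1; rewrite intrB -pmulrn => ->; rewrite andbT eq_sym.
    by have := irr_off_grid D y D0 yI (j%:Z - 1); rewrite intrB -pmulrn.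
  have -> : F z - F y = ((f z - Rm j) - (f y - Lm j)) - (\sum_(k < D) J k) * (z - y).
    have Jj : J j = Lm j - Rm j by [].
    have := saw_comb_cross J _ _ _ jD zj yj; rewrite /F; move: Jj.
    by set u := J j; set S := (\sum_(_ < _) _) * _; lra.
  rewrite (le_trans (ler_normB _ _)) // mulrDl lerD //; last first.
    rewrite normrM [`|z - y|]ger0_norm ?ler_wpM2r ?subr_ge0 //; lra.
  rewrite (le_trans (ler_normB _ _)) // (le_trans (lerD HR HL)) //.
  by rewrite -mulrDr; set u := j%:R / D%:R; rewrite (_ : z - u + (u - y) = z - y) //; ring.
have flD (x : R) (m : int) : Num.floor (D%:R * (x - m%:~R)) = Num.floor (D%:R * x) - D%:Z * m.
  have -> : D%:R * (x - m%:~R) = D%:R * x + (- (D%:Z * m))%:~R.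
    by rewrite intrN intrM -pmulrn mulrBr.
  by rewrite floorDrz ?intr_int // intrKfloor.
have adj y z : irr y -> irr z -> Num.floor (D%:R * z) = Num.floor (D%:R * y) + 1 ->
    `|F z - F y| <= (B + SJ) * (z - y).
  move=> yI zI E.
  pose m := Num.floor z.
  have [z0 z1] : 0 <= z - m%:~R /\ z - m%:~R < 1.
    by have := floor_itv z; rewrite -/m intrD; lra.
  have k0 : 0 <= Num.floor (D%:R * (z - m%:~R)).
    by rewrite floor_ge0 mulr_ge0 // ltW.
  have kD : Num.floor (D%:R * (z - m%:~R)) < D%:Z.
    by rewrite floor_lt_int -pmulrn gtr_pMr.
  have := adj0 (y - m%:~R) (z - m%:~R) `|Num.floor (D%:R * (z - m%:~R))|%N.
  have Fm x : F (x - m%:~R) = F x by rewrite -intrN Fint.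
  have Im x : irr x -> irr (x - m%:~R) by rewrite -intrN; exact: irrDi.
  rewrite !Fm (_ : z - m%:~R - (y - m%:~R) = z - y); last by ring.
  apply; [exact: Im|exact: Im| | |].
  - by rewrite -ltz_nat gez0_abs.
  - by rewrite gez0_abs.
  - by rewrite gez0_abs // !flD E; ring.
have far (n : nat) : forall y z, irr y -> irr z ->
    Num.floor (D%:R * z) = Num.floor (D%:R * y) + n%:Z -> y <= z ->
    `|F z - F y| <= (B + SJ) * (z - y).
  elim: n => [|n IH] y z yI zI E yz; first by apply: cell; rewrite ?E ?addr0.
  case: n IH E => [|n] IH E; first exact: adj.
  (* A step of exactly one cell stays irrational, so the chain never meets a breakpoint. *)
  pose y' := y + D%:R^-1.
  have y'I : irr y'.
    have := irrDr y (D%:R^-1) yI; rewrite fmorphV /= ratr_nat; exact.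
  have y'E : Num.floor (D%:R * y') = Num.floor (D%:R * y) + 1.
    rewrite /y' mulrDr divff ?gt_eqF //.
    by rewrite -[X in _ + X]/(1%:~R) floorDrz ?intr_int // intrKfloor.
  have y'z : y' <= z.
    rewrite -(ler_pM2l D0') ltW //.
    have /andP[_ h1] := floor_itv (D%:R * y'); have /andP[h2 _] := floor_itv (D%:R * z).
    apply: lt_le_trans h1 (le_trans _ h2); rewrite ler_int y'E E; lia.
  have h1 := adj _ _ yI y'I y'E.
  have E' : Num.floor (D%:R * z) = Num.floor (D%:R * y') + n.+1%:Z.
    by rewrite E y'E -addrA.
  have h2 := IH y' z y'I zI E' y'z.
  have -> : F z - F y = (F z - F y') + (F y' - F y) by ring.
  rewrite (le_trans (ler_normD _ _)) // (le_trans (lerD h2 h1)) // -mulrDr.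
  by rewrite (_ : z - y' + (y' - y) = z - y) //; ring.
split=> //.
- exact: addr_ge0.
- move=> y z yI zI; wlog yz : y z yI zI / y <= z.
    move=> H; case: (leP y z) => [/H|/ltW /H]; first exact.
    by rewrite distrC [`|z - y|]distrC; apply.
  rewrite distrC [`|y - z|]distrC [`|z - y|]ger0_norm ?subr_ge0 //.
  apply: (far `|Num.floor (D%:R * z) - Num.floor (D%:R * y)|%N) => //.
  rewrite gez0_abs; first by rewrite addrCA subrr addr0.
  by rewrite subr_ge0 le_floor // ler_pM2l.
- exists (- \sum_(k < D) J k) => y z yg E yz.
  have [c [yc cz fE]] := cell_mvt D f g B D0 Hf y z yg E yz.
  exists c; split=> //.
  have -> : F z - F y = (f z - f y) - (saw_comb J z - saw_comb J y) by rewrite /F; ring.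
  by rewrite fE saw_comb_cell //; ring.
- move=> k kD d d0 dD; have [HR HL] := LR k.
  have {}HR : `|f (k%:R / D%:R + d) - Rm k| <= B * d.
    have := HR (k%:R / D%:R + d); rewrite addrAC subrr add0r; apply.
    by rewrite ltrDl d0 -natr1 mulrDl div1r ltrD2l.
  have {}HL : `|f (k%:R / D%:R - d) - Lm k| <= B * d.
    have := HL (k%:R / D%:R - d); rewrite subKr; apply.
    by rewrite gtrDl oppr_lt0 d0 andbT mulrBl div1r ltrD2l ltrN2.
  rewrite /J; set u := f _ in HL *; set v := f _ in HR *.
  have -> : u - v - (Lm k - Rm k) = (u - Lm k) - (v - Rm k) by ring.
  rewrite (le_trans (ler_normB _ _)) // (le_trans (lerD HL HR)) //; lra.
Qed.

End Decomposition.

(** * Riemann sums of the Lipschitz part with equidistant nodes *)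

Section Quadrature.
Context {R : realType}.
Implicit Types (F g : R -> R) (y z s : R) (n : nat).
Local Notation fl x := ((Num.floor x)%:~R : R).

Definition riemann F n y : R := \sum_(r < n) F (y + r%:R / n%:R).

Lemma riemann_shift F n y (m : int) : (forall x (k : int), F (x + k%:~R) = F x) ->
  (0 < n)%N -> riemann F n (y + m%:~R / n%:R) = riemann F n y.
Proof.
move=> Fp n0; have n0' : 0 < n%:R :> R by rewrite ltr0n.
have Gnat x (k : nat) : riemann F n (x + k%:R / n%:R) = riemann F n x.
  elim: k => [|k IH]; first by rewrite mul0r addr0.
  rewrite -IH -[k.+1%:R]natr1 mulrDl addrA; move: (x + _) => {IH}w.
  case: n n0 n0' => // n _ n0'; rewrite /riemann.
  rewrite big_ord_recr [in RHS]big_ord_recl /= mul0r addr0.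
  have -> : w + 1 / n.+1%:R + n%:R / n.+1%:R = w + 1%:~R.
    by rewrite -addrA -mulrDl addrC [1 + _]addrC natr1 divff ?gt_eqF // addrC.
  rewrite Fp addrC; congr (_ + _); apply: eq_bigr => i _.
  by rewrite /bump /= add1n -addrA -mulrDl [1 + _]addrC natr1.
case: m => m; first exact: Gnat.
by rewrite NegzE mulrNz -pmulrn mulNr -[LHS](Gnat _ m.+1) subrK.
Qed.

(** The points [u r <= v r] are interleaved into one monotone sequence, padded by its last value,
    and the increments from [v r] to [u r.+1] are dropped. *)
Lemma BV_pairs g (M : R) n (u v : nat -> R) :
  (forall (t : nat -> R) (n : nat), (forall i, (i <= n)%N -> 0 <= t i < 1) ->
    (forall i, (i < n)%N -> t i <= t i.+1) ->
    \sum_(i < n) `|g (t i.+1) - g (t i)| <= M) ->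
  (forall r, (r < n)%N -> [/\ 0 <= u r, u r <= v r & v r < 1]) ->
  (forall r, (r.+1 < n)%N -> v r <= u r.+1) ->
  \sum_(r < n) `|g (v r) - g (u r)| <= M.
Proof.
move=> HM uv vu; case: n uv vu => [|n] uv vu.
  by have := HM (fun=> 0) 0%N; rewrite !big_ord0; apply => // i _; rewrite lexx ltr01.
pose t i := if (i < n.+1 * 2)%N then (if odd i then v i./2 else u i./2) else v n.
have t0 (r : nat) : (r < n.+1)%N -> t (r * 2)%N = u r.
  by move=> rn; rewrite /t ltn_pmul2r // rn muln2 odd_double doubleK.
have t1 (r : nat) : (r < n.+1)%N -> t (r * 2).+1 = v r.
  by move=> rn; rewrite /t muln2 (_ : (_ < _)%N) ?oddS ?odd_double /= ?uphalf_double //;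
    rewrite muln2 -doubleS; lia.
have t2 (r : nat) : (r < n.+1)%N -> t (r * 2).+2 = if (r < n)%N then u r.+1 else v n.
  move=> rn; case: ifP => rn'; first by rewrite -(t0 r.+1).
  by rewrite /t ifF //; apply/negbTE; rewrite -leqNgt; lia.
have := HM t (n.+1 * 2)%N.
rewrite -(big_mkord xpredT (fun i => `|g (t i.+1) - g (t i)|)) sum_blocks big_mkord.
move=> H; apply: le_trans (H _ _) => {H}.
- apply: ler_sum => r _; rewrite big_ord_recl big_ord1 /= addn0 addn1.
  by rewrite t0 // t1 // lerDl.
- move=> i iN; rewrite /t; case: ifP => iN'; last by have [] := uv n (leqnn _); lra.
  have ilt : (i./2 < n.+1)%N by lia.
  by have [] := uv _ ilt; case: ifP => _; lra.
- move=> i iN.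
  have ilt : (i./2 < n.+1)%N by lia.
  have [ui uvi vi] := uv _ ilt.
  rewrite -(odd_double_half i) -muln2; case: (odd i); rewrite /= ?add0n ?add1n.
    rewrite t1 // t2 //; case: ifP => h; first exact: vu.
    by have -> : i./2 = n by lia.
  by rewrite t0 // t1.
Qed.

Section Core.
Variables (D : nat) (F g : R -> R) (M B c0 : R).
Hypotheses (D0 : (0 < D)%N) (B0 : 0 <= B).
Hypothesis HM : forall (t : nat -> R) (n : nat),
  (forall i, (i <= n)%N -> 0 <= t i < 1) ->
  (forall i, (i < n)%N -> t i <= t i.+1) ->
  \sum_(i < n) `|g (t i.+1) - g (t i)| <= M.
Hypothesis Fint : forall x (m : int), F (x + m%:~R) = F x.
Hypothesis Flip : forall y z, irr y -> irr z -> `|F y - F z| <= B * `|y - z|.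
Hypothesis Fmvt : forall y z, off_grid D y ->
  Num.floor (D%:R * y) = Num.floor (D%:R * z) -> y <= z ->
  exists c, [/\ y <= c, c <= z & F z - F y = (g (fracpart c) + c0) * (z - y)].

Let D0' : 0 < D%:R :> R. Proof. by rewrite ltr0n. Qed.

(** If no grid point is crossed, both increments come from the mean value theorem, at points [c] and
    [d] that give [u] and [v] in increasing order. Otherwise the Lipschitz bound is charged to the
    floor difference, then at least 1; these charges total [D] over a period. *)
Lemma quad_cell n y s : (0 < n)%N -> irr y -> irr (y + s) -> 0 <= y -> y < 1 ->
  0 <= s -> s <= n%:R^-1 ->
  exists uv : R * R, [/\ y <= uv.1, uv.1 <= uv.2, uv.2 <= y + n%:R^-1, uv.2 < 1 &
    `|n%:R * s * (F (y + n%:R^-1) - F y) - (F (y + s) - F y)| <=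
    s * (`|g uv.2 - g uv.1| +
         2 * B * (fl (D%:R * (y + n%:R^-1)) - fl (D%:R * y)))].
Proof.
move=> n0 yI ysI y0 y1 s0 sn; have n0' : 0 < n%:R :> R by rewrite ltr0n.
have V0 : 0 < n%:R^-1 :> R by rewrite invr_gt0.
have [E|E] := eqVneq (Num.floor (D%:R * y)) (Num.floor (D%:R * (y + n%:R^-1))).
  have yg := irr_off_grid D y D0 yI.
  have [c [yc cz cE]] := Fmvt _ _ yg E (ltac:(lra) : y <= y + n%:R^-1).
  have E' : Num.floor (D%:R * y) = Num.floor (D%:R * (y + s)).
    apply/le_anti; rewrite le_floor ?ler_pM2l ?lerDl //= E.
    by rewrite le_floor // ler_pM2l // lerD2l.
  have [d [yd dz dE]] := Fmvt _ _ yg E' (ltac:(lra) : y <= y + s).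
  have z1 : y + n%:R^-1 < 1.
    rewrite -(ltr_pM2l D0') mulr1; have := floorD1_gt (D%:R * (y + n%:R^-1)).
    rewrite -E => /lt_le_trans; apply; rewrite -[leRHS]/(D%:Z%:~R) ler_int lezD1.
    by rewrite floor_lt_int -pmulrn gtr_pMr.
  have fc : fracpart c = c by apply: fracpart_id; lra.
  have fd : fracpart d = d by apply: fracpart_id; lra.
  exists (Num.min c d, Num.max c d) => /=.
  have dn : d <= y + n%:R^-1 by lra.
  split; rewrite ?le_min ?ge_max ?yc ?yd ?cz ?dn //.
  - by rewrite ge_min le_max lexx.
  - by rewrite gt_max; apply/andP; split; lra.
  rewrite E subrr mulr0 addr0 cE dE fc fd.
  have -> : n%:R * s * ((g c + c0) * (y + n%:R^-1 - y)) - (g d + c0) * (y + s - y)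
     = s * (g c - g d) by field; lra.
  rewrite normrM ger0_norm // ler_wpM2l //.
  by case: (leP c d) => _; rewrite // distrC.
exists (y, y); split=> //=; first by rewrite lerDl ltW.
rewrite subrr normr0 add0r (le_trans (ler_normB _ _)) //.
have yn : irr (y + n%:R^-1).
  by have := irrDr y (n%:R^-1) yI; rewrite fmorphV /= ratr_nat; exact.
have h1 : `|n%:R * s * (F (y + n%:R^-1) - F y)| <= s * B.
  rewrite normrM ger0_norm ?mulr_ge0 // (le_trans (ler_wpM2l _ (Flip _ _ yn yI))) //.
    by rewrite mulr_ge0.
  rewrite addrAC subrr add0r (ger0_norm (ltW V0)).
  by rewrite (_ : n%:R * s * (B / n%:R) = s * B) ?lexx //; field; lra.
have h2 : `|F (y + s) - F y| <= s * B.
  rewrite (le_trans (Flip _ _ ysI yI)) // addrAC subrr add0r ger0_norm // mulrC //.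
rewrite (le_trans (lerD h1 h2)) // -mulrDr ler_wpM2l //.
have : 1 <= fl (D%:R * (y + n%:R^-1)) - fl (D%:R * y).
  have : Num.floor (D%:R * y) < Num.floor (D%:R * (y + n%:R^-1)).
    by rewrite lt_neqAle E le_floor // ler_pM2l // lerDl ltW.
  by rewrite -lezD1 -(ler_int R) intrD; lra.
set a := fl _; set b := fl _ => ab.
have : 2 * B <= 2 * B * (a - b) by rewrite ler_peMr // mulr_ge0.
lra.
Qed.

(* The increments over full cells telescope to [0] by periodicity, and on each cell the
   increments over [s] and over [1/n] differ by [s] times the oscillation of [F']. *)
Lemma quad_core n y s : (0 < n)%N -> irr y -> irr (y + s) -> 0 < y -> y < n%:R^-1 ->
  0 <= s -> s <= n%:R^-1 ->
  `|riemann F n (y + s) - riemann F n y| <= (M + 2 * B * D%:R) / n%:R.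
Proof.
move=> n0 yI ysI y0 yn s0 sn; have n0' : 0 < n%:R :> R by rewrite ltr0n.
have V0 : 0 < n%:R^-1 :> R by rewrite invr_gt0.
pose Y (r : nat) := y + r%:R / n%:R.
have YI r : irr (Y r).
  have := irrDr y (r%:R / n%:R) yI; rewrite fmorph_div /= !ratr_nat; exact.
have YsI r : irr (Y r + s).
  have := irrDr (y + s) (r%:R / n%:R) ysI; rewrite fmorph_div /= !ratr_nat.
  by rewrite /Y addrAC.
have YS r : Y r.+1 = Y r + n%:R^-1 by rewrite /Y -natr1 mulrDl div1r addrA.
have Y0 r : 0 <= Y r by rewrite addr_ge0 ?divr_ge0 // ltW.
have Y1 r : (r < n)%N -> Y r < 1.
  move=> rn; have : r.+1%:R / n%:R <= 1 :> R by rewrite ler_pdivrMr // mul1r ler_nat.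
  by rewrite -natr1 mulrDl div1r /Y; lra.
have cells r : exists uv : R * R, (r < n)%N ->
  [/\ Y r <= uv.1, uv.1 <= uv.2, uv.2 <= Y r.+1, uv.2 < 1 &
    `|n%:R * s * (F (Y r.+1) - F (Y r)) - (F (Y r + s) - F (Y r))| <=
    s * (`|g uv.2 - g uv.1| + 2 * B * (fl (D%:R * Y r.+1) - fl (D%:R * Y r)))].
  have [rn|rn] := ltnP r n; last by exists (0, 0).
  have [uv Huv] := quad_cell n _ s n0 (YI r) (YsI r) (Y0 r) (Y1 _ rn) s0 sn.
  by exists uv => _; rewrite YS.
have {cells}[uv Huv] := choice cells.
have bv : \sum_(r < n) `|g (uv r).2 - g (uv r).1| <= M.
  apply: (BV_pairs g M n (fun r => (uv r).1) (fun r => (uv r).2) HM).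
    by move=> r /Huv[h1 h2 h3 h4 _]; split=> //; exact: le_trans (Y0 r) h1.
  move=> r rn; have [_ _ h _ _] := Huv r (ltnW rn); have [h' _ _ _ _] := Huv _ rn.
  exact: le_trans h h'.
have Yn : Y n = y + 1%:~R by rewrite /Y divff ?gt_eqF.
have Y00 : Y 0%N = y by rewrite /Y mul0r addr0.
have tel : \sum_(r < n) (F (Y r.+1) - F (Y r)) = 0.
  rewrite -(big_mkord xpredT (fun r => F (Y r.+1) - F (Y r))).
  by rewrite (telescope_sumr (fun r => F (Y r))) // Yn Y00 Fint subrr.
have telf : \sum_(r < n) (fl (D%:R * Y r.+1) - fl (D%:R * Y r)) = D%:R.
  rewrite -(big_mkord xpredT (fun r => fl (D%:R * Y r.+1) - fl (D%:R * Y r))).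
  rewrite (telescope_sumr (fun r => fl (D%:R * Y r))) // Yn Y00 mulrDr mulr1.
  by rewrite (flDi _ D%:Z) addrAC subrr add0r.
have -> : riemann F n (y + s) - riemann F n y =
  - \sum_(r < n) (n%:R * s * (F (Y r.+1) - F (Y r)) - (F (Y r + s) - F (Y r))).
  rewrite sumrB -mulr_sumr tel mulr0 sub0r opprK sumrB; congr (_ - _).
  by apply: eq_bigr => r _; rewrite /Y addrAC.
rewrite normrN (le_trans (ler_norm_sum _ _ _)) //.
apply: (@le_trans _ _ (\sum_(r < n) s * (`|g (uv r).2 - g (uv r).1| +
   2 * B * (fl (D%:R * Y r.+1) - fl (D%:R * Y r))))).
  by apply: ler_sum => r _; have [] := Huv r (ltn_ord r).
rewrite -mulr_sumr big_split /= -mulr_sumr telf mulrC ler_pM //.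
  rewrite addr_ge0 ?mulr_ge0 //; by apply: sumr_ge0.
by rewrite lerD2r.
Qed.

(** Riemann sums with [n] nodes have period [1 / n], so [y] can be moved into the first cell and [z]
    to within [1 / n] to the right of it. *)
Lemma quad_close n y z : (0 < n)%N -> irr y -> irr z ->
  `|riemann F n y - riemann F n z| <= (M + 2 * B * D%:R) / n%:R.
Proof.
move=> n0 yI zI; have n0' : 0 < n%:R :> R by rewrite ltr0n.
have V0 : 0 < n%:R^-1 :> R by rewrite invr_gt0.
have red (x : R) : 0 <= x - fl (n%:R * x) / n%:R < n%:R^-1.
  have /andP[h1 h2] := floor_itv (n%:R * x).
  have xE : n%:R * (x - fl (n%:R * x) / n%:R) = n%:R * x - fl (n%:R * x).
    by rewrite mulrBr [n%:R * (_ / _)]mulrCA divff ?gt_eqF // mulr1.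
  apply/andP; split; first by rewrite -(pmulr_rge0 _ n0') xE subr_ge0.
  by rewrite -(ltr_pM2l n0') xE divff ?gt_eqF //; move: h2; rewrite intrD; lra.
have Ired (x : R) (m : int) : irr x -> irr (x - m%:~R / n%:R).
  move=> xI; have := irrDr x (- (m%:~R / n%:R)) xI.
  by rewrite rmorphN fmorph_div /= ratr_int ratr_nat.
pose y0 := y - fl (n%:R * y) / n%:R.
pose z0 := z - fl (n%:R * (z - y0)) / n%:R.
have y0I : irr y0 by exact: Ired.
have z0I : irr z0 by exact: Ired.
have -> : riemann F n y = riemann F n y0.
  by rewrite -(riemann_shift F n y0 (Num.floor (n%:R * y))) // /y0 subrK.
have -> : riemann F n z = riemann F n (y0 + (z0 - y0)).
  rewrite addrC subrK.
  by rewrite -(riemann_shift F n z0 (Num.floor (n%:R * (z - y0)))) // /z0 subrK.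
have /andP[h1 h2] := red y; have /andP[h3 h4] := red (z - y0).
have zE : z0 - y0 = z - y0 - fl (n%:R * (z - y0)) / n%:R by rewrite /z0; ring.
rewrite distrC; apply: quad_core => //.
- by rewrite addrC subrK.
- by rewrite lt_neqAle eq_sym irr_neq0.
- by rewrite zE.
- by rewrite zE ltW.
Qed.

(* Refining [n] nodes to [n k] multiplies the sum by [k] up to [k E / n]; compare with
   the crude bound [V] and let [k] tend to infinity. *)
Lemma quadrature (m V : R) :
  (forall n y, (0 < n)%N -> irr y -> `|riemann F n y - n%:R * m| <= V) ->
  forall n y, (0 < n)%N -> irr y ->
    `|riemann F n y - n%:R * m| <= (M + 2 * B * D%:R) / n%:R.
Proof.
move=> HV n y n0 yI; have n0' : 0 < n%:R :> R by rewrite ltr0n.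
set E := _ / _.
have key k : (0 < k)%N -> k%:R * `|riemann F n y - n%:R * m| <= V + k%:R * E.
  move=> k0; have k0' : 0 < k%:R :> R by rewrite ltr0n.
  have -> : k%:R * `|riemann F n y - n%:R * m| =
     `|(riemann F (n * k) y - (n * k)%:R * m) - (riemann F (n * k) y - k%:R * riemann F n y)|.
    rewrite -{1}(ger0_norm (ltW k0')) -normrM natrM; congr `|_|; ring.
  rewrite (le_trans (ler_normB _ _)) // lerD //.
    by apply: HV => //; rewrite muln_gt0 n0.
  have -> : riemann F (n * k) y =
     \sum_(i < k) riemann F n (y + i%:R / (n * k)%:R).
    rewrite /riemann.
    rewrite -(big_mkord xpredT (fun i : nat => F (y + i%:R / (n * k)%:R))) sum_blocks.
    rewrite big_mkord exchange_big /=; apply: eq_bigr => i _; apply: eq_bigr => r _.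
    congr F; rewrite natrD !natrM; field; lra.
  have -> : k%:R * riemann F n y = \sum_(i < k) riemann F n y.
    by rewrite sumr_const card_ord mulr_natl.
  rewrite -sumrB (le_trans (ler_norm_sum _ _ _)) //.
  have -> : k%:R * E = \sum_(i < k) E by rewrite sumr_const card_ord mulr_natl.
  apply: ler_sum => i _; apply: quad_close => //.
  by have := irrDr y (i%:R / (n * k)%:R) yI; rewrite fmorph_div /= !ratr_nat; exact.
apply/ler_addgt0Pr => eps eps0.
pose k := (Num.truncn (`|V| / eps)).+1.
have Vk : V <= k%:R * eps.
  rewrite (le_trans (ler_norm V)) // -ler_pdivrMr // ltW //; exact: truncnS_gt.
have k0' : 0 < k%:R :> R by rewrite ltr0n.
rewrite -(ler_pM2l k0') (le_trans (key k isT)) // mulrDr addrC lerD2l //.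
Qed.

End Core.
End Quadrature.

(** * Riemann sums against the Lebesgue integral *)

Section RiemannSums.
Context {R : realType}.
Implicit Types (f g : R -> R) (y z s t : R) (n : nat).
Local Notation fl x := ((Num.floor x)%:~R : R).
Notation lam := (@lebesgue_measure R).

Definition unit_itv : set R := `[0, 1]%classic.

Lemma measurable_fun_countable f (A : set R) : countable A -> measurable_fun A f.
Proof.
move=> cA mA Y mY; apply: countable_measurable => //.
exact: sub_countable (subset_card_le (@subIsetl _ _ _)) cA.
Qed.

Lemma cellwise_measurable (D : nat) f g (B : R) : (0 < D)%N ->
  cellwise_smooth D f g B -> measurable_fun unit_itv f.
Proof.
move=> D0 [_ fd _ _].
have D0' : 0 < D%:R :> R by rewrite ltr0n.
pose U : set R := \bigcup_(k in setT) `](k%:R / D%:R), (k.+1%:R / D%:R)[%classic.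
have mU : measurable_fun U f.
  apply/measurable_fun_bigcup => // k.
  apply: open_continuous_measurable_fun; first exact: interval_open.
  move=> x /set_mem /=; rewrite in_itv /= => xk.
  apply/differentiable_continuous/derivable1_diffP.
  have [|_ xg] := cell_itv D k x D0; first by rewrite intrD -!pmulrn natr1.
  by have [] := fd x xg.
have mU' : measurable U by apply: bigcup_measurable.
pose G : set R := [set x | exists k : nat, x = k%:R / D%:R].
have cG : countable G.
  have -> : G = range (fun k : nat => k%:R / D%:R).
    by apply/seteqP; split=> x [k]; [move=> ->; exists k|move=> _ <-; exists k].
  exact: card_le_trans (card_image_le _ _) (countableP _).
have mG : measurable G by apply: countable_measurable.
apply: (measurable_funS _ _ (_ : measurable_fun (U `|` G) f)).
- exact: measurableU.
- move=> x; rewrite /unit_itv /= in_itv /= => /andP[x0 x1].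
  have Dx : 0 <= x * D%:R by rewrite mulr_ge0 // ltW.
  have /andP[h1 h2] := truncn_itv Dx.
  have [E|E] := eqVneq ((Num.truncn (x * D%:R))%:R / D%:R) x.
    by right; exists (Num.truncn (x * D%:R)).
  left; exists (Num.truncn (x * D%:R)) => //=; rewrite in_itv /= lt_neqAle E /=.
  by rewrite ler_pdivrMr // h1 ltr_pdivlMr.
- apply/measurable_funU => //; split=> //; exact: measurable_fun_countable.
Qed.

Definition unit_cell n r : set R := `[(r%:R / n%:R), (r.+1%:R / n%:R)[%classic.

Lemma measurable_unit_cell n r : measurable (unit_cell n r).
Proof. exact: measurable_itv. Qed.

Lemma unit_cellE n r t : (0 < n)%N -> 0 <= t ->
  (t \in unit_cell n r) = (Num.truncn (n%:R * t) == r).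
Proof.
move=> n0 t0; have n0' : 0 < n%:R :> R by rewrite ltr0n.
rewrite truncn_eq ?mulr_ge0 // /unit_cell mem_setE in_itv /=.
by rewrite ler_pdivrMr // ltr_pdivlMr // mulrC.
Qed.

Lemma step_sum n (c : nat -> R) t : (0 < n)%N -> 0 <= t -> t < 1 ->
  \sum_(r < n) c r * \1_(unit_cell n r) t = c (Num.truncn (n%:R * t)).
Proof.
move=> n0 t0 t1; have n0' : 0 < n%:R :> R by rewrite ltr0n.
have rn : (Num.truncn (n%:R * t) < n)%N.
  by rewrite truncn_lt_nat ?mulr_ge0 // gtr_pMr.
rewrite (bigD1 (Ordinal rn)) //= indicE unit_cellE // eqxx mulr1 big1 ?addr0 //.
move=> r rE; rewrite indicE unit_cellE //.
have -> : (Num.truncn (n%:R * t) == r) = false; last by rewrite mulr0.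
by apply/negbTE; apply: contraNneq rE => E; apply/eqP/val_inj.
Qed.

Lemma lebesgue_unit_cell n r : (r < n)%N ->
  lam (unit_cell n r `&` @irr01 R) = (n%:R^-1)%:E.
Proof.
move=> rn; have n0' : 0 < n%:R :> R by rewrite ltr0n; case: n rn.
have -> : unit_cell n r `&` @irr01 R = unit_cell n r `&` [set x | irr x].
  apply/seteqP; split=> x [xr]; first by case.
  move=> xI; split=> //; split=> //; move: xr; rewrite /unit_cell /= in_itv /=.
  move=> /andP[h1 h2]; rewrite (le_trans _ h1) ?divr_ge0 // (lt_le_trans h2) //.
  by rewrite ler_pdivrMr // mul1r ler_nat.
rewrite lebesgue_irr; last exact: measurable_itv.
rewrite /unit_cell lebesgue_measure_itv /= lte_fin ltr_pM2r ?invr_gt0 //.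
rewrite ltr_nat ltnSn -EFinB -mulrBl -natr1 addrAC subrr add0r mul1r //.
Qed.

Let A := @irr01 R.
Let mA : measurable A. Proof. exact: measurable_irr01. Qed.
Let finA : (lam A < +oo)%E. Proof. by rewrite lebesgue_irr01 ltry. Qed.

Lemma integrable_irr01 f (C : R) : measurable_fun A f ->
  (forall t, A t -> `|f t| <= C) -> lam.-integrable A (EFin \o f).
Proof.
move=> mf fC; apply: measurable_bounded_integrable => //.
exists C; split; first exact: num_real.
by move=> x Cx t At; apply: le_trans (fC _ At) _; exact: ltW.
Qed.

Lemma measurable_step n (c : nat -> R) :
  measurable_fun A (fun t => \sum_(r < n) c r * \1_(unit_cell n r) t).
Proof.
apply: measurable_sum => r; apply: measurable_funM => //.
exact: measurable_indic (measurable_unit_cell n r).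
Qed.

Lemma integrable_step n (c : nat -> R) : (0 < n)%N ->
  lam.-integrable A (EFin \o (fun t => \sum_(r < n) c r * \1_(unit_cell n r) t)).
Proof.
move=> n0; apply: (integrable_irr01 _ (\sum_(r < n) `|c r|)).
  exact: measurable_step.
move=> t [_ /andP[t0 t1]]; rewrite (le_trans (ler_norm_sum _ _ _)) //.
apply: ler_sum => r _; rewrite normrM ler_piMr // indicE.
by case: (_ \in _); rewrite ?normr1 ?normr0.
Qed.

Lemma integral_step n (c : nat -> R) : (0 < n)%N ->
  (\int[lam]_(t in A) (\sum_(r < n) c r * \1_(unit_cell n r) t)%:E)%E =
  ((\sum_(r < n) c r) / n%:R)%:E.
Proof.
move=> n0; have n0' : 0 < n%:R :> R by rewrite ltr0n.
under eq_integral do rewrite -sumEFin.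
rewrite integral_sum //; last first.
  move=> r; apply: (integrable_irr01 _ `|c r|).
    by apply: measurable_funM => //; exact: measurable_indic (measurable_unit_cell n r).
  move=> t _; rewrite normrM ler_piMr // indicE.
  by case: (_ \in _); rewrite ?normr1 ?normr0.
rewrite mulr_suml -sumEFin; apply: eq_bigr => r _.
under eq_integral do rewrite EFinM.
rewrite integralZl //; last first.
  apply: (integrable_irr01 _ 1); first exact: measurable_indic (measurable_unit_cell n r).
  by move=> t _; rewrite indicE; case: (_ \in _); rewrite ?normr1 ?normr0.
have -> := @integral_indic _ _ _ lam A mA _ (measurable_unit_cell n r).
by rewrite EFinM; congr (_ * _)%E; exact: lebesgue_unit_cell.
Qed.

(** The estimates live on irrational points while the mean is an integral over the closed interval;
    the rationals are a null set. *)
Lemma Rintegral_irr01 f : measurable_fun unit_itv f ->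
  lam.-integrable A (EFin \o f) ->
  (Rintegral lam unit_itv f)%:E = (\int[lam]_(t in A) (f t)%:E)%E.
Proof.
move=> mf fi.
have AE : A = unit_itv `\` range (@ratr R).
  rewrite /A irr01_itv irrE -setDE /unit_itv; apply/seteqP; split=> x [/=].
    by rewrite !in_itv /= => /andP[-> /ltW ->].
  rewrite !in_itv /= => /andP[-> x1] xI; split=> //=.
  rewrite lt_neqAle x1 andbT; apply/eqP => xE; apply: xI; exists 1 => //.
  by rewrite rmorph1.
have mQ : measurable (range (@ratr R)).
  by apply: countable_measurable => //; exact: countable_ratr.
have Q0 : lam (range (@ratr R)) = 0%E.
  by apply: countable_lebesgue_measure0; exact: countable_ratr.
have mEf : measurable_fun unit_itv (EFin \o f) by exact/measurable_EFinP.
have munit : measurable unit_itv by exact: measurable_itv.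
have fi1 : lam.-integrable unit_itv (EFin \o f).
  have [_] := negligible_integrable (mu := lam) mQ munit mEf Q0.
  by rewrite -AE; apply.
rewrite /Rintegral (negligible_integral (mu := lam) mQ munit fi1 Q0) -AE fineK //.
exact: integrable_fin_num.
Qed.

Lemma riemann_compare f n y (w : nat -> R) : (0 < n)%N ->
  measurable_fun unit_itv f -> lam.-integrable A (EFin \o f) ->
  (forall t, A t -> let r := Num.truncn (n%:R * t) in
     `|f t - f (y + r%:R / n%:R)| <= w r) ->
  `|riemann f n y - n%:R * Rintegral lam unit_itv f| <= \sum_(r < n) w r.
Proof.
move=> n0 mf fi fw; have n0' : 0 < n%:R :> R by rewrite ltr0n.
pose c r := f (y + r%:R / n%:R).
pose st t := \sum_(r < n) c r * \1_(unit_cell n r) t.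
pose wt t := \sum_(r < n) w r * \1_(unit_cell n r) t.
have mfA : measurable_fun A f.
  apply: (measurable_funS _ _ mf); first exact: measurable_itv.
  by move=> t [_ /andP[t0 t1]]; rewrite /unit_itv /= in_itv /= t0 ltW.
have sti := integrable_step n c n0; have wti := integrable_step n w n0.
have mst := measurable_step n c; have mwt := measurable_step n w.
have mfs : measurable_fun A (fun t => ((f t)%:E - (st t)%:E)%E).
  by apply/measurable_EFinP; exact: measurable_funB.
have le1 : (`|\int[lam]_(t in A) ((f t)%:E - (st t)%:E)| <=
            \int[lam]_(t in A) (wt t)%:E)%E.
  apply: (@le_trans _ _ (\int[lam]_(t in A) `|(f t)%:E - (st t)%:E|)%E).
    exact: (le_abse_integral lam mA mfs).
  apply: ge0_le_integral => //.
  - exact: measurableT_comp.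
  - exact/measurable_EFinP.
  - move=> t At; case: (At) => _ /andP[t0 t1].
    by rewrite -EFinB abse_EFin lee_fin /st /wt !step_sum //; exact: fw.
move: le1; rewrite integralB_EFin // -Rintegral_irr01 // !integral_step //.
rewrite -EFinB abse_EFin lee_fin => le1.
set m := Rintegral _ _ _ in le1 *; set S := \sum_(r < n) c r in le1.
have -> : riemann f n y - n%:R * m = - (n%:R * (m - S / n%:R)).
  by rewrite /riemann -/S; field; rewrite gt_eqF.
by rewrite normrN normrM normr_nat mulrC -ler_pdivlMr.
Qed.

End RiemannSums.

Section Structure.
Context {R : realType}.
Implicit Types (f g F : R -> R) (J : nat -> R) (y z s t : R) (n D : nat).
Local Notation fl x := ((Num.floor (x : R))%:~R : R).
Notation lam := (@lebesgue_measure R).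

(* [J k] is the jump [f(k/D-) - f(k/D+)]. Orbit points are irrational, so [F] need
   only be controlled there; its values at the breakpoints are irrelevant. *)
Definition saw_decomposition f D J F (B E m : R) : Prop :=
  [/\ forall x, f x = F x + saw_comb D J x,
      forall x (k : int), F (x + k%:~R) = F x,
      forall y z, irr y -> irr z -> `|F y - F z| <= B * `|y - z| &
      forall n y, (0 < n)%N -> irr y -> `|riemann F n y - n%:R * m| <= E / n%:R].

Lemma saw_comb_bound D J x : `|saw_comb D J x| <= \sum_(k < D) `|J k|.
Proof.
rewrite (le_trans (ler_norm_sum _ _ _)) //; apply: ler_sum => k _.
by rewrite normrM ler_piMr // (le_trans (saw_bound _)) //; lra.
Qed.

Lemma riemann_saw_comb D J n y : (0 < n)%N ->
  `|riemann (saw_comb D J) n y| <= \sum_(k < D) `|J k|.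
Proof.
move=> n0; rewrite /riemann /saw_comb exchange_big /=.
rewrite (le_trans (ler_norm_sum _ _ _)) //; apply: ler_sum => k _.
rewrite -mulr_sumr normrM ler_piMr //.
under eq_bigr => i _ do rewrite addrAC.
rewrite saw_hermite // (le_trans (saw_bound _)) //; lra.
Qed.

(** Supplies the crude bound, uniform in [n], that [quadrature] sharpens. Over all cells the
    Lipschitz parts add up to [B], and each sawtooth contributes total length 1 and one crossed
    integer. *)
Lemma riemann_integral_bound f F J D (B : R) : (0 < D)%N -> 0 <= B ->
  (forall x, f x = F x + saw_comb D J x) ->
  (forall x (k : int), F (x + k%:~R) = F x) ->
  (forall y z, irr y -> irr z -> `|F y - F z| <= B * `|y - z|) ->
  measurable_fun unit_itv f ->
  forall n y, (0 < n)%N -> irr y ->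
    `|riemann f n y - n%:R * Rintegral lam unit_itv f| <=
      B + 2 * \sum_(k < D) `|J k|.
Proof.
move=> D0 B0 fE Fint Flip mf n y n0 yI.
have n0' : 0 < n%:R :> R by rewrite ltr0n.
have V0 : 0 < n%:R^-1 :> R by rewrite invr_gt0.
set SJ := \sum_(k < D) _.
have fint x (k : int) : f (x + k%:~R) = f x by rewrite !fE Fint saw_combDi.
(* After a shift by a multiple of [1 / n], the node [y + r / n] and the points of cell [r] share a
   window of length [1 / n]. *)
wlog y01 : y yI / 0 <= y <= n%:R^-1.
  move=> H; pose y0 := y - fl (n%:R * y) / n%:R.
  have y0I : irr y0.
    have := irrDr y (- ((Num.floor (n%:R * y))%:~R / n%:R)) yI.
    by rewrite rmorphN fmorph_div /= ratr_int ratr_nat.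
  rewrite -(subrK (fl (n%:R * y) / n%:R) y) (riemann_shift f n y0) //.
  apply: H => //.
  have /andP[h1 h2] := floor_itv (n%:R * y).
  have y0E : n%:R * y0 = n%:R * y - fl (n%:R * y).
    by rewrite /y0 mulrBr [n%:R * (_ / _)]mulrCA divff ?gt_eqF // mulr1.
  apply/andP; split; first by rewrite -(pmulr_rge0 _ n0') y0E subr_ge0.
  by rewrite -(ler_pM2l n0') y0E divff ?gt_eqF //; move: h2; rewrite intrD; lra.
have fbd t : irr01 t -> `|f t| <= `|F y| + B * (1 + `|y|) + SJ.
  move=> [tI /andP[t0 t1]]; rewrite fE (le_trans (ler_normD _ _)) // lerD ?saw_comb_bound //.
  have -> : F t = F y + (F t - F y) by ring.
  rewrite (le_trans (ler_normD _ _)) // lerD2l (le_trans (Flip _ _ tI yI)) //.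
  by rewrite ler_wpM2l // (le_trans (ler_normB _ _)) // lerD2r ger0_norm // ltW.
have mfA : measurable_fun (@irr01 R) f.
  apply: (measurable_funS _ _ mf); first exact: measurable_itv.
  by move=> x [_ /andP[x0 x1]]; rewrite /unit_itv /= in_itv /= x0 ltW.
have fi := integrable_irr01 f _ mfA fbd.
pose w (r : nat) := B * n%:R^-1 + \sum_(k < D) `|J k| * (n%:R^-1 +
   (fl (r.+1%:R / n%:R - k%:R / D%:R) - fl (r%:R / n%:R - k%:R / D%:R))).
have -> : B + 2 * SJ = \sum_(r < n) w r.
  rewrite big_split /= sumr_const card_ord -[_ *+ n]mulr_natr divfK ?gt_eqF //.
  congr (_ + _); rewrite exchange_big /= mulr_sumr; apply: eq_bigr => k _.
  rewrite -mulr_sumr mulrC; congr (_ * _).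
  rewrite big_split /= sumr_const card_ord -[_ *+ n]mulr_natr mulVf ?gt_eqF //.
  rewrite -(big_mkord xpredT (fun r => fl (r.+1%:R / n%:R - k%:R / D%:R) -
                                       fl (r%:R / n%:R - k%:R / D%:R))).
  rewrite (telescope_sumr (fun r => fl (r%:R / n%:R - k%:R / D%:R))) // divff ?gt_eqF //.
  rewrite mul0r add0r [1 - _]addrC -[X in fl (_ + X)]/(1%:~R) flDi.
  by rewrite addrAC subrr add0r.
apply: riemann_compare => // t tA /=.
set r := Num.truncn _.
case: (tA) => tI /andP[t0 t1].
have /andP[r1 r2] := truncn_itv (mulr_ge0 (ltW n0') t0).
have yrI : irr (y + r%:R / n%:R).
  by have := irrDr y (r%:R / n%:R) yI; rewrite fmorph_div /= !ratr_nat; exact.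
have rS : r.+1%:R / n%:R = r%:R / n%:R + n%:R^-1 :> R by rewrite -natr1 mulrDl div1r.
have t1' : r%:R / n%:R <= t by rewrite ler_pdivrMr // mulrC.
have t2' : t <= r%:R / n%:R + n%:R^-1 by rewrite -rS ler_pdivlMr // mulrC ltW.
rewrite !fE [`|_|](_ : _ = `|(F t - F (y + r%:R / n%:R)) +
   (saw_comb D J t - saw_comb D J (y + r%:R / n%:R))|); last by congr `|_|; ring.
rewrite (le_trans (ler_normD _ _)) // lerD //.
  by rewrite (le_trans (Flip _ _ tI yrI)) // ler_wpM2l // ler_norml; lra.
rewrite /saw_comb -sumrB (le_trans (ler_norm_sum _ _ _)) //.
apply: ler_sum => k _; rewrite -mulrBr normrM ler_wpM2l // rS.
rewrite [_ + n%:R^-1 - _]addrAC.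
by apply: saw_close; move: y01 t1' t2'; lra.
Qed.

Lemma pw_smooth_saw_decomposition f (q : rat) : pw_smooth_rat_disc f ->
  exists D J F (B E : R), [/\ (0 < D)%N, 0 <= B, 0 <= E,
    saw_decomposition f D J F B E (Rintegral lam `[0, 1] f) &
    (exists k, (k < D)%N /\ J k != 0) /\ exists z : int, D%:R * ratr q = z%:~R :> R].
Proof.
move=> /(pw_smooth_cellwise f q)[D [g [B [D0 B0 Hf qz [k [L [kD L0 fL]]]]]]].
have D0' : 0 < D%:R :> R by rewrite ltr0n.
have [J [B' [B'0 Fint Flip [c0 Fmvt] Jump]]] := cellwise_decomposition D f g B D0 B0 Hf.
set F := fun x => f x - saw_comb D J x.
have fE x : f x = F x + saw_comb D J x by rewrite subrK.
have mf := cellwise_measurable D f g B D0 Hf.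
have HV := riemann_integral_bound f F J D B' D0 B'0 fE Fint Flip mf.
have [_ _ _ [M HM]] := Hf.
have M0 : 0 <= M.
  by have := HM (fun=> 0) 0%N; rewrite big_ord0; apply => // i _; rewrite lexx ltr01.
(* By [hermite] the sawtooth part has bounded Riemann sums, so [F] inherits the crude bound with the
   mean of [f]. *)
have HV' n y : (0 < n)%N -> irr y ->
    `|riemann F n y - n%:R * Rintegral lam unit_itv f| <=
    (B' + 2 * \sum_(k < D) `|J k|) + \sum_(k < D) `|J k|.
  move=> n0 yI.
  have -> : riemann F n y = riemann f n y - riemann (saw_comb D J) n y.
    by rewrite /riemann -sumrB.
  rewrite addrAC (le_trans (ler_normB _ _)) // lerD ?riemann_saw_comb //.
  exact: HV.
have Q := quadrature D F g M B' c0 D0 B'0 HM Fint Flip Fmvt _ _ HV'.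
exists D, J, F, B', (M + 2 * B' * D%:R); split=> //.
- by rewrite addr_ge0 // mulr_ge0 // mulr_ge0.
- split=> //; exists k; split=> //.
  suff -> : J k = L by [].
  have cJ : (fun d : R => f (k%:R / D%:R - d) - f (k%:R / D%:R + d)) @ 0^'+ --> J k.
    apply/cvgrPdist_le => e e0; near=> d.
    have d0 : 0 < d by near: d; exact: nbhs_right_gt.
    have dD : d < D%:R^-1 by near: d; apply: nbhs_right_lt; rewrite invr_gt0.
    have de : d < e / (2 * B + 1).
      by near: d; apply: nbhs_right_lt; rewrite divr_gt0 //; lra.
    rewrite distrC (le_trans (Jump k kD d d0 dD)) //.
    move: de; rewrite ltr_pdivlMr; last by lra.
    have := mulr_ge0 (ltW d0) B0.
    have -> : d * (2 * B + 1) = 2 * (d * B) + d by ring.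
    have -> : 2 * B * d = 2 * (d * B) by ring.
    set u := d * B; lra.
  exact: (cvg_unique _ cJ fL).
Unshelve. all: by end_near. Qed.

End Structure.

(** * Birkhoff sums *)

Section ApproximationError.
Context {R : realType}.
Variable alpha : R.
Hypothesis aI : irr01 alpha.

Notation q := (cf_q alpha).
Notation p := (cfp (cf_a alpha)).

Let a_gt0 i : (0 < i)%N -> (0 < cf_a alpha i)%N. Proof. exact: cf_a_gt0. Qed.

Lemma cf_q_gt0 k : (0 < q k)%N. Proof. exact: cfq_gt0. Qed.

(* [q_k^2 |alpha - p_k / q_k|] *)
Definition cf_tau k : R := (q k)%:R / ((q k.+1)%:R + (q k)%:R * cf_x alpha k.+1).

Lemma cf_x_gt0 k : 0 < cf_x alpha k < 1. Proof. exact/irr01_gt0/cf_x_irr01. Qed.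

Lemma cf_tau_gt0 k : 0 < cf_tau k.
Proof.
have /andP[x0 _] := cf_x_gt0 k.+1.
by rewrite divr_gt0 ?ltr0n ?cf_q_gt0 // addr_gt0 ?mulr_gt0 ?ltr0n ?cf_q_gt0.
Qed.

Lemma cf_tauV k : (cf_tau k)^-1 = (q k.+1)%:R / (q k)%:R + cf_x alpha k.+1.
Proof.
have q0 : (q k)%:R != 0 :> R by rewrite pnatr_eq0 -lt0n cf_q_gt0.
by rewrite /cf_tau invf_div mulrDl mulrAC divff // mul1r.
Qed.

Lemma cf_tau_le k : (cf_a alpha k.+1)%:R <= (cf_tau k)^-1.
Proof.
have q0 : 0 < (q k)%:R :> R by rewrite ltr0n cf_q_gt0.
have /andP[x0 _] := cf_x_gt0 k.+1.
rewrite cf_tauV; apply: (@le_trans _ _ ((q k.+1)%:R / (q k)%:R)); last by rewrite lerDl ltW.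
rewrite ler_pdivlMr // -natrM ler_nat [q k.+1]cfqS; exact: leq_addr.
Qed.

Lemma cf_tau_le1 k : cf_tau k <= 1.
Proof.
rewrite -[leRHS]invr1 -[leLHS]invrK lef_pV2 ?posrE ?invr_gt0 ?cf_tau_gt0 //.
by rewrite (le_trans _ (cf_tau_le k)) // ler1n cf_a_gt0.
Qed.

(** [p_k / q_k] and [alpha] are the values of [mob] at the tails 0 and [cf_x alpha k], so [mobB]
    gives the signed error exactly; [x_k (a_(k+1) + x_(k+1)) = 1] brings it to the form of
    [cf_tau]. *)
Lemma cf_approx k : exists d : R, alpha = (p k)%:R / (q k)%:R + d /\
  (-1) ^+ k * cf_tau k = (q k)%:R ^+ 2 * d.
Proof.
exists (alpha - (p k)%:R / (q k)%:R); split; first by ring.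
have /andP[x0 x1] := cf_x_gt0 k.
have mE : alpha = mob (cf_a alpha) k (cf_x alpha k) by rewrite mob_cf.
have m0 : (p k)%:R / (q k)%:R = mob (cf_a alpha) k 0 :> R.
  by rewrite /mob !mulr0 !addr0.
rewrite m0 {2}mE mobB ?(ltW x0) // mulr0 addr0 subr0.
have q0 : 0 < (q k)%:R :> R by rewrite ltr0n cf_q_gt0.
have den := mob_den_gt0 (cf_a alpha) a_gt0 k _ (ltW x0).
rewrite /cf_tau [(q k.+1)]cfqS.
have y1 := cf_xV alpha k aI; have /andP[y0 _] := cf_x_gt0 k.+1.
have {y1} : cf_x alpha k * ((cf_a alpha k.+1)%:R + cf_x alpha k.+1) = 1.
  by rewrite -y1 divff // gt_eqF.
move: den; rewrite natrD natrM -/(cf_q alpha k).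
set Q := (q k)%:R in q0 *; set Q' := (cfq1 _ k)%:R.
set x := cf_x alpha k in x0 x1 *; set y := cf_x alpha k.+1 in y0 *.
set a := (cf_a alpha k.+1)%:R => den xy.
have Q'0 : 0 <= Q' by [].
have a0 : 0 <= a by [].
have den' : 0 < a * Q + Q' + Q * y.
  have : 0 < Q * y by rewrite mulr_gt0.
  have : 0 <= a * Q by rewrite mulr_ge0 // ltW.
  lra.
have xden : x * (a * Q + Q' + Q * y) = Q + Q' * x.
  have -> : x * (a * Q + Q' + Q * y) = Q * (x * (a + y)) + Q' * x by ring.
  by rewrite xy mulr1.
have -> : Q / (a * Q + Q' + Q * y) = Q ^+ 2 * (x / ((Q + Q' * x) * Q)).
  by rewrite -xden; field; rewrite !gt_eqF.
by rewrite mulrCA !mulrA.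
Qed.

End ApproximationError.

Section BirkhoffSums.
Context {R : realType}.
Variables (f F : R -> R) (J : nat -> R) (D : nat) (B E m : R) (r0 : rat) (alpha : R).
Hypotheses (D0 : (0 < D)%N) (B0 : 0 <= B) (E0 : 0 <= E).
Hypothesis Hf : saw_decomposition f D J F B E m.
Hypothesis aI : irr01 alpha.

Notation q := (cf_q alpha).
Notation x0 := (ratr r0 : R).
Let SJ := \sum_(k < D) `|J k|.
Let SJ0 : 0 <= SJ. Proof. exact: sumr_ge0. Qed.

Lemma orbit_irr i : irr (i.+1%:R * alpha + x0).
Proof.
apply: irrDr; rewrite mulrC -[i.+1%:R](ratr_nat R); apply: irrMr.
  by rewrite pnatr_eq0.
by case: aI.
Qed.

Definition birkhoff (g : R -> R) (j N : nat) : R :=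
  \sum_(0 <= i < N) g ((j + i).+1%:R * alpha + x0).

Lemma birkhoffD g j N M : birkhoff g j (N + M) = birkhoff g j N + birkhoff g (j + N) M.
Proof.
rewrite /birkhoff (@big_cat_nat _ _ _ N) ?leq_addr //=; congr (_ + _).
rewrite -{1}[N]add0n big_addn addKn; apply: eq_bigr => i _.
by rewrite [(i + N)%N]addnC addnA.
Qed.

Lemma birkhoff_split j N : birkhoff f j N =
  birkhoff F j N + \sum_(k < D) J k * birkhoff (fun x => saw (x - k%:R / D%:R)) j N.
Proof.
case: Hf => fE _ _ _; rewrite /birkhoff (eq_bigr _ (fun i _ => fE _)) big_split /=.
congr (_ + _); rewrite /saw_comb exchange_big /=; apply: eq_bigr => k _.
by rewrite mulr_sumr.
Qed.

(** Moving the orbit to the nodes [y + i p / q_k] shifts each point by at most [q_k |d|], which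
    costs [B cf_tau] in total; [E / q_k] is the quadrature error. Hence [b] blocks with
    [b cf_tau <= 1] cost only [B + b E / q_k]. *)
Lemma birkhoff_F_block j k :
  `|birkhoff F j (q k) - (q k)%:R * m| <= B * cf_tau alpha k + E / (q k)%:R.
Proof.
case: Hf => _ Fint Flip FQ.
have [d [aE dE]] := cf_approx alpha aI k.
have n0 := cf_q_gt0 alpha aI k; set n := q k in n0 dE aE *.
have n0' : 0 < n%:R :> R by rewrite ltr0n.
pose p := cfp (cf_a alpha) k.
have cpn : coprime p n by apply: coprime_cfp => i; exact: cf_a_gt0.
pose y := j.+1%:R * alpha + x0.
have yI : irr y by exact: orbit_irr.
have ndE : n%:R * (n%:R * `|d|) = cf_tau alpha k.
  rewrite mulrA -expr2 -[in RHS](ger0_norm (ltW (cf_tau_gt0 alpha aI k))).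
  rewrite -[RHS](@normrMsign _ (odd k)) signr_odd dE normrM.
  by rewrite [`|n%:R ^+ 2|]ger0_norm // exprn_ge0.
have -> : birkhoff F j n - n%:R * m =
   (\sum_(i < n) (F ((j + i).+1%:R * alpha + x0) - F (y + (i * p)%:R / n%:R)))
   + (riemann F n y - n%:R * m).
  rewrite /riemann -(sum_coprime _ F n p y n0 cpn Fint) sumrB /birkhoff big_mkord.
  by ring.
rewrite (le_trans (ler_normD _ _)) // lerD ?FQ //.
rewrite (le_trans (ler_norm_sum _ _ _)) //.
rewrite -ndE mulrCA.
have -> : n%:R * (B * (n%:R * `|d|)) = \sum_(i < n) B * (n%:R * `|d|).
  by rewrite sumr_const card_ord mulr_natl.
apply: ler_sum => i _.
have ypI : irr (y + (i * p)%:R / n%:R).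
  by have := irrDr y ((i * p)%:R / n%:R) yI; rewrite fmorph_div /= !ratr_nat; exact.
rewrite (le_trans (Flip _ _ (orbit_irr _) ypI)) // ler_wpM2l //.
have -> : (j + i).+1%:R * alpha + x0 - (y + (i * p)%:R / n%:R) = i%:R * d.
  rewrite /y -!natr1 natrD {1 2}aE -/p natrM; field; exact: lt0r_neq0.
by rewrite normrM normr_nat ler_wpM2r // ler_nat ltnW.
Qed.

Lemma saw_birkhoff_block v j k :
  `|birkhoff (fun x => saw (x - v)) j (q k)| <= 4.
Proof.
have [d [aE dE]] := cf_approx alpha aI k.
have n0 := cf_q_gt0 alpha aI k; set n := q k in n0 dE aE *.
have cpn : coprime (cfp (cf_a alpha) k) n.
  by apply: coprime_cfp => i; exact: cf_a_gt0.
have nd : n%:R ^+ 2 * `|d| <= 1.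
  rewrite -[n%:R ^+ 2]ger0_norm ?exprn_ge0 // -normrM -dE normrMsign.
  by rewrite ger0_norm ?(ltW (cf_tau_gt0 alpha aI k)) // cf_tau_le1.
have := saw_denjoy n _ d (j%:R * alpha + x0 - v) n0 cpn nd.
rewrite -aE /birkhoff big_mkord; congr (`|_| <= _); apply: eq_bigr => i _.
by congr saw; rewrite -addnS natrD; ring.
Qed.

Let V := B + E + 4 * SJ.

Lemma denjoy_koksma j k : `|birkhoff f j (q k) - (q k)%:R * m| <= V.
Proof.
rewrite birkhoff_split addrAC (le_trans (ler_normD _ _)) // /V lerD //.
  rewrite (le_trans (birkhoff_F_block j k)) // lerD //.
    by rewrite ler_piMr // cf_tau_le1.
  by rewrite ler_pdivrMr ?ltr0n ?cf_q_gt0 // ler_peMr // ler1n cf_q_gt0.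
rewrite (le_trans (ler_norm_sum _ _ _)) // mulr_sumr; apply: ler_sum => i _.
by rewrite normrM mulrC ler_wpM2r // saw_birkhoff_block.
Qed.

Let V0 : 0 <= V.
Proof. by rewrite !addr_ge0 ?mulr_ge0. Qed.

Lemma birkhoff_blocks g j b n (c : R) :
  (forall i, `|birkhoff g i n - n%:R * m| <= c) ->
  `|birkhoff g j (b * n) - (b * n)%:R * m| <= b%:R * c.
Proof.
move=> H; elim: b => [|b IH].
  by rewrite mul0n /birkhoff big_nil !mul0r subr0 normr0.
rewrite mulSnr birkhoffD natrD mulrDl opprD addrACA -natr1 mulrDl mul1r.
by rewrite (le_trans (ler_normD _ _)) // lerD.
Qed.

(** Greedy Ostrowski expansion: at most [a_(k+1)] blocks of length [q_k], each within [V], then a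
    remainder below [q_k]. The start [j] is arbitrary because the remainder begins where the blocks
    end. *)
Lemma ostrowski_bound k : forall j N, (N < q k)%N ->
  `|birkhoff f j N - N%:R * m| <= V * (dsum alpha k)%:R.
Proof.
elim: k => [|k IH] j N.
  rewrite ltnS leqn0 => /eqP ->.
  by rewrite /birkhoff big_nil mul0r subr0 normr0 mulr_ge0.
move=> Nq; have n0 := cf_q_gt0 alpha aI k.
have bE := divn_eq N (q k); set b := (N %/ q k)%N in bE.
have ba : (b <= cf_a alpha k.+1)%N.
  rewrite -ltnS /b ltn_divLR // (leq_trans Nq) // [q k.+1]cfqS mulSn addnC leq_add2r.
  by apply: cfq1_le => i; exact: cf_a_gt0.
rewrite bE birkhoffD natrD mulrDl opprD addrACA (le_trans (ler_normD _ _)) //.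
have -> : V * (dsum alpha k.+1)%:R =
    (cf_a alpha k.+1)%:R * V + V * (dsum alpha k)%:R.
  by rewrite dsumS natrD; ring.
apply: lerD; last by apply: IH; rewrite ltn_mod.
apply: le_trans (birkhoff_blocks f j b (q k) V _) _.
  by move=> i; exact: denjoy_koksma.
by rewrite ler_wpM2r // ler_nat.
Qed.

(** The use of the congruence: with [n = c D + 1] and [D v] an integer, [n v] and [v] differ by an
    integer. *)
Lemma saw2_mul n v t : (0 < n)%N -> n = 1 %[mod D] ->
  (exists z : int, D%:R * v = z%:~R) -> saw2 (n%:R * v + t) = saw2 (v + t) :> R.
Proof.
move=> n0 nD [z zE].
have /dvdnP[c cE] : (D %| n - 1)%N by rewrite -eqn_mod_dvd //; apply/eqP.
have -> : n%:R * v + t = v + t + (c%:Z * z)%:~R.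
  have -> : n = (c * D + 1)%N by rewrite -cE subnK.
  by rewrite natrD natrM mulrDl -mulrA zE intrM -!pmulrn; ring.
by rewrite saw2Di.
Qed.

Hypothesis Dr0 : exists z : int, D%:R * x0 = z%:~R.

Let I t := saw2_comb D J (x0 + t) - saw2_comb D J x0.

(** Inside the bracket, [9 SJ] comes from the sawtooth blocks, [B + b E / q_k] from the blocks of
    [F], and the last term from the remainder of [N] modulo [q_k]. *)
Lemma birkhoff_main k N (b : nat) (th : R) : q k = 1 %[mod D] -> (N < q k.+1)%N ->
  b = (N %/ q k)%N -> th = (-1) ^+ k * cf_tau alpha k ->
  `|th * (birkhoff f 0 N - N%:R * m) - I (b%:R * th)| <=
  cf_tau alpha k * (9 * SJ + B + b%:R * E / (q k)%:R + V * (dsum alpha k)%:R).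
Proof.
move=> nD Nq bE thE.
have n0 := cf_q_gt0 alpha aI k.
have tau0 := cf_tau_gt0 alpha aI k; have tau1 := cf_tau_le1 alpha aI k.
have [d [aE dE]] := cf_approx alpha aI k.
have cpn : coprime (cfp (cf_a alpha) k) (q k).
  by apply: coprime_cfp => i; exact: cf_a_gt0.
have thn : `|th| = cf_tau alpha k by rewrite thE normrMsign ger0_norm // ltW.
have bq : (b * q k <= N)%N by rewrite bE leq_trunc_div.
(* The complete blocks fit below [q_(k+1)], so the accumulated rotation stays within one turn, as
   [saw_birkhoff] assumes. *)
have bth : b%:R * cf_tau alpha k <= 1.
  rewrite -ler_pdivlMr // mul1r cf_tauV //.
  have /andP[x1 _] := cf_x_gt0 alpha aI k.+1.
  apply: (@le_trans _ _ ((q k.+1)%:R / (q k)%:R)); last by rewrite lerDl ltW.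
  rewrite ler_pdivlMr ?ltr0n //.
  by rewrite -natrM ler_nat (leq_trans bq) // ltnW.
have NE : N = (b * q k + N %% q k)%N by rewrite bE -divn_eq.
pose SS (i : nat) := birkhoff (fun x => saw (x - i%:R / D%:R)) 0 (b * q k).
have sawE (i : 'I_D) : `|th * SS i -
    (saw2 (x0 - i%:R / D%:R + b%:R * th) - saw2 (x0 - i%:R / D%:R))| <=
    9 * cf_tau alpha k.
  have Dv : exists z : int, D%:R * (x0 - i%:R / D%:R) = z%:~R.
    case: Dr0 => z zE; exists (z - i%:Z); rewrite mulrBr zE mulrCA divff ?mulr1 ?intrB //.
    by rewrite pnatr_eq0 -lt0n.
  have := saw_birkhoff (q k) _ d (x0 - i%:R / D%:R) th b n0 cpn (etrans thE dE).
  rewrite thn => /(_ bth tau1).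
  rewrite saw2_mul // -[in saw2 ((q k)%:R * _)](addr0 ((q k)%:R * _)) saw2_mul // addr0.
  rewrite -aE /SS /birkhoff; congr (`|_ * _ - _| <= _); apply: eq_bigr => j _.
  by congr saw; rewrite add0n addrA.
have FE : `|birkhoff F 0 (b * q k) - (b * q k)%:R * m| <= B + b%:R * E / (q k)%:R.
  apply: le_trans (birkhoff_blocks F 0 b (q k) (B * cf_tau alpha k + E / (q k)%:R) _) _.
    by move=> i; exact: birkhoff_F_block.
  have -> : b%:R * (B * cf_tau alpha k + E / (q k)%:R) =
    B * (b%:R * cf_tau alpha k) + b%:R * E / (q k)%:R by ring.
  by rewrite lerD2r ler_piMr.
have RE : `|birkhoff f (0 + b * q k) (N %% q k) - (N %% q k)%:R * m| <= V * (dsum alpha k)%:R.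
  by apply: ostrowski_bound; rewrite ltn_mod.
have IE : I (b%:R * th) = \sum_(i < D) J i *
    (saw2 (x0 - i%:R / D%:R + b%:R * th) - saw2 (x0 - i%:R / D%:R)).
  rewrite /I /saw2_comb -sumrB; apply: eq_bigr => i _.
  by rewrite mulrBr [x0 + _ - _]addrAC.
rewrite NE birkhoffD birkhoff_split IE natrD mulrDl.
set X := birkhoff F 0 _ in FE *; set Y := birkhoff f _ _ in RE *.
set u := (b * q k)%:R * m in FE *; set w := (N %% q k)%:R * m in RE *.
have -> : th * (X + \sum_(i < D) J i * SS i + Y - (u + w)) -
   \sum_(i < D) J i * (saw2 (x0 - i%:R / D%:R + b%:R * th) - saw2 (x0 - i%:R / D%:R))
  = \sum_(i < D) J i * (th * SS i -
     (saw2 (x0 - i%:R / D%:R + b%:R * th) - saw2 (x0 - i%:R / D%:R)))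
  + th * ((X - u) + (Y - w)).
  have -> : \sum_(i < D) J i * (th * SS i -
     (saw2 (x0 - i%:R / D%:R + b%:R * th) - saw2 (x0 - i%:R / D%:R))) =
     th * (\sum_(i < D) J i * SS i) -
     \sum_(i < D) J i * (saw2 (x0 - i%:R / D%:R + b%:R * th) - saw2 (x0 - i%:R / D%:R)).
    by rewrite mulr_sumr -sumrB; apply: eq_bigr => i _; ring.
  by ring.
set T := cf_tau alpha k in tau0 tau1 bth thn sawE *.
have -> : T * (9 * SJ + B + b%:R * E / (q k)%:R + V * (dsum alpha k)%:R) =
  9 * T * SJ + T * ((B + b%:R * E / (q k)%:R) + V * (dsum alpha k)%:R) by ring.
rewrite (le_trans (ler_normD _ _)) // lerD //.
  rewrite (le_trans (ler_norm_sum _ _ _)) // /SJ mulr_sumr; apply: ler_sum => i _.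
  by rewrite normrM mulrC ler_wpM2r //; exact: sawE.
rewrite normrM thn ler_wpM2l ?(ltW tau0) //.
by rewrite (le_trans (ler_normD _ _)) // lerD.
Qed.

End BirkhoffSums.

(** * Upper density from windows of positive proportion *)

Section UpperDensity.
Context {R : realType}.

Lemma limn_esup_ge (u : (\bar R)^nat) (c : \bar R) :
  (forall n, exists2 m, (n <= m)%N & (c <= u m)%E) -> (c <= limn_esup u)%E.
Proof.
move=> H; rewrite limn_esup_lim; apply: lime_ge; first exact: is_cvg_esups.
apply: nearW => n; have [m nm cm] := H n.
by apply: le_trans cm _; apply: ereal_sup_ubound; exists m.
Qed.

Lemma upper_density_gt0 (X : set nat) (b1 rho : R) :
  0 <= b1 -> 0 < rho -> b1 + rho <= 1 ->
  (forall M : nat, exists2 Q : nat, (M <= Q)%N &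
     forall N : nat, b1 * Q%:R <= N%:R <= (b1 + rho) * Q%:R -> X N) ->
  (0 < upper_density R X)%E.
Proof.
move=> b10 rho0 b11 H.
apply: (@lt_le_trans _ _ (rho / 2)%:E); first by rewrite lte_fin divr_gt0.
apply: limn_esup_ge => n.
(* Forces [rho Q > n + 2]: this gives [M >= n], and a window that loses one integer to rounding
   still holds [rho Q / 2] of them. *)
have [Q nQ HQ] := H (Num.truncn ((n%:R + 2) / rho)).+1.
have Q0' : (n%:R + 2) / rho < Q%:R.
  by apply: lt_le_trans (truncnS_gt _) _; rewrite ler_nat.
have {Q0'}Qn : n%:R + 2 < Q%:R * rho by rewrite -ltr_pdivrMr.
have Q0 : 0 < Q%:R :> R.
  by rewrite -(pmulr_lgt0 _ rho0) (lt_trans _ Qn) // ltr_wpDl.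
pose M := Num.truncn ((b1 + rho) * Q%:R).
have M0 : 0 <= (b1 + rho) * Q%:R by rewrite mulr_ge0 // ?ltW // ltr_wpDl.
have /andP[M1 M2] := truncn_itv M0; rewrite -/M in M1 M2.
pose L := (Num.truncn (b1 * Q%:R)).+1.
have L1 : b1 * Q%:R < L%:R by exact: truncnS_gt.
have L2 : L%:R <= b1 * Q%:R + 1.
  by rewrite -natr1 lerD2r truncn_le mulr_ge0 // ltW.
have bQ0 : 0 <= b1 * Q%:R by rewrite mulr_ge0 // ltW.
have n0 := ler0n R n.
rewrite mulrC in Qn; rewrite -natr1 mulrDl in M2.
have nM : (n <= M)%N.
  rewrite -ltnS -(ltr_nat R) -natr1 (le_lt_trans _ M2) //.
  by move: Qn; set x := rho * Q%:R; lra.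
have MQ : M%:R <= Q%:R :> R.
  by rewrite (le_trans M1) // ler_piMl // ltW.
have Mpos : 0 < M%:R :> R by move: M2 Qn; set x := rho * Q%:R; lra.
have LM : (L <= M.+1)%N.
  rewrite -(ler_nat R) (le_trans L2) // -natr1 lerD2r.
  by move: M2 Qn; set x := rho * Q%:R; lra.
exists M => //; rewrite lee_fin ler_pdivlMr //.
apply: (@le_trans _ _ (\sum_(L <= N < M.+1) (1 : R))).
  rewrite sumr_const_nat natrB // -natr1.
  have : rho / 2 * M%:R <= rho * Q%:R / 2.
    by rewrite mulrAC ler_pM2r // ler_pM2l.
  move: M2 Qn L2; set x := rho * Q%:R; set l := L%:R; set mm := M%:R.
  by set y := b1 * Q%:R; set z := rho / 2 * mm; lra.
rewrite (@big_cat_nat _ _ _ L 1 M.+1) //= -[leLHS]add0r lerD ?sumr_ge0 //.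
rewrite big_nat_cond [leRHS]big_nat_cond; apply: ler_sum => N; rewrite andbT ltnS.
move=> /andP[LN NM]; rewrite indicE mem_set //; apply: HQ.
apply/andP; split; first by rewrite (le_trans (ltW L1)) // ler_nat.
by rewrite (le_trans _ M1) // ler_nat.
Qed.

End UpperDensity.

(** * The lower bound on a window of [N] *)

Section MainEstimate.
Context {R : realType}.

Lemma cf_K_eq (alpha : R) k N : irr01 alpha ->
  (cf_q alpha k <= N)%N -> (N < cf_q alpha k.+1)%N -> cf_K alpha N = k.+1.
Proof.
move=> aI kN Nk; rewrite /cf_K; case: pselect => [ex|]; last first.
  by case; exists k.+1; rewrite kN Nk.
case: ex_minnP => K /and3P[K0 KN NK] Kmin.
have mono : {homo cf_q alpha : i j / (i <= j)%N}.
  by apply: cfq_le => i; exact: cf_a_gt0.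
apply/eqP; rewrite eqn_leq Kmin /=; last by rewrite kN Nk.
rewrite ltnNge; apply/negP => Kk.
have := leq_ltn_trans kN NK; rewrite ltnNge => /negP; apply; exact: mono.
Qed.

Variables (f F : R -> R) (J : nat -> R) (D : nat) (B E m : R) (r0 : rat) (alpha : R).
Hypotheses (D0 : (0 < D)%N) (B0 : 0 <= B) (E0 : 0 <= E).
Hypothesis Hf : saw_decomposition f D J F B E m.
Hypothesis aI : irr01 alpha.
Hypothesis Dr0 : exists z : int, D%:R * (ratr r0 : R) = z%:~R.

Notation q := (cf_q alpha).
Let SJ := \sum_(k < D) `|J k|.
Let V := B + E + 4 * SJ.
Let I t := saw2_comb D J (ratr r0 + t) - saw2_comb D J (ratr r0).

Variables (t0 eta rho : R) (A : nat).
Hypotheses (eta0 : 0 < eta) (I0 : `|I t0| = 4 * eta).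
Hypotheses (rho0 : 0 < rho) (rhoI : 4 * SJ * rho <= eta).
Hypotheses (rho1 : 2 * rho <= t0) (rho2 : 2 * rho <= 1 - t0).
Hypotheses (A1 : (9 * SJ + B + V) / eta <= A%:R) (A2 : 4 / rho <= A%:R) (A3 : (0 < A)%N).

(** For odd [k] the rotation is negative, and [-(1 - t0)] is congruent to [t0] modulo 1. *)
Let target (e : bool) : R := if e then 1 - t0 else t0.

(** Of [|I t0| = 4 eta], one [eta] is spent on the distance from [b th] to [t0] modulo 1, two on the
    error of [birkhoff_main], and one is left. Division by [cf_tau <= 1 / a_(k+1)] gives
    [eta a_(k+1)], and [a_(k+1)] is at least half of the digit sum up to [k + 1]. *)
Lemma large_sum k N : (0 < k)%N -> q k = 1 %[mod D] ->
  (A * dsum alpha k <= cf_a alpha k.+1)%N -> E / eta <= (q k)%:R ->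
  (target (odd k) - rho / 2) * (q k.+1)%:R <= N%:R <=
    (target (odd k) + rho / 2) * (q k.+1)%:R ->
  [/\ (q k <= N)%N, (N < q k.+1)%N &
    eta / 2 * (dsum alpha k.+1)%:R <=
      (-1) ^+ odd k * Num.sg (I t0) * (birkhoff r0 alpha f 0 N - N%:R * m)].
Proof.
move=> k0 qD aA Eq /andP[N1 N2].
move: eta0 rho0 rho1 rho2 rhoI B0 E0 => eta_gt0 rho_gt0 rho_le1 rho_le2 rho_leI B_ge0 E_ge0.
have tg : 2 * rho <= target (odd k) /\ 2 * rho <= 1 - target (odd k).
  by rewrite /target; case: odd; split; lra.
set t := target (odd k) in N1 N2 tg; have [tg1 tg2] := tg.
have n0 : 0 < (q k)%:R :> R by rewrite ltr0n cf_q_gt0.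
have Q0 : 0 < (q k.+1)%:R :> R by rewrite ltr0n cf_q_gt0.
have tau0 := cf_tau_gt0 alpha aI k; have tauV := cf_tauV alpha aI k.
have taule := cf_tau_le alpha aI k.
have /andP[x0 x1] := cf_x_gt0 alpha aI k.+1.
have ds1 : 1 <= (dsum alpha k)%:R :> R.
  rewrite ler1n /dsum big_ltn // addn_gt0 cf_a_gt0 //.
set a := (cf_a alpha k.+1)%:R : R in taule *.
set ds := (dsum alpha k)%:R : R in ds1 *.
have aAds : A%:R * ds <= a by rewrite -natrM ler_nat.
have A1' : 1 <= A%:R :> R by rewrite ler1n.
have dsa : ds <= a by rewrite (le_trans _ aAds) // ler_peMl //; lra.
have a4 : 4 / rho <= a.
  by rewrite (le_trans A2) // (le_trans _ aAds) // ler_peMr //; lra.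
have a0 : 0 < a by rewrite (lt_le_trans _ a4) // divr_gt0.
have a4' : 4 <= rho * a by rewrite mulrC -ler_pdivrMr.
have Qan : a * (q k)%:R <= (q k.+1)%:R.
  by rewrite -natrM ler_nat [q k.+1]cfqS leq_addr.
have NQ : N%:R < (q k.+1)%:R :> R.
  rewrite (le_lt_trans N2) // gtr_pMl //; lra.
have nN : (q k)%:R <= N%:R :> R.
  apply: le_trans N1.
  apply: (@le_trans _ _ (rho * (a * (q k)%:R))).
    by rewrite mulrA ler_peMl //; lra.
  by apply: ler_pM => //; [lra|rewrite mulr_ge0 // ltW|lra].
split; [by rewrite -(ler_nat R)|by rewrite -(ltr_nat R)|].
set tau := cf_tau alpha k in tau0 tauV taule *.
pose b := (N %/ q k)%N.
pose th := (-1) ^+ k * tau.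
have bn1 : b%:R * (q k)%:R <= N%:R :> R by rewrite -natrM ler_nat leq_trunc_div.
have bn2 : N%:R < (b%:R + 1) * (q k)%:R :> R.
  by rewrite natr1 -natrM ltr_nat ltn_ceil // cf_q_gt0.
have nQ1 : (q k)%:R / (q k.+1)%:R <= a^-1.
  by rewrite ler_pdivrMr // ler_pdivlMl.
have tau_n : tau <= (q k)%:R / (q k.+1)%:R.
  rewrite -[leLHS]invrK tauV -[leRHS]invrK lef_pV2 ?posrE ?invr_gt0 ?invf_div; first lra.
    by rewrite addr_gt0 // divr_gt0.
  by rewrite divr_gt0.
have aV : a^-1 <= rho / 4.
  by rewrite -[leLHS]mul1r ler_pdivrMr //; lra.
have bt1 : b%:R * tau <= N%:R / (q k.+1)%:R.
  apply: (@le_trans _ _ (b%:R * ((q k)%:R / (q k.+1)%:R))); first by rewrite ler_wpM2l.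
  by rewrite mulrA ler_pM2r ?invr_gt0.
have NQ1 : N%:R / (q k.+1)%:R <= 1 :> R by rewrite ler_pdivrMr // mul1r ltW.
(* One [a^-1] pays for rounding [N / q_k] down to [b], the other for replacing [tau / q_k] by
   [1 / q_(k+1)]. *)
have bt2 : N%:R / (q k.+1)%:R - 2 * a^-1 <= b%:R * tau.
  set nn := (q k)%:R in n0 bn2 nQ1 tau_n tauV nN *.
  set QQ := (q k.+1)%:R in Q0 nQ1 tau_n tauV NQ1 NQ *.
  have h1 : N%:R * (tau / nn) - tau <= b%:R * tau.
    have : N%:R / nn * tau <= (b%:R + 1) * tau.
      by rewrite ler_wpM2r ?(ltW tau0) // ler_pdivrMr // ltW.
    have -> : N%:R * (tau / nn) = N%:R / nn * tau by rewrite mulrCA mulrC.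
    by rewrite mulrDl mul1r; set z := _ * tau; set y := _ * tau; lra.
  have tE : tau / nn = (QQ + nn * cf_x alpha k.+1)^-1.
    rewrite -[tau]invrK tauV; field; rewrite !gt_eqF //=.
    by rewrite addr_gt0 ?mulr_gt0.
  have h2 : N%:R / QQ - nn / QQ <= N%:R * (tau / nn).
    have QX : 0 < QQ + nn * cf_x alpha k.+1 by rewrite addr_gt0 ?mulr_gt0.
    rewrite tE ler_pdivlMr // -mulrBl.
    have -> : (N%:R - nn) / QQ * (QQ + nn * cf_x alpha k.+1) =
       N%:R - nn + (N%:R - nn) * (nn * cf_x alpha k.+1) / QQ.
      by field; rewrite gt_eqF.
    have : (N%:R - nn) * (nn * cf_x alpha k.+1) / QQ <= nn.
      rewrite ler_pdivrMr // mulrC -!mulrA ler_pM2l //.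
      apply: (@le_trans _ _ (1 * QQ)); last by rewrite mul1r.
      apply: ler_pM; [exact: ltW|by rewrite subr_ge0|exact: ltW|].
      by rewrite lerBlDr (le_trans (ltW NQ)) // lerDl ltW.
    lra.
  lra.
(* Half of [rho] is the window, the other half covers [2 a^-1], by [A >= 4 / rho]. *)
have btt : `|b%:R * tau - t| <= rho.
  have N1' : t - rho / 2 <= N%:R / (q k.+1)%:R by rewrite ler_pdivlMr.
  have N2' : N%:R / (q k.+1)%:R <= t + rho / 2 by rewrite ler_pdivrMr.
  by rewrite ler_norml; lra.
have Ibt : `|I (b%:R * th) - I t0| <= eta.
  have [u uE ut] : exists2 u, I (b%:R * th) = I u & `|u - t0| <= rho.
    move: btt; rewrite /t /target /th -signr_odd; case: odd => btt.
      exists (1 - b%:R * tau); last first.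
        by rewrite (_ : 1 - b%:R * tau - t0 = - (b%:R * tau - (1 - t0))) ?normrN //; ring.
      rewrite /I -(saw2_combDi _ _ (ratr r0 + _) 1); congr (saw2_comb _ _ _ - _).
      by rewrite expr1; ring.
    by exists (b%:R * tau) => //; rewrite expr0 mul1r.
  rewrite uE /I [X in `|X|](_ : _ = saw2_comb D J (ratr r0 + u) - saw2_comb D J (ratr r0 + t0)).
    rewrite (le_trans (saw2_comb_lip _ _ _ _)) // opprD addrACA subrr add0r.
    by rewrite (le_trans _ rhoI) // ler_wpM2l ?mulr_ge0 // sumr_ge0.
  by ring.
have main := birkhoff_main f F J D B E m r0 alpha D0 B0 E0 Hf aI Dr0 k N b th qD
  (ltac:(by rewrite -(ltr_nat R))) erefl erefl.
rewrite -/SJ -/V -/(I _) -/tau -/ds in main.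
set X := birkhoff r0 alpha f 0 N - N%:R * m in main *.
have SJ0 : 0 <= SJ by exact: sumr_ge0.
have taua : tau * a <= 1 by rewrite -ler_pdivlMl // mulr1.
have err : tau * (9 * SJ + B + b%:R * E / (q k)%:R + V * ds) <= 2 * eta.
  have e1 : tau * (b%:R * E / (q k)%:R) <= eta.
    have -> : tau * (b%:R * E / (q k)%:R) = (b%:R * tau) * (E / (q k)%:R) by ring.
    apply: (@le_trans _ _ (1 * (E / (q k)%:R))).
      by apply: ler_wpM2r; [rewrite divr_ge0 // ltW|exact: le_trans bt1 NQ1].
    by rewrite mul1r ler_pdivrMr // mulrC -ler_pdivrMr.
  have e2 : tau * ((9 * SJ + B + V) * ds) <= eta.
    apply: (@le_trans _ _ (tau * (eta * a))).
      rewrite ler_wpM2l ?(ltW tau0) //.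
      apply: (@le_trans _ _ (eta * A%:R * ds)).
        by rewrite ler_wpM2r // [eta * _]mulrC -ler_pdivrMr.
      by rewrite -mulrA ler_wpM2l // ltW.
    by rewrite mulrCA ler_piMr // ltW.
  have e3 : 9 * SJ + B <= (9 * SJ + B) * ds by rewrite ler_peMr //; lra.
  have e4 : tau * (9 * SJ + B) <= tau * ((9 * SJ + B) * ds).
    by rewrite ler_wpM2l // ltW.
  have -> : tau * (9 * SJ + B + b%:R * E / (q k)%:R + V * ds) =
     tau * (9 * SJ + B) + tau * (b%:R * E / (q k)%:R) + tau * (V * ds) by ring.
  move: e2; have -> : tau * ((9 * SJ + B + V) * ds) =
    tau * ((9 * SJ + B) * ds) + tau * (V * ds) by ring.
  move: e1 e4; set z1 := tau * (_ / _); set z2 := tau * (9 * SJ + B).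
  by set z3 := tau * (V * ds); set z4 := tau * (_ * ds); lra.
have close : `|th * X - I t0| <= 3 * eta.
  rewrite -(subrK (I (b%:R * th)) (th * X)) -addrA (le_trans (ler_normD _ _)) //.
  by move: main err Ibt; set z1 := `|_|; set z2 := `|_|; set z3 := tau * _; lra.
have sgI : Num.sg (I t0) * I t0 = 4 * eta by rewrite -normrEsg.
have sg1 : `|Num.sg (I t0)| = 1.
  by rewrite normr_sg -normr_gt0 I0 mulr_gt0.
have low : eta <= Num.sg (I t0) * (th * X).
  have : `|Num.sg (I t0) * (th * X - I t0)| <= 3 * eta by rewrite normrM sg1 mul1r.
  rewrite mulrBr sgI ler_norml; lra.
have -> : (-1) ^+ odd k * Num.sg (I t0) * X = tau^-1 * (Num.sg (I t0) * (th * X)).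
  by rewrite signr_odd /th; field; rewrite gt_eqF.
apply: (@le_trans _ _ (tau^-1 * eta)); last by rewrite ler_wpM2l // invr_ge0 ltW.
apply: (@le_trans _ _ (a * eta)); last by rewrite ler_wpM2r // ltW.
rewrite dsumS natrD -/ds -/a.
have -> : eta / 2 * (ds + a) = (ds + a) / 2 * eta by ring.
by rewrite ler_wpM2r ?(ltW eta0) //; lra.
Qed.

End MainEstimate.

Lemma S_N_birkhoff (R : realType) (f : R -> R) (alpha : R) (r0 : rat) N :
  S_N f alpha (ratr r0) N =
  birkhoff r0 alpha f 0 N - N%:R * Rintegral (@lebesgue_measure R) `[0, 1] f.
Proof. by rewrite /S_N /birkhoff big_add1. Qed.

Theorem theorem1p4 (R : realType) (f : R -> R) (q : rat) :
  pw_smooth_rat_disc f ->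
  {ae (@lebesgue_measure R), forall alpha : R,
     0 <= alpha < 1 -> (forall r : rat, alpha != ratr r) ->
     exists C : R, 0 < C /\
       (0 < upper_density R [set N : nat | (S_N f alpha (ratr q) N >=
              C * (\sum_(1 <= i < (cf_K alpha N).+1) (cf_a alpha i)%:R))%R])%E /\
       (0 < upper_density R [set N : nat | (S_N f alpha (ratr q) N <=
              - (C * (\sum_(1 <= i < (cf_K alpha N).+1) (cf_a alpha i)%:R)))%R])%E}.
Proof.
move=> /(pw_smooth_saw_decomposition f q)
  [D [J [F [B [E [D0 B0 E0 Hf [[k0 [k0D Jk0]] Dq]]]]]]].
have [t0 [t00 t01 It0]] := saw2_comb_nonconst D J k0 (ratr q) k0D Jk0.
set m := Rintegral _ _ _ in Hf.
pose SJ := \sum_(k < D) `|J k|.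
have SJ0 : 0 <= SJ by exact: sumr_ge0.
pose It := saw2_comb D J (ratr q + t0) - saw2_comb D J (ratr q).
have ItN0 : It != 0 by rewrite subr_eq0.
pose eta := `|It| / 4.
have eta0 : 0 < eta by rewrite divr_gt0 // normr_gt0.
have I0 : `|It| = 4 * eta by rewrite /eta; lra.
(* The first bound lets [I] vary by at most [eta] within [rho]; the others keep the windows about
   [t0] and [1 - t0] inside the unit interval, with room to spare. *)
pose rho := Num.min (eta / (4 * SJ + 1)) (Num.min (t0 / 2) ((1 - t0) / 2)).
have SJ1 : 0 < 4 * SJ + 1 by lra.
have rho0 : 0 < rho by rewrite !lt_min !divr_gt0 //; lra.
have rhoI : 4 * SJ * rho <= eta.
  have : rho <= eta / (4 * SJ + 1) by rewrite ge_min lexx.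
  rewrite ler_pdivlMr //; have := rho0; rewrite mulrDr mulr1 [rho * _]mulrC.
  by set u := 4 * SJ * rho; lra.
have rho1 : 2 * rho <= t0.
  have : rho <= t0 / 2 by rewrite !ge_min lexx orbT.
  lra.
have rho2 : 2 * rho <= 1 - t0.
  have : rho <= (1 - t0) / 2 by rewrite !ge_min lexx !orbT.
  lra.
pose V := B + E + 4 * SJ.
pose A := (Num.truncn ((9 * SJ + B + V) / eta) + Num.truncn (4 / rho) + 2)%N.
have A1 : (9 * SJ + B + V) / eta <= A%:R.
  by rewrite (le_trans (ltW (truncnS_gt _))) // ler_nat /A addn2 ltnS leqW // leq_addr.
have A2 : 4 / rho <= A%:R.
  by rewrite (le_trans (ltW (truncnS_gt _))) // ler_nat /A addn2 ltnS leqW // leq_addl.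
have A3 : (0 < A)%N by rewrite /A addn2.
have density (alpha : R) (e : bool) : irr01 alpha ->
    (forall n, exists2 j, (n <= j)%N & big_digit D A (4 * j + 4 + e) alpha) ->
    (0 < upper_density R [set N : nat |
       (eta / 2 * (\sum_(1 <= i < (cf_K alpha N).+1) (cf_a alpha i)%:R) <=
       (-1) ^+ e * Num.sg It * S_N f alpha (ratr q) N)%R])%E.
  move=> aI Hbig.
  pose t := if e then 1 - t0 else t0.
  have [tg1 tg2] : 2 * rho <= t /\ 2 * rho <= 1 - t by rewrite /t; case: (e); split; lra.
  apply: (upper_density_gt0 _ (t - rho / 2) rho); [lra|lra|lra|] => M.
  have [j jM [_ qD aA]] := Hbig (M + (Num.truncn (E / eta)).+1)%N.
  set k := (4 * j + 4 + e).+2 in qD aA.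
  have ke : odd k = e by rewrite /k !oddS negbK (oddD (4 * j + 4)) (oddD (4 * j)) oddM; case: (e).
  have a_gt0 i : (0 < i)%N -> (0 < cf_a alpha i)%N by exact: cf_a_gt0.
  have kq : (j <= cf_q alpha k)%N.
    by apply: leq_trans (cfq_ge _ a_gt0 _); clear; lia.
  have qk : (cf_q alpha k <= cf_q alpha k.+1)%N by exact: cfq_leS.
  exists (cf_q alpha k.+1).
    by rewrite (leq_trans _ qk) // (leq_trans _ kq) // (leq_trans _ jM) // leq_addr.
  move=> N NQ.
  have Eq : E / eta <= (cf_q alpha k)%:R.
    rewrite (le_trans (ltW (truncnS_gt _))) // ler_nat (leq_trans _ kq) //.
    by rewrite (leq_trans _ jM) // leq_addl.
  have kpos : (0 < k)%N by [].
  have [|kN Nk H] := large_sum f F J D B E m q alpha D0 B0 E0 Hf aI Dq t0 eta rho A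
     eta0 I0 rho0 rhoI rho1 rho2 A1 A2 A3 k N kpos qD aA Eq.
    by rewrite ke -/t (_ : t + rho / 2 = t - rho / 2 + rho) //; lra.
  rewrite ke in H; rewrite /mkset S_N_birkhoff -/m (cf_K_eq alpha k N aI kN Nk).
  by rewrite -natr_sum.
have ae0 := @ae_big_digit R D A false D0 A3.
have ae1 := @ae_big_digit R D A true D0 A3.
apply: negligibleS (negligibleU ae0 ae1) => alpha nP; apply: contrapT.
move=> /not_orP[/contrapT H0 /contrapT H1]; apply: nP => a01 aI.
have aI01 : irr01 alpha by split.
have d0 := density alpha false aI01 (H0 aI01).
have d1 := density alpha true aI01 (H1 aI01).
exists (eta / 2); split; first by rewrite divr_gt0.
pose W N : R := \sum_(1 <= i < (cf_K alpha N).+1) (cf_a alpha i)%:R.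
suff sgn (s : R) : s = 1 \/ s = -1 ->
    (0 < upper_density R [set N : nat |
      (eta / 2 * W N <= s * S_N f alpha (ratr q) N)%R])%E.
  split.
    have := sgn 1 (or_introl erefl); congr (_ < upper_density R _)%E.
    by apply/seteqP; split=> N /=; rewrite mul1r.
  have := sgn (-1) (or_intror erefl); congr (_ < upper_density R _)%E.
  by apply/seteqP; split=> N /=; rewrite mulN1r lerNr.
move: d0 d1; rewrite expr0 expr1 mul1r mulN1r.
(* The sign of [I t0] is not known; if it is negative, even and odd indices exchange their roles. *)
have [->|->] : Num.sg It = 1 \/ Num.sg It = -1.
  by case: sgrP ItN0 => //; [left|right].
- by move=> d0 d1 [] ->.
- by rewrite opprK => d0 d1 [] ->.
Qed.
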